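(* Let $(M,d)$ be a complete separable metric space and $\mathcal T=(\mathcal T(t))_{t\ge0}$ a strong Feller semigroup on $B_b(M)$ of type $(C,\omega)$, with full generator $\mathcal L$ and Laplace transform $\mathcal R=(\mathcal R(\lambda))_{\mathrm{Re}\lambda>\omega}$. Let $B:D(B)\to B_b(M)$ be a linear operator, $D(B)\subset B_b(M)$ a subspace, with $D(\mathcal L)\subset D(B)$, such that (1) $B\mathcal R(\lambda)\in\mathcal L(B_b(M),\sigma)$ for one (equivalently, all) $\lambda$ with $\mathrm{Re}\lambda>\omega$; (2) for every $t>0$ the map $B\mathcal T(t)$, initially defined on $D(\mathcal L)$, has a (necessarily unique) extension to an operator in $\mathcal L(B_b(M),\sigma)$, still denoted $B\mathcal T(t)$; (3) for every $f\in B_b(M)$ and $\mu\in\mathcal M(M)$ the function $s\mapsto\langle B\mathcal T(s)f,\mu\rangle$ is measurable on $(0,\infty)$; (4) there is $\varphi\in L^1_{\mathrm{loc}}([0,\infty))$ with $\|B\mathcal T(s)\|\le\varphi(s)$ for all $s>0$. Then $\mathcal L+B:=\{(f,g+Bf):(f,g)\in\mathcal L\}$ is the full generator of a strong Feller semigroup $\mathscr P=(\mathscr P(t))_{t\ge0}$ which satisfies, for all $t\ge 0$, $$\mathscr P(t)f=\mathcal T(t)f+\int_0^t\mathscr P(t-s)B\mathcal T(s)f\,ds,\qquad f\in B_b(M),$$ where the integral is understood as an $\mathcal M(M)$-integral.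
   Context: $B_b(M)$, $C_b(M)$: bounded Borel measurable, respectively bounded continuous, (complex) scalar functions on $M$, with the supremum norm; $\mathcal M(M)$: complex Borel measures on $M$; $\langle f,\mu\rangle=\int f\,d\mu$; $\sigma=\sigma(B_b(M),\mathcal M(M))$ is the weak topology induced by $\mathcal M(M)$. $\mathcal L(B_b(M),\sigma)$ is the algebra of $\sigma$-continuous linear operators on $B_b(M)$; these are automatically norm bounded and are exactly the kernel operators $f\mapsto\int f(y)k(\cdot,dy)$ ($k(\cdot,A)$ measurable, $k(x,\cdot)\in\mathcal M(M)$, $\sup_x\|k(x,\cdot)\|_{TV}<\infty$). Convergence with respect to $\sigma$ is denoted $\rightharpoonup$; for sequences it means boundedness plus pointwise convergence. $T\in\mathcal L(B_b(M),\sigma)$ is a strong Feller operator if $TB_b(M)\subset C_b(M)$. A strong Feller semigroup is a family $(\mathcal T(t))_{t\ge0}\subset\mathcal L(B_b(M),\sigma)$ with $\mathcal T(0)=I$, $\mathcal T(t+s)=\mathcal T(t)\mathcal T(s)$; $\mathcal T(t)$ a strong Feller operator for every $t>0$; and $\mathcal T(t)f\rightharpoonup f$ as $t\downarrow0$ for all $f\in C_b(M)$. It is of type $(C,\omega)$ if $\|\mathcal T(t)\|\le Ce^{\omega t}$ for all $t\ge0$ (such $C\ge1$, $\omega\in\mathbb R$ always exist). Its Laplace transform is the family $\mathcal R(\lambda)\in\mathcal L(B_b(M),\sigma)$, $\mathrm{Re}\lambda>\omega$, with $\langle\mathcal R(\lambda)f,\mu\rangle=\int_0^\infty e^{-\lambda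 t}\langle\mathcal T(t)f,\mu\rangle dt$ for all $f\in B_b(M)$, $\mu\in\mathcal M(M)$. Its full generator is the (in general multi-valued) operator $\mathcal L\subset B_b(M)\times B_b(M)$ with $(\lambda-\mathcal L)^{-1}=\mathcal R(\lambda)$ as graphs, i.e. $\mathcal L=\{(\mathcal R(\lambda)h,\lambda\mathcal R(\lambda)h-h):h\in B_b(M)\}$ (independent of $\lambda$); $D(\mathcal L)=\{f:(f,g)\in\mathcal L\text{ for some }g\}$. The $\mathcal M(M)$-integral over an interval $J$ of a function $\Phi:J\to B_b(M)$ is the element $u\in B_b(M)$ with $\langle u,\mu\rangle=\int_J\langle\Phi(s),\mu\rangle ds$ for all $\mu\in\mathcal M(M)$; $\Phi$ is $\mathcal M(M)$-integrable if such an element exists for $\mathbf 1_A\Phi$ for every measurable $A\subset J$. *)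

(* Defs.v *)
From HB Require Import structures.
From mathcomp Require Import all_boot all_order all_algebra.
From mathcomp Require Import complex.
From mathcomp Require Import lra.
From mathcomp Require Import all_classical all_reals all_analysis.
From mathcomp Require Import measurable_realfun.

Set Implicit Arguments.
Unset Strict Implicit.
Unset Printing Implicit Defensive.

Import Order.TTheory GRing.Theory Num.Theory.
Import numFieldNormedType.Exports.

Local Open Scope classical_set_scope.
Local Open Scope ring_scope.

#[short(type="completeMetricType")]
HB.structure Definition CompleteMetric (K : numDomainType) :=
  {T of Complete T & Metric K T}.

Definition separable_space (T : topologicalType) : Prop :=
  exists2 D : set T, countable D & dense D.

Notation borel T := (g_sigma_algebraType (@open T)).

(* [R[i]] carries its norm topology only through the alias [_^o]; [Re] and [Im]
   are qualified because [Num.Re] and [Num.Im], which are R[i]-valued, shadow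
   the R-valued projections. *)
Notation Cplx R := (R[i]^o).
Notation Cre := (@complex.Re _).
Notation Cim := (@complex.Im _).
Notation Cabs := (@Normc.normc _).

Section complex_functions.
Context {R : realType}.

Lemma Cabs_Re (z : R[i]) : `|Cre z| <= Cabs z.
Proof.
case: z => a b /=; rewrite -sqrtr_sqr ler_sqrt ?addr_ge0 ?sqr_ge0//.
by rewrite lerDl sqr_ge0.
Qed.

Lemma Cabs_Im (z : R[i]) : `|Cim z| <= Cabs z.
Proof.
case: z => a b /=; rewrite -sqrtr_sqr ler_sqrt ?addr_ge0 ?sqr_ge0//.
by rewrite lerDr sqr_ge0.
Qed.

Lemma Cabs_le (z : R[i]) : Cabs z <= `|Cre z| + `|Cim z|.
Proof.
case: z => a b /=; rewrite -[leRHS]ger0_norm ?addr_ge0//.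
rewrite -sqrtr_sqr ler_sqrt ?sqr_ge0//.
by rewrite sqrrD !real_normK ?num_real// lerD2r lerDl mulrn_wge0// mulr_ge0.
Qed.

Lemma CnormE (z : R[i]) : `|z| = (Cabs z)%:C%C.
Proof. by []. Qed.

Lemma continuous_Cre : continuous (Cre : Cplx R -> R).
Proof.
move=> z A /nbhs_ballP[e/= e0 eA].
apply/nbhs_ballP; exists e%:C%C; first by rewrite /= ltcR.
move=> w; rewrite /ball/= CnormE ltcR => zw; apply: eA.
apply: le_lt_trans zw; rewrite /ball/=.
by rewrite -raddfB; exact: (Cabs_Re (z - w)).
Qed.

Lemma continuous_Cim : continuous (Cim : Cplx R -> R).
Proof.
move=> z A /nbhs_ballP[e/= e0 eA].
apply/nbhs_ballP; exists e%:C%C; first by rewrite /= ltcR.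
move=> w; rewrite /ball/= CnormE ltcR => zw; apply: eA.
apply: le_lt_trans zw; rewrite /ball/=.
by rewrite -raddfB; exact: (Cabs_Im (z - w)).
Qed.

Lemma measurable_complexP d (T : measurableType d) (D : set T) (f : T -> R[i]) :
  measurable D ->
  measurable_fun D (f : T -> borel (Cplx R)) <->
  measurable_fun D (Cre \o f) /\ measurable_fun D (Cim \o f).
Proof.
move=> mD; split.
  have key (p : Cplx R -> R) : continuous p ->
      measurable_fun D (f : T -> borel (Cplx R)) -> measurable_fun D (p \o f).
    move=> /continuousP cp mf.
    apply: (measurability _ (RGenOpens.measurableE R)).
    move=> _ [_ [a [b ->]] <-]; rewrite comp_preimage; apply: mf => //.
    by apply: sub_sigma_algebra; apply: cp; exact: interval_open.
  by move=> mf; split; apply: key => //;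
    [exact: continuous_Cre|exact: continuous_Cim].
move=> [mre mim].
apply: (@measurability _ _ T (borel (Cplx R)) D f (@open (Cplx R))) => //.
move=> _ [U oU <-].
pose box (k : rat * rat * rat) : set R[i] :=
  [set z | Cre z \in `]ratr k.1.1 - ratr k.2, ratr k.1.1 + ratr k.2] /\
           Cim z \in `]ratr k.1.2 - ratr k.2, ratr k.1.2 + ratr k.2]].
pose F k : set R[i] := if `[< box k `<=` U >] then box k else set0.
have UE : U = \bigcup_k F k.
  apply/seteqP; split; last first.
    by move=> z [k _]; rewrite /F; case: asboolP => // kU /kU.
  move=> z Uz.
  have [e e0 eU] : exists2 e : R, 0 < e & forall w, Cabs (z - w) < e -> U w.
    have /nbhs_ballP[[e1 e2]/=] := open_nbhs_nbhs (conj oU Uz).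
    rewrite ltcE/= => /andP[/eqP -> e0] eU; exists e1 => // w zw.
    by apply: eU; rewrite /ball/= CnormE ltcR.
  have [q q0 qe] : exists2 q : rat, 0 < (ratr q : R) & (ratr q : R) < e / 4.
    have /rat_in_itvoo[q] : 0 < e / 4 by rewrite divr_gt0.
    by rewrite in_itv/= => /andP[? ?]; exists q.
  have app (x : R) : exists p : rat, x - ratr q < ratr p < x + ratr q.
    have /rat_in_itvoo[p] : x - ratr q < x + ratr q by lra.
    by rewrite in_itv/= => ?; exists p.
  have [a /andP[a1 a2]] := app (Cre z).
  have [b /andP[b1 b2]] := app (Cim z).
  exists (a, b, q) => //; rewrite /F ifT.
    by rewrite /box/= !in_itv/=; split; lra.
  apply/asboolP => w; rewrite /box/= !in_itv/= => -[/andP[? ?] /andP[? ?]].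
  apply: eU; apply: le_lt_trans (Cabs_le _) _; rewrite !raddfB/=.
  have re : `|Cre z - Cre w| < e / 2 by rewrite ltr_norml; lra.
  have im : `|Cim z - Cim w| < e / 2 by rewrite ltr_norml; lra.
  by rewrite (splitr e) ltrD.
rewrite UE preimage_bigcup setI_bigcupr.
apply: countable_bigcupT_measurable => // k.
rewrite /F; case: asboolP => _; last by rewrite preimage_set0 setI0.
rewrite (_ : _ `&` _ =
  (D `&` (Cre \o f) @^-1` `]ratr k.1.1 - ratr k.2, ratr k.1.1 + ratr k.2]) `&`
  (D `&` (Cim \o f) @^-1` `]ratr k.1.2 - ratr k.2, ratr k.1.2 + ratr k.2])).
  by apply: measurableI; [exact: mre|exact: mim].
by apply/seteqP; split=> x /=; rewrite /box/=; tauto.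
Qed.

End complex_functions.

Definition cexp {R : realType} (z : R[i]) : R[i] :=
  Complex (expR (Cre z) * cos (Cim z)) (expR (Cre z) * sin (Cim z)).

Section complex_integral.
Context {R : realType} d (T : measurableType d).
Implicit Types (mu : {measure set T -> \bar R}) (D : set T) (f : T -> R[i]).

Definition cintegrable mu D f : Prop :=
  mu.-integrable D (EFin \o (Cre \o f)) /\ mu.-integrable D (EFin \o (Cim \o f)).

Definition cintegral mu D f : R[i] :=
  Complex (\int[mu]_(x in D) Cre (f x)) (\int[mu]_(x in D) Cim (f x)).

End complex_integral.

Section charge_integral.
Context {R : realType} d (T : measurableType d).

(* Any Hahn decomposition gives the same integral of a bounded function. *)
Definition hahn_pos (nu : {charge set T -> \bar R}) : set T :=
  sval (cid (Hahn_decomposition nu)).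

Definition hahn_neg (nu : {charge set T -> \bar R}) : set T :=
  sval (cid (svalP (cid (Hahn_decomposition nu)))).

Lemma hahnP (nu : {charge set T -> \bar R}) :
  hahn_decomposition nu (hahn_pos nu) (hahn_neg nu).
Proof. exact: svalP (cid (svalP (cid (Hahn_decomposition nu)))). Qed.

Definition charge_integral (nu : {charge set T -> \bar R}) (f : T -> R[i]) :
    R[i] :=
  cintegral (jordan_pos (hahnP nu)) setT f -
  cintegral (jordan_neg (hahnP nu)) setT f.

(* The complex measure [cmeas_re + i cmeas_im]; a charge is finite-valued. *)
Record cmeasure := CMeasure {
  cmeas_re : {charge set T -> \bar R} ;
  cmeas_im : {charge set T -> \bar R} }.

Definition cmeasure_integral (mu : cmeasure) (f : T -> R[i]) : R[i] :=
  charge_integral (cmeas_re mu) f + 'i%C * charge_integral (cmeas_im mu) f.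

End charge_integral.
Arguments cmeasure R {d} T.

Section bounded_borel.
Context {R : realType} (M : completeMetricType R).

Definition bounded_borel : {pred M -> R[i]^o} :=
  mem [set f : M -> R[i]^o |
    measurable_fun setT (f : borel M -> borel (Cplx R)) /\
    exists K : R, forall x, Cabs (f x) <= K].

Lemma bounded_borel_submod : submod_closed bounded_borel.
Proof.
split.
  rewrite inE/=; split; first exact: measurable_cst.
  by exists 0 => x; rewrite [leLHS](_ : _ = 0) //; exact: Normc.normc0.
move=> a f g; rewrite !inE/= => -[mf [K fK]] [mg [L gL]]; split; last first.
  exists (Cabs a * K + L) => x; apply: le_trans (le_normcD _ _) _.
  by rewrite lerD// Normc.normcM ler_wpM2l// -lecR -CnormE normr_ge0.
move: mf mg; rewrite !measurable_complexP// => -[fr fi] [gr gi]; split.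
  rewrite (_ : _ \o _ = fun x => Cre a * Cre (f x) - Cim a * Cim (f x) + Cre (g x)).
    by apply: measurable_funD => //; apply: measurable_funB;
      apply: measurable_funM.
  by apply/funext => x /=; rewrite !fctE; case: a (f x) (g x) => ? ? [? ?] [? ?].
rewrite (_ : _ \o _ = fun x => Cre a * Cim (f x) + Cim a * Cre (f x) + Cim (g x)).
  by apply: measurable_funD => //; apply: measurable_funD;
    apply: measurable_funM.
by apply/funext => x /=; rewrite !fctE; case: a (f x) (g x) => ? ? [? ?] [? ?].
Qed.

HB.instance Definition _ :=
  GRing.isSubmodClosed.Build R[i] (M -> R[i]^o) bounded_borel
    bounded_borel_submod.

Record Bb := MkBb { Bb_fun :> M -> R[i]^o ; _ : Bb_fun \in bounded_borel }.

HB.instance Definition _ := [isSub for Bb_fun].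
HB.instance Definition _ := [Choice of Bb by <:].
HB.instance Definition _ := [SubChoice_isSubLmodule of Bb by <:].

End bounded_borel.
Arguments Bb {R} M.

Section duality.
Context {R : realType} (M : completeMetricType R).

Definition pairing (f : Bb M) (mu : cmeasure R (borel M)) : R[i] :=
  cmeasure_integral mu f.

End duality.

(* The coarsest topology making every [pairing^~ mu] continuous. *)
Notation sigma_top M :=
  (initial_topology (@pairing _ M : Bb M -> {ptws cmeasure _ (borel M) -> Cplx _})).

Section operators.
Context {R : realType} (M : completeMetricType R).
Implicit Types (f g h : Bb M) (T B : Bb M -> Bb M) (L : set (Bb M * Bb M)).

Definition sigma_operator T : Prop :=
  linear T /\ continuous (T : sigma_top M -> sigma_top M).

Definition supnorm f : R := sup [set Cabs (f x) | x in [set: M]].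

(* Extended-real valued, so that an unbounded operator has norm [+oo]. *)
Definition opnorm T : \bar R :=
  ereal_sup [set (supnorm (T f))%:E | f in [set f | supnorm f <= 1]].

Definition strong_feller T : Prop :=
  forall f, continuous (T f : M -> Cplx R).

Record strong_feller_semigroup (T : R -> Bb M -> Bb M) : Prop := {
  sfs_operator : forall t, 0 <= t -> sigma_operator (T t) ;
  sfs0 : T 0 = id ;
  sfsD : forall t s, 0 <= t -> 0 <= s -> T (t + s) = T t \o T s ;
  sfs_strong_feller : forall t, 0 < t -> strong_feller (T t) ;
  sfs_cvg : forall f, continuous (f : M -> Cplx R) ->
    (fun t => T t f : sigma_top M) @ 0^'+ --> (f : sigma_top M) }.

Definition of_type (T : R -> Bb M -> Bb M) (C w : R) : Prop :=
  forall t, 0 <= t -> (opnorm (T t) <= (C * expR (w * t))%:E)%E.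

(* Only the values [Rs lam] with [w < Cre lam] are meaningful. *)
Definition laplace_transform (T : R -> Bb M -> Bb M) (w : R)
    (Rs : R[i] -> Bb M -> Bb M) : Prop :=
  forall lam : R[i], w < Cre lam -> sigma_operator (Rs lam) /\
    forall f mu,
      let F t := cexp (- (lam * t%:C%C)) * pairing (T t f) mu in
      cintegrable lebesgue_measure `[0, +oo[ F /\
      pairing (Rs lam f) mu = cintegral lebesgue_measure `[0, +oo[ F.

(* Multi-valued operators are identified with their graphs. *)
Definition graph T : set (Bb M * Bb M) := [set (f, T f) | f in setT].

Definition inverse_op L : set (Bb M * Bb M) := [set (p.2, p.1) | p in L].

Definition scalar_minus (lam : R[i]) L : set (Bb M * Bb M) :=
  [set (p.1, lam *: p.1 - p.2) | p in L].

Definition dom L : set (Bb M) := [set f | exists g, L (f, g)].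

Definition has_resolvent L (w : R) (Rs : R[i] -> Bb M -> Bb M) : Prop :=
  forall lam : R[i], w < Cre lam ->
    inverse_op (scalar_minus lam L) = graph (Rs lam).

Definition is_full_generator L (T : R -> Bb M -> Bb M) : Prop :=
  exists C w Rs,
    [/\ of_type T C w, laplace_transform T w Rs & has_resolvent L w Rs].

(* [B : D -> Bb M] is encoded by a total function, whose values outside [D]
   are irrelevant. *)
Definition linear_operator_on (D : set (Bb M)) B : Prop :=
  [/\ D 0,
      forall a f g, D f -> D g -> D (a *: f + g)
    & forall a f g, D f -> D g -> B (a *: f + g) = a *: B f + B g].

Definition perturb L B : set (Bb M * Bb M) := [set (p.1, p.2 + B p.1) | p in L].

Definition is_Mintegral (J : set R) (Phi : R -> Bb M) (u : Bb M) : Prop :=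
  forall mu : cmeasure R (borel M),
    cintegrable lebesgue_measure J (fun s => pairing (Phi s) mu) /\
    pairing u mu = cintegral lebesgue_measure J (fun s => pairing (Phi s) mu).

Definition Mintegrable (J : set R) (Phi : R -> Bb M) : Prop :=
  forall A : set R, measurable A -> A `<=` J ->
    exists u, is_Mintegral J (fun s => (\1_A s : R)%:C%C *: Phi s) u.

End operators.

(* Main.v *)
From HB Require Import structures.
Require Import Defs.
From mathcomp Require Import all_boot all_order all_algebra.
From mathcomp Require Import complex.
From mathcomp Require Import all_classical all_reals all_analysis.
From mathcomp Require Import measurable_realfun ring lra.

Set Implicit Arguments.
Unset Strict Implicit.
Unset Printing Implicit Defensive.

Import Order.TTheory GRing.Theory Num.Theory.
Import numFieldNormedType.Exports.

Local Open Scope classical_set_scope.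
Local Open Scope ring_scope.

(** The perturbed semigroup is the solution [P] of the Volterra equation
    [P = T + P * BT], where [(U * BT) t f] is the integral over [`]0, t]] of
    [U (t - s) (BT s f)]. The norm of [BT s] is at most [phi s] near 0 and grows
    exponentially afterwards, because [BT (r + s) = BT r \o T s]; hence for
    large [l0] the integral of [expR (- l0 * s)] times the norm of [BT s] is
    small, and [U |-> U * BT] is a contraction for the weighted norm
    [sup_t expR (- l0 * t) |U t|]. Iterating gives [P] ([perturbed],
    [perturbed_eq]).

    The semigroup law comes from the same contraction: for fixed [t] the defect
    [s |-> P (t + s) - P t \o P s] solves the homogeneous equation, so it is 0
    ([perturbedD]). The strong Feller property and convergence at 0 follow
    from dominated convergence in the integral equation ([convol_feller],
    [perturbed_cvg]).

    For the generator, the Laplace transform turns the equation into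
    [RP = R + RP \o V], where [V] is the Laplace transform of [BT]
    ([laplace_convol]). Now [V = B \o R]: this is checked on the domain, on
    which [B R(mu)] may be pulled out of the integral, and extends to all
    functions because a measure is determined by its values on the domain
    ([BR_integral], [eq_bp_functional_dom]). As [V] has norm at most 1/2,
    [id - V] is invertible by a Neumann series, and [RP = R (id - V)^-1] is the
    resolvent of [L + B] ([resolvent_perturb]).

    Measures enter only through one observation, which lets all of this be
    done pointwise: a linear functional on the bounded Borel functions is
    integration against a complex measure if and only if it is continuous for
    bounded pointwise convergence of sequences ([bp_functional_represent]).
    So sigma-continuous operators are the bounded ones that preserve such
    limits at every point ([sigma_operator_bp], [bp_operator_sigma]), and
    M-integrals are pointwise integrals, by Fubini's theorem
    ([bp_functional_mint]). The joint measurability that Fubini's theorem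
    requires holds because [T s f x] and [BT s f x] are right continuous in [s]
    ([evolved_family_measurable]). *)

(** * Complex numbers: modulus and sequences *)

Section modulus.
Context {R : realType}.
Implicit Types (z w : R[i]) (a : R).

Lemma Cabs_ge0 z : 0 <= Cabs z.
Proof. by rewrite -lecR -CnormE normr_ge0. Qed.

Lemma Cabs0 : Cabs (0 : R[i]) = 0.
Proof. exact: Normc.normc0. Qed.

Lemma CabsM z w : Cabs (z * w) = Cabs z * Cabs w.
Proof. exact: Normc.normcM. Qed.

Lemma CabsD z w : Cabs (z + w) <= Cabs z + Cabs w.
Proof. exact: le_normcD. Qed.

Lemma CabsN z : Cabs (- z) = Cabs z.
Proof. by apply: complexI; rewrite -!CnormE normrN. Qed.

Lemma CabsB z w : Cabs (z - w) = Cabs (w - z).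
Proof. by rewrite -CabsN opprB. Qed.

Lemma Cabs_eq0 z : Cabs z <= 0 -> z = 0.
Proof.
move=> z0; apply/eqP; rewrite -normr_eq0 CnormE.
by rewrite (_ : Cabs z = 0) ?eqxx//; apply/le_anti; rewrite z0 Cabs_ge0.
Qed.

Lemma Cabs_real a : Cabs (a%:C%C) = `|a|.
Proof. by rewrite /= expr0n/= addr0 sqrtr_sqr. Qed.

Lemma CreD z w : Cre (z + w) = Cre z + Cre w. Proof. by rewrite raddfD. Qed.
Lemma CimD z w : Cim (z + w) = Cim z + Cim w. Proof. by rewrite raddfD. Qed.
Lemma CreB z w : Cre (z - w) = Cre z - Cre w. Proof. by rewrite raddfB. Qed.
Lemma CimB z w : Cim (z - w) = Cim z - Cim w. Proof. by rewrite raddfB. Qed.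

Lemma CreM z w : Cre (z * w) = Cre z * Cre w - Cim z * Cim w.
Proof. by case: z w => ? ? []. Qed.

Lemma CimM z w : Cim (z * w) = Cre z * Cim w + Cim z * Cre w.
Proof. by case: z w => ? ? []. Qed.

Lemma complexP z w : Cre z = Cre w -> Cim z = Cim w -> z = w.
Proof. by case: z w => ? ? [? ?] /= -> ->. Qed.

Lemma Cabs_cexp z : Cabs (cexp z) = expR (Cre z).
Proof.
rewrite /cexp /= !exprMn -mulrDr cos2Dsin2 mulr1 sqrtr_sqr.
by rewrite ger0_norm// expR_ge0.
Qed.

Lemma cexpD z w : cexp (z + w) = cexp z * cexp w.
Proof.
apply: complexP.
  by rewrite CreM /cexp/= !CreD !CimD expRD cosD; ring.
by rewrite CimM /cexp/= !CreD !CimD expRD sinD; ring.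
Qed.

Lemma cexp_real a : cexp a%:C%C = (expR a)%:C%C.
Proof. by rewrite /cexp/= cos0 sin0 mulr1 mulr0. Qed.

End modulus.

Section complex_sequences.
Context {R : realType}.
Implicit Types (u v : nat -> R[i]) (l m : R[i]).

(** Working componentwise in [R] gives access to the real-valued limit and
    integration theorems; [ccvg_topP] relates this to the topology of [R[i]^o]. *)
Definition ccvg u l : Prop :=
  (fun n => Cre (u n)) @ \oo --> Cre l /\ (fun n => Cim (u n)) @ \oo --> Cim l.

Lemma ccvgP u l : ccvg u l <->
  forall e : R, 0 < e -> exists N, forall n, (N <= n)%N -> Cabs (u n - l) < e.
Proof.
split.
  move=> [/cvgrPdist_lt cr /cvgrPdist_lt ci] e e0.
  have e20 : 0 < e / 2 by rewrite divr_gt0.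
  have [N1 _ H1] := cr _ e20; have [N2 _ H2] := ci _ e20.
  exists (maxn N1 N2) => n; rewrite geq_max => /andP[n1 n2].
  apply: le_lt_trans (Cabs_le _) _; rewrite CreB CimB.
  have := H1 _ n1; have := H2 _ n2 => /=; rewrite distrC => ?.
  by rewrite distrC => ?; lra.
move=> H; split; apply/cvgrPdist_lt => e e0; have [N HN] := H _ e0;
  exists N => // n /= /HN; apply: le_lt_trans; rewrite CabsB.
  by rewrite -CreB; exact: Cabs_Re.
by rewrite -CimB; exact: Cabs_Im.
Qed.

Lemma ccvg_topP u l : ccvg u l <-> (u : nat -> Cplx R) @ \oo --> (l : Cplx R).
Proof.
split => [/ccvgP H|H].
  apply/cvg_ballP => -[e1 e2]; rewrite ltcE/= => /andP[/eqP -> e0].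
  have [N HN] := H _ e0; exists N => // n /= /HN.
  by rewrite /ball/= CnormE ltcR CabsB.
by split; [exact: (cvg_comp _ _ H (@continuous_Cre R l))
         |exact: (cvg_comp _ _ H (@continuous_Cim R l))].
Qed.

Lemma ccvg_cst l : ccvg (fun=> l) l.
Proof. by split; exact: cvg_cst. Qed.

Lemma eq_ccvg u v l : (forall n, u n = v n) -> ccvg u l -> ccvg v l.
Proof. by move=> /funext ->. Qed.

Lemma ccvgD u v l m : ccvg u l -> ccvg v m -> ccvg (fun n => u n + v n) (l + m).
Proof.
move=> [ur ui] [vr vi]; split; rewrite ?CreD ?CimD.
  by under eq_fun do rewrite CreD; exact: cvgD.
by under eq_fun do rewrite CimD; exact: cvgD.
Qed.

Lemma ccvgZ u l a : ccvg u l -> ccvg (fun n => a * u n) (a * l).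
Proof.
move=> [ur ui]; split; rewrite ?CreM ?CimM.
  by under eq_fun do rewrite CreM; apply: cvgB; exact: cvgMr.
by under eq_fun do rewrite CimM; apply: cvgD; exact: cvgMr.
Qed.

Lemma ccvg_unique u l m : ccvg u l -> ccvg u m -> l = m.
Proof.
move=> [ur ui] [vr vi]; apply: complexP.
  by rewrite -(cvg_lim _ ur)// -(cvg_lim _ vr).
by rewrite -(cvg_lim _ ui)// -(cvg_lim _ vi).
Qed.

Lemma ccvg_Cabs_le u l b : ccvg u l -> (forall n, Cabs (u n) <= b) -> Cabs l <= b.
Proof.
move=> /ccvgP ul ub; apply/ler_addgt0Pl => e e0.
have [N /(_ _ (leqnn _)) HN] := ul _ e0.
rewrite -(subrK (u N) l) (le_trans (CabsD _ _))// lerD//.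
by rewrite CabsB ltW.
Qed.

Lemma ccvg_shift u l : ccvg u l -> ccvg (fun n => u n.+1) l.
Proof.
move=> /ccvgP ul; apply/ccvgP => e /ul[N HN]; exists N => n nN.
by apply: HN; exact: leqW.
Qed.

Lemma ccvg_dist u l (b : nat -> R) :
  (forall n, Cabs (u n - l) <= b n) -> b @ \oo --> 0 -> ccvg u l.
Proof.
move=> ub /cvgrPdist_lt b0; apply/ccvgP => e /b0[N _ HN]; exists N => n nN.
apply: le_lt_trans (ub n) _; have := HN _ nN; rewrite /= sub0r normrN.
exact/le_lt_trans/ler_norm.
Qed.

Lemma cvg_geom2 (c : R) : (fun n => c / 2 ^+ n) @ \oo --> 0.
Proof.
rewrite -[0 in X in _ --> X](mulr0 c); apply: cvgMr.
rewrite [X in X @ _ --> _](_ : _ = (fun n => (2^-1) ^+ n)).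
  by apply: cvg_expr; rewrite ger0_norm; lra.
by apply/funext => n; rewrite exprVn.
Qed.

Lemma geometric_cvg (u : nat -> R) (c : R) :
  (forall n, `|u n.+1 - u n| <= c / 2 ^+ n) -> cvg (u @ \oo).
Proof.
move=> H; have c0 : 0 <= c.
  by have := le_trans (normr_ge0 _) (H 0%N); rewrite expr0 divr1.
have cv : cvgn (series (fun n => u n.+1 - u n)).
  apply: normed_cvg; apply: (@series_le_cvg _ _ (fun n => c / 2 ^+ n)) => //=.
    by move=> n; rewrite /= divr_ge0// exprn_ge0.
  rewrite (_ : (fun n => _) = geometric c (2^-1)).
    by apply: is_cvg_geometric_series; rewrite ger0_norm; lra.
  by apply/funext => n; rewrite /= exprVn.
have E : u = (fun n => u 0%N + series (fun n => u n.+1 - u n) n).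
  apply/funext => n; rewrite /series/=; elim: n => [|n ih].
    by rewrite big_nil addr0.
  by rewrite big_nat_recr//= addrA -ih addrC subrK.
by rewrite E; apply: is_cvgD => //; exact: is_cvg_cst.
Qed.

(** The bound [2 * c / 2 ^+ n] is the tail of the geometric series. *)
Lemma dist_geometric u (c : R) :
  (forall n, Cabs (u n.+1 - u n) <= c / 2 ^+ n) ->
  forall n k, Cabs (u (n + k)%N - u n) <= 2 * c / 2 ^+ n.
Proof.
move=> H n k; have c0 : 0 <= c.
  by have := le_trans (Cabs_ge0 _) (H 0%N); rewrite expr0 divr1.
have p0 (j : nat) : 0 < 2 ^+ j :> R by rewrite exprn_gt0.
suff : Cabs (u (n + k)%N - u n) <= 2 * c / 2 ^+ n - 2 * c / 2 ^+ (n + k).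
  move=> /le_trans; apply; rewrite gerDl oppr_le0.
  by rewrite divr_ge0 ?mulr_ge0// ltW.
elim: k => [|k ih]; first by rewrite addn0 !subrr Cabs0.
rewrite addnS -(subrK (u (n + k)%N) (u _)) -addrA.
apply: le_trans (CabsD _ _) _; apply: le_trans (lerD (H _) ih) _.
rewrite [in leRHS]exprS; have := p0 (n + k)%N => p1.
have -> : 2 * c / (2 * 2 ^+ (n + k)) = c / 2 ^+ (n + k).
  by field; rewrite lt0r_neq0.
by have -> : 2 * c / 2 ^+ (n + k) = 2 * (c / 2 ^+ (n + k)); [rewrite mulrA|lra].
Qed.

Lemma ccvg_geometric u (c : R) :
  (forall n, Cabs (u n.+1 - u n) <= c / 2 ^+ n) ->
  exists2 l, ccvg u l & forall n, Cabs (l - u n) <= 2 * c / 2 ^+ n.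
Proof.
move=> H; have [l ul] : exists l, ccvg u l.
  have cr : cvg ((fun n => Cre (u n)) @ \oo).
    apply: (@geometric_cvg _ c) => n; rewrite -CreB.
    exact: le_trans (Cabs_Re _) (H n).
  have ci : cvg ((fun n => Cim (u n)) @ \oo).
    apply: (@geometric_cvg _ c) => n; rewrite -CimB.
    exact: le_trans (Cabs_Im _) (H n).
  by exists (Complex (lim ((fun n => Cre (u n)) @ \oo))
                     (lim ((fun n => Cim (u n)) @ \oo))).
exists l => // n; move/ccvgP : (ul) => {}ul.
apply/ler_addgt0Pl => e /ul[N /(_ (n + N)%N (leq_addl _ _)) HN].
rewrite -(subrK (u (n + N)%N) l) -addrA (le_trans (CabsD _ _))// lerD//.
  by rewrite CabsB ltW.
exact: dist_geometric.
Qed.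

End complex_sequences.

(** * Complex-valued integration *)

Section complex_measurability.
Context {R : realType} d (X : measurableType d).
Implicit Types (F G : X -> R[i]).

Definition cmeasurable F : Prop :=
  measurable_fun setT (Cre \o F) /\ measurable_fun setT (Cim \o F).

Lemma cmeasurable_cst (c : R[i]) : cmeasurable (fun=> c).
Proof. by split; exact: measurable_cst. Qed.

Lemma cmeasurableD F G : cmeasurable F -> cmeasurable G ->
  cmeasurable (fun x => F x + G x).
Proof.
move=> [Fr Fi] [Gr Gi]; split.
  rewrite /comp; under eq_fun do rewrite CreD; exact: measurable_funD.
rewrite /comp; under eq_fun do rewrite CimD; exact: measurable_funD.
Qed.

Lemma cmeasurableM F G : cmeasurable F -> cmeasurable G ->
  cmeasurable (fun x => F x * G x).
Proof.
move=> [Fr Fi] [Gr Gi]; split.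
  rewrite /comp; under eq_fun do rewrite CreM.
  by apply: measurable_funB; exact: measurable_funM.
rewrite /comp; under eq_fun do rewrite CimM.
by apply: measurable_funD; exact: measurable_funM.
Qed.

Lemma cmeasurableZ F (a : R[i]) : cmeasurable F -> cmeasurable (fun x => a * F x).
Proof. by move=> mF; apply: cmeasurableM => //; exact: cmeasurable_cst. Qed.

Lemma cmeasurableB F G : cmeasurable F -> cmeasurable G ->
  cmeasurable (fun x => F x - G x).
Proof.
move=> mF mG; rewrite (_ : (fun x => _) = (fun x => F x + (-1) * G x)).
  by apply: cmeasurableD => //; exact: cmeasurableZ.
by apply/funext => x; rewrite mulN1r.
Qed.

Lemma cmeasurable_real (f : X -> R) : measurable_fun setT f ->
  cmeasurable (fun x => (f x)%:C%C).
Proof. by move=> mf; split => //; exact: measurable_cst. Qed.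

Lemma cmeasurable_indic (A : set X) : measurable A ->
  cmeasurable (fun x => (\1_A x : R)%:C%C).
Proof. by move=> mA; apply: cmeasurable_real; exact: measurable_indic. Qed.

Lemma cmeasurable_lim (F_ : nat -> X -> R[i]) F :
  (forall n, cmeasurable (F_ n)) -> (forall x, ccvg (F_^~ x) (F x)) ->
  cmeasurable F.
Proof.
move=> mF FF; split.
  apply: (measurable_fun_cvg (h := fun n => Cre \o F_ n)) => //.
    by move=> n; have [] := mF n.
  by move=> x _; have [] := FF x.
apply: (measurable_fun_cvg (h := fun n => Cim \o F_ n)) => //.
  by move=> n; have [] := mF n.
by move=> x _; have [] := FF x.
Qed.

Lemma measurable_Cabs F : cmeasurable F -> measurable_fun setT (Cabs \o F).
Proof.
move=> [Fr Fi]; rewrite (_ : _ \o _ = fun x =>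
    Num.sqrt ((Cre (F x)) ^+ 2 + (Cim (F x)) ^+ 2)); last first.
  by apply/funext => x /=; case: (F x).
apply: (@measurableT_comp _ _ _ _ _ _ (@Num.sqrt R)).
  by apply: continuous_measurable_fun; exact: sqrt_continuous.
by apply: measurable_funD; exact: measurable_funX.
Qed.

End complex_measurability.

Lemma cmeasurable_comp {R : realType} d d' (X : measurableType d)
    (Y : measurableType d') (F : Y -> R[i]) (h : X -> Y) :
  cmeasurable F -> measurable_fun setT h -> cmeasurable (F \o h).
Proof.
by move=> [Fr Fi] mh; split; rewrite compA; exact: measurableT_comp.
Qed.

Section complex_integration.
Context {R : realType} d (X : measurableType d).
Variable mu : {measure set X -> \bar R}.
Implicit Types (F G : X -> R[i]) (g : X -> R) (D : set X).

Lemma integrable_EFinZ g (c : R) : mu.-integrable setT (EFin \o g) ->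
  mu.-integrable setT (EFin \o (fun x => c * g x)).
Proof. by move=> ig; apply: eq_integrable (integrableZl measurableT c ig). Qed.

Lemma integrable_EFinD g g' : mu.-integrable setT (EFin \o g) ->
  mu.-integrable setT (EFin \o g') ->
  mu.-integrable setT (EFin \o (fun x => g x + g' x)).
Proof. by move=> ig ig'; apply: eq_integrable (integrableD measurableT ig ig'). Qed.

(** Integrability in the form in which it is used throughout: a measurable
    function with an integrable majorant of its modulus. *)
Lemma cintegrable_dom F g : cmeasurable F ->
  mu.-integrable setT (EFin \o g) -> (forall x, Cabs (F x) <= g x) ->
  cintegrable mu setT F.
Proof.
move=> [Fr Fi] ig Fg; split.
  apply: (le_integrable _ _ _ ig) => //; first exact/measurable_EFinP.
  move=> x _ /=; rewrite lee_fin (le_trans (Cabs_Re _))// (le_trans (Fg x))//.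
  exact: ler_norm.
apply: (le_integrable _ _ _ ig) => //; first exact/measurable_EFinP.
move=> x _ /=; rewrite lee_fin (le_trans (Cabs_Im _))// (le_trans (Fg x))//.
exact: ler_norm.
Qed.

Lemma cintegrable_measurable F : cintegrable mu setT F -> cmeasurable F.
Proof.
by move=> [Fr Fi]; split; apply/measurable_EFinP;
  [exact: (measurable_int mu Fr)|exact: (measurable_int mu Fi)].
Qed.

Lemma eq_cintegral D F G : (forall x, D x -> F x = G x) ->
  cintegral mu D F = cintegral mu D G.
Proof.
by move=> FG; congr Complex; apply: eq_Rintegral => x /set_mem /FG ->.
Qed.

Lemma cintegral0 F : (forall x, F x = 0) -> cintegral mu setT F = 0.
Proof.
move=> F0; under eq_cintegral do rewrite F0.
by apply: complexP; rewrite /= /Rintegral integral0.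
Qed.

Lemma eq_cintegrable D F G : measurable D -> (forall x, D x -> F x = G x) ->
  cintegrable mu D F -> cintegrable mu D G.
Proof.
move=> mD FG [Fr Fi]; split.
  by apply: eq_integrable Fr => // x /set_mem /FG /= ->.
by apply: eq_integrable Fi => // x /set_mem /FG /= ->.
Qed.

Lemma cintegrableD F G : cintegrable mu setT F -> cintegrable mu setT G ->
  cintegrable mu setT (fun x => F x + G x).
Proof.
move=> [Fr Fi] [Gr Gi]; split.
  apply: eq_integrable (integrableD _ Fr Gr) => // x _ /=.
  by rewrite CreD EFinD.
apply: eq_integrable (integrableD _ Fi Gi) => // x _ /=.
by rewrite CimD EFinD.
Qed.

Lemma cintegrableZ F (a : R[i]) : cintegrable mu setT F ->
  cintegrable mu setT (fun x => a * F x).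
Proof.
move=> [Fr Fi]; split.
  have := integrableB measurableT (integrableZl measurableT (Cre a) Fr)
    (integrableZl measurableT (Cim a) Fi).
  by apply: eq_integrable => // x _ /=; rewrite CreM.
have := integrableD measurableT (integrableZl measurableT (Cre a) Fi)
  (integrableZl measurableT (Cim a) Fr).
by apply: eq_integrable => // x _ /=; rewrite CimM.
Qed.

Lemma cintegralD F G : cintegrable mu setT F -> cintegrable mu setT G ->
  cintegral mu setT (fun x => F x + G x) =
  cintegral mu setT F + cintegral mu setT G.
Proof.
move=> [Fr Fi] [Gr Gi]; apply: complexP => /=; rewrite -RintegralD//;
  by apply: eq_Rintegral => x _; rewrite (CreD, CimD).
Qed.

Lemma cintegralZ F (a : R[i]) : cintegrable mu setT F ->
  cintegral mu setT (fun x => a * F x) = a * cintegral mu setT F.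
Proof.
move=> [Fr Fi]; apply: complexP; rewrite ?CreM ?CimM /=.
  rewrite -!RintegralZl// -RintegralB//.
  - by apply: eq_Rintegral => x _; rewrite CreM.
  - by apply: eq_integrable (integrableZl measurableT (Cre a) Fr).
  - by apply: eq_integrable (integrableZl measurableT (Cim a) Fi).
rewrite -!RintegralZl// -RintegralD//.
- by apply: eq_Rintegral => x _; rewrite CimM.
- by apply: eq_integrable (integrableZl measurableT (Cre a) Fi).
- by apply: eq_integrable (integrableZl measurableT (Cim a) Fr).
Qed.

Lemma cintegrableB F G : cintegrable mu setT F -> cintegrable mu setT G ->
  cintegrable mu setT (fun x => F x - G x).
Proof.
move=> iF /(cintegrableZ (-1)) /(cintegrableD iF).
by apply: eq_cintegrable => // x _; rewrite mulN1r.
Qed.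

Lemma cintegralB F G : cintegrable mu setT F -> cintegrable mu setT G ->
  cintegral mu setT (fun x => F x - G x) =
  cintegral mu setT F - cintegral mu setT G.
Proof.
move=> iF iG; rewrite -[in RHS](mulN1r (cintegral _ _ G)) -cintegralZ//.
rewrite -cintegralD//; last exact: cintegrableZ.
by apply: eq_cintegral => x _; rewrite mulN1r.
Qed.

(** The factor 2 comes from bounding the real and imaginary parts separately;
    every estimate below leaves room for it. *)
Lemma Cabs_cintegral F g : cmeasurable F ->
  mu.-integrable setT (EFin \o g) -> (forall x, Cabs (F x) <= g x) ->
  Cabs (cintegral mu setT F) <= 2 * \int[mu]_x g x.
Proof.
move=> mF ig Fg; have [iFr iFi] := cintegrable_dom mF ig Fg.
apply: le_trans (Cabs_le _) _ => /=; rewrite mulrDl mul1r.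
apply: lerD; apply: le_trans (le_normr_Rintegral _ _) _ => //;
  apply: le_Rintegral => //; do ?exact: integrable_norm.
  by move=> x _; exact: le_trans (Cabs_Re _) (Fg x).
by move=> x _; exact: le_trans (Cabs_Im _) (Fg x).
Qed.

Lemma Cre_indicM D F x :
  Cre ((\1_D x : R)%:C%C * F x) = ((Cre \o F) \_ D) x.
Proof.
by rewrite indicE patchE CreM/= mul0r subr0; case: ifP; rewrite ?mul1r ?mul0r.
Qed.

Lemma Cim_indicM D F x :
  Cim ((\1_D x : R)%:C%C * F x) = ((Cim \o F) \_ D) x.
Proof.
by rewrite indicE patchE CimM/= mul0r addr0; case: ifP; rewrite ?mul1r ?mul0r.
Qed.

Lemma cintegral_mkcond D F :
  cintegral mu D F = cintegral mu setT (fun x => (\1_D x : R)%:C%C * F x).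
Proof.
by congr Complex; rewrite Rintegral_mkcond; apply: eq_Rintegral => x _;
  rewrite (Cre_indicM, Cim_indicM).
Qed.

Lemma cintegrable_mkcond D F : measurable D ->
  cintegrable mu D F <->
  cintegrable mu setT (fun x => (\1_D x : R)%:C%C * F x).
Proof.
have E (h : X -> R) : (EFin \o h) \_ D = EFin \o (h \_ D).
  by apply/funext => x; rewrite /= !patchE; case: ifP.
move=> mD; rewrite /cintegrable !(integrable_mkcond _ mD) !E.
split=> -[Fr Fi]; split.
- by apply: eq_integrable Fr => // x _; rewrite /= Cre_indicM.
- by apply: eq_integrable Fi => // x _; rewrite /= Cim_indicM.
- by apply: eq_integrable Fr => // x _; rewrite /= Cre_indicM.
- by apply: eq_integrable Fi => // x _; rewrite /= Cim_indicM.
Qed.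

Lemma cdominated_convergence_ae (F_ : nat -> X -> R[i]) F g :
  (forall n, cmeasurable (F_ n)) -> cmeasurable F ->
  {ae mu, forall x, ccvg (F_^~ x) (F x)} ->
  mu.-integrable setT (EFin \o g) -> (forall n x, Cabs (F_ n x) <= g x) ->
  ccvg (fun n => cintegral mu setT (F_ n)) (cintegral mu setT F).
Proof.
move=> mF_ mF FF ig F_g.
split.
  have mn n : measurable_fun setT (EFin \o (Cre \o F_ n)).
    by apply/measurable_EFinP; have [] := mF_ n.
  have cn : {ae mu, forall x, setT x ->
      (fun n => (EFin \o (Cre \o F_ n)) x) @ \oo --> (EFin \o (Cre \o F)) x}.
    apply: filterS FF => x FFx _.
    by apply/cvg_EFin; [exact: nearW|case: FFx].
  have bn : {ae mu, forall x n, setT x ->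
      (`|(EFin \o (Cre \o F_ n)) x| <= (EFin \o g) x)%E}.
    apply: aeW => x n _; rewrite /= lee_fin.
    exact: le_trans (Cabs_Re _) (F_g _ _).
  have mCre : measurable_fun setT (EFin \o (Cre \o F)).
    by apply/measurable_EFinP; case: mF.
  have [iF _] := dominated_convergence measurableT mn mCre cn ig bn.
  by move=> h; apply: fine_cvg; rewrite fineK//; exact: integrable_fin_num.
have mn n : measurable_fun setT (EFin \o (Cim \o F_ n)).
  by apply/measurable_EFinP; have [] := mF_ n.
have cn : {ae mu, forall x, setT x ->
    (fun n => (EFin \o (Cim \o F_ n)) x) @ \oo --> (EFin \o (Cim \o F)) x}.
  apply: filterS FF => x FFx _.
  by apply/cvg_EFin; [exact: nearW|case: FFx].
have bn : {ae mu, forall x n, setT x ->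
    (`|(EFin \o (Cim \o F_ n)) x| <= (EFin \o g) x)%E}.
  apply: aeW => x n _; rewrite /= lee_fin.
  exact: le_trans (Cabs_Im _) (F_g _ _).
have mCim : measurable_fun setT (EFin \o (Cim \o F)).
  by apply/measurable_EFinP; case: mF.
have [iF _] := dominated_convergence measurableT mn mCim cn ig bn.
by move=> h; apply: fine_cvg; rewrite fineK//; exact: integrable_fin_num.
Qed.

Lemma cdominated_convergence (F_ : nat -> X -> R[i]) F g :
  (forall n, cmeasurable (F_ n)) -> (forall x, ccvg (F_^~ x) (F x)) ->
  mu.-integrable setT (EFin \o g) -> (forall n x, Cabs (F_ n x) <= g x) ->
  ccvg (fun n => cintegral mu setT (F_ n)) (cintegral mu setT F).
Proof.
move=> mF_ FF; apply: cdominated_convergence_ae => //; last exact: aeW.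
exact: cmeasurable_lim FF.
Qed.

End complex_integration.

(** * Translation invariance and Fubini's theorem *)

Section translation.
Context {R : realType}.
Local Notation lebesgue := (@lebesgue_measure R).
Local Notation RR := (measurableTypeR R).
Implicit Types (a : R).

Lemma measurable_shift a : measurable_fun setT (shift a : RR -> RR).
Proof. by apply: measurable_funD => //; exact: measurable_id. Qed.

(** Translation invariance on half-open intervals suffices, by uniqueness of
    the Lebesgue measure. *)
Lemma lebesgue_measure_shift a (A : set RR) : measurable A ->
  pushforward lebesgue (shift a : RR -> RR) A = lebesgue A.
Proof.
move=> mA; have ms := measurable_shift a.
apply/esym/lebesgue_measure_unique => //= _ [[x y]] _ <-.
rewrite /pushforward (_ : _ @^-1` _ = `]x - a, y - a]%classic); last first.
  by apply/seteqP; split => t /=; rewrite !in_itv/= ltrBlDr lerBrDr.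
rewrite !lebesgue_measure_itv/= !lte_fin ltrD2r.
by case: ifP => // _; rewrite -!EFinB; congr EFin; ring.
Qed.

Lemma integral_shift a (f : RR -> \bar R) : measurable_fun setT f ->
  (\int[lebesgue]_t f (t + a)%R = \int[lebesgue]_t f t)%E.
Proof.
have key (g : RR -> \bar R) : measurable_fun setT g -> (forall t, (0 <= g t)%E) ->
    (\int[lebesgue]_t g (t + a)%R = \int[lebesgue]_t g t)%E.
  move=> mg g0.
  transitivity (\int[pushforward lebesgue (shift a : RR -> RR)]_t g t)%E.
    by rewrite ge0_integral_pushforward//; exact: measurable_shift.
  apply: eq_measure_integral; first exact: measurable_shift.
  by move=> ? A mA _; exact: lebesgue_measure_shift.
move=> mf; rewrite [LHS]integralE [RHS]integralE.
rewrite -(key f^\+%E); last 2 first.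
- exact: measurable_funepos.
- by move=> t; exact: funepos_ge0.
rewrite -(key f^\-%E).
- by rewrite (funepos_comp f (shift a)) (funeneg_comp f (shift a)).
- exact: measurable_funeneg.
- by move=> t; exact: funeneg_ge0.
Qed.

Lemma integrable_shift a (g : RR -> R) : lebesgue.-integrable setT (EFin \o g) ->
  lebesgue.-integrable setT (EFin \o (fun t => g (t + a))).
Proof.
move=> /integrableP[mg ig]; apply/integrableP; split.
  exact: (measurableT_comp mg (measurable_shift a)).
rewrite [ltLHS](integral_shift a (f := fun t => `|(g t)%:E|%E))//.
exact: measurableT_comp.
Qed.

Lemma Rintegral_shift a (g : RR -> R) : measurable_fun setT g ->
  \int[lebesgue]_t g (t + a) = \int[lebesgue]_t g t.
Proof.
move=> mg; rewrite /Rintegral.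
by rewrite (integral_shift a (f := fun t => (g t)%:E))//; exact/measurable_EFinP.
Qed.

Lemma cintegral_shift a (F : RR -> R[i]) : cmeasurable F ->
  cintegral lebesgue setT (fun t => F (t + a)) = cintegral lebesgue setT F.
Proof.
move=> [Fr Fi]; rewrite /cintegral.
by rewrite (Rintegral_shift a Fr) (Rintegral_shift a Fi).
Qed.

(** Points are Lebesgue null. *)
Lemma eq_cintegral_except a (F G : RR -> R[i]) : cmeasurable F -> cmeasurable G ->
  (forall s, s != a -> F s = G s) ->
  cintegral lebesgue setT F = cintegral lebesgue setT G.
Proof.
move=> [Fr Fi] [Gr Gi] FG.
have ae (p : R[i] -> R) : ae_eq lebesgue setT (fun s => (p (F s))%:E)
    (fun s => (p (G s))%:E).
  exists [set a]; split => //; first exact: lebesgue_measure_set1.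
  move=> s /= nFG; apply: contrapT => /eqP sa; apply: nFG => _.
  by rewrite FG.
by congr Complex; congr fine; apply: ae_eq_integral => //; exact/measurable_EFinP.
Qed.

End translation.

(** The inner integrals are required to exist at every point, not just almost
    everywhere, so that taking the real value of an extended integral is
    harmless. *)
Section complex_fubini.
Context {R : realType} d1 d2 (X : measurableType d1) (Y : measurableType d2).
Variables (m1 : {sigma_finite_measure set X -> \bar R}).
Variables (m2 : {sigma_finite_measure set Y -> \bar R}).
Implicit Types (F : X * Y -> R[i]).

Lemma measurable_Rintegral1 (f : X * Y -> R) : measurable_fun setT f ->
  measurable_fun setT (fun y => \int[m1]_x f (x, y)).
Proof.
move=> mf; have mEf : measurable_fun setT (EFin \o f) by exact/measurable_EFinP.
apply: measurableT_comp => //.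
under eq_fun do rewrite integralE.
apply: emeasurable_funB.
  rewrite (_ : (fun y => _) = fubini_G m1 (EFin \o f)^\+%E); last first.
    by apply/funext => y; apply: eq_integral => x _; rewrite !funeposE.
  apply: measurable_fun_fubini_tonelli_G; first exact: measurable_funepos.
  by move=> z; exact: funepos_ge0.
rewrite (_ : (fun y => _) = fubini_G m1 (EFin \o f)^\-%E); last first.
  by apply/funext => y; apply: eq_integral => x _; rewrite !funenegE.
apply: measurable_fun_fubini_tonelli_G; first exact: measurable_funeneg.
by move=> z; exact: funeneg_ge0.
Qed.

Lemma cmeasurable_cintegral F : cmeasurable F ->
  cmeasurable (fun y => cintegral m1 setT (fun x => F (x, y))).
Proof.
move=> [Fr Fi]; split; first exact: measurable_Rintegral1 Fr.
exact: measurable_Rintegral1 Fi.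
Qed.

Lemma Rintegral_fubini (f : X * Y -> R) :
  (m1 \x m2)%E.-integrable setT (EFin \o f) ->
  (forall x, m2.-integrable setT (fun y => (f (x, y))%:E)) ->
  (forall y, m1.-integrable setT (fun x => (f (x, y))%:E)) ->
  [/\ m1.-integrable setT (fun x => (\int[m2]_y f (x, y))%:E) &
    \int[m1]_x \int[m2]_y f (x, y) = \int[m2]_y \int[m1]_x f (x, y)].
Proof.
move=> mf if1 if2.
have E1 x : ((\int[m2]_y f (x, y))%:E = \int[m2]_y (EFin \o f) (x, y))%E.
  by rewrite fineK//; exact: integrable_fin_num.
have E2 y : ((\int[m1]_x f (x, y))%:E = \int[m1]_x (EFin \o f) (x, y))%E.
  by rewrite fineK//; exact: integrable_fin_num.
split.
- by under eq_fun do rewrite E1; exact: (integrable_fubini_F mf).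
- rewrite /Rintegral; congr fine.
  under eq_integral do rewrite E1.
  by under [RHS]eq_integral do rewrite E2; exact: (Fubini mf).
Qed.

Lemma cintegral_fubini F (g : X * Y -> R) :
  cmeasurable F -> (forall z, Cabs (F z) <= g z) ->
  (m1 \x m2)%E.-integrable setT (EFin \o g) ->
  (forall x, m2.-integrable setT (fun y => (g (x, y))%:E)) ->
  (forall y, m1.-integrable setT (fun x => (g (x, y))%:E)) ->
  [/\ cintegrable m1 setT (fun x => cintegral m2 setT (fun y => F (x, y))) &
    cintegral m1 setT (fun x => cintegral m2 setT (fun y => F (x, y))) =
    cintegral m2 setT (fun y => cintegral m1 setT (fun x => F (x, y)))].
Proof.
move=> mF Fg ig ig2 ig1.
have [Fr Fi] := cintegrable_dom mF ig Fg.
have mF1 y : cmeasurable (fun x => F (x, y)).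
  exact: (cmeasurable_comp mF (@measurable_pair2 _ _ _ _ y)).
have mF2 x : cmeasurable (fun y => F (x, y)).
  exact: (cmeasurable_comp mF (@measurable_pair1 _ _ _ _ x)).
have iF1 y : cintegrable m1 setT (fun x => F (x, y)).
  exact: cintegrable_dom (mF1 y) (ig1 y) _.
have iF2 x : cintegrable m2 setT (fun y => F (x, y)).
  exact: cintegrable_dom (mF2 x) (ig2 x) _.
have [|||r1 r2] := @Rintegral_fubini (Cre \o F); [by []|..].
- by move=> x; have [] := iF2 x.
- by move=> y; have [] := iF1 y.
have [|||i1 i2] := @Rintegral_fubini (Cim \o F); [by []|..].
- by move=> x; have [] := iF2 x.
- by move=> y; have [] := iF1 y.
by split => //; apply: complexP.
Qed.

End complex_fubini.

(** * Monotone classes of bounded Borel functions *)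

(** The functional form of the pi-lambda theorem: a class of functions closed
    under linear combinations and bounded pointwise limits that contains the
    indicators of a generating pi-system contains every bounded measurable
    function. *)
Section monotone_class.
Context {R : realType} d (X : measurableType d).
Variables (G : set (set X)) (H : set (X -> R[i])).
Hypothesis GE : @measurable _ X = <<s G >>.
Hypothesis GI : setI_closed G.
Hypothesis H1 : H (fun=> 1).
Hypothesis HD : forall a F F', H F -> H F' -> H (fun x => a * F x + F' x).
Hypothesis HG : forall A, G A -> H (fun x => (\1_A x : R)%:C%C).
Hypothesis Hlim : forall (F_ : nat -> X -> R[i]) F (K : R),
  (forall n, H (F_ n)) -> (forall n x, Cabs (F_ n x) <= K) ->
  (forall x, ccvg (F_^~ x) (F x)) -> H F.

Let eqH F F' : H F -> F =1 F' -> H F'.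
Proof. by move=> HF /funext <-. Qed.

Let H0 : H (fun=> 0).
Proof. by apply: eqH (HD (-1) H1 H1) _ => x; rewrite mulr1 addNr. Qed.

Lemma monotone_class_indic A : measurable A -> H (fun x => (\1_A x : R)%:C%C).
Proof.
rewrite GE; suff /lambda_system_subset : lambda_system setT
    [set A : set X | H (fun x => (\1_A x : R)%:C%C)] by apply.
split => //.
- by apply: eqH H1 _ => x; rewrite indicT.
- move=> B C CB HB HC; apply: eqH (HD (-1) HC HB) _ => x.
  rewrite !indicE in_setD; case: (boolP (x \in C)) => xC /=.
    by rewrite (mem_set (CB _ (set_mem xC)))/= mulr1 addNr.
  by rewrite mulr0 add0r andbT.
- move=> F ndF HF; apply: (@Hlim (fun n x => (\1_(F n) x)%:C%C) _ 1) => //.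
    by move=> n x; rewrite Cabs_real indicE ger0_norm// lern1 leq_b1.
  move=> x; apply/ccvgP => e e0.
  have [[N _ FN]|nF] := pselect ((\bigcup_k F k) x).
    exists N => n Nn; have Fn : F n x by move: FN; exact/subsetPset/ndF.
    by rewrite !indicE (mem_set Fn) mem_set ?subrr ?Cabs0//; exists N.
  exists 0%N => n _; have nFn : ~ F n x by move=> Fn; apply: nF; exists n.
  by rewrite !indicE (memNset nF) (memNset nFn) subrr Cabs0.
Qed.

Import HBNNSimple.

Let H_nnsfun (h : {nnsfun X >-> R}) : H (fun x => (h x)%:C%C).
Proof.
under eq_fun do rewrite fimfunE fsbig_finite//=.
elim: (finmap.enum_fset _) => [|y s ih].
  by apply: eqH H0 _ => x; rewrite big_nil.
apply: eqH (HD (y%:C%C) (monotone_class_indic _) ih) _; last first.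
  by move=> x; rewrite big_cons raddfD/= rmorphM.
exact: measurable_sfunP.
Qed.

Let H_nneg (f : X -> R) (K : R) : measurable_fun setT f -> (forall x, 0 <= f x) ->
  (forall x, f x <= K) -> H (fun x => (f x)%:C%C).
Proof.
move=> mf f0 fK; have mEf : measurable_fun setT (EFin \o f).
  exact/measurable_EFinP.
have Ef0 x : setT x -> (0 <= (EFin \o f) x)%E by rewrite lee_fin.
pose g := nnsfun_approx measurableT mEf.
apply: (@Hlim (fun n x => (g n x)%:C%C) _ K) => //.
- move=> n x; rewrite Cabs_real ger0_norm//; apply: le_trans (fK x).
  by rewrite -lee_fin /g nnsfun_approxE; exact: le_approx.
- move=> x; split => /=; last exact: cvg_cst.
  exact: (fine_cvg (cvg_nnsfun_approx measurableT mEf Ef0 (x := x) I)).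
Qed.

Let H_real (f : X -> R) (K : R) : measurable_fun setT f ->
  (forall x, `|f x| <= K) -> H (fun x => (f x)%:C%C).
Proof.
move=> mf fK.
apply: eqH (HD (-1) (H_nneg (K := K) (f := fun x => Num.max (- f x) 0) _ _ _)
  (H_nneg (K := K) (f := fun x => Num.max (f x) 0) _ _ _)) _.
- by apply: measurable_maxr => //; exact: measurable_funN.
- by move=> x; rewrite le_max lexx orbT.
- move=> x; rewrite ge_max (le_trans _ (fK x)) ?(le_trans _ (fK x))//.
  by rewrite -normrN ler_norm.
- by apply: measurable_maxr.
- by move=> x; rewrite le_max lexx orbT.
- move=> x; rewrite ge_max (le_trans _ (fK x)) ?(le_trans _ (fK x))//.
  by rewrite ler_norm.
- move=> x; rewrite mulN1r -rmorphN/= -rmorphD/=; congr (_%:C%C).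
  by rewrite /Num.max; case: ifP; case: ifP; lra.
Qed.

Lemma monotone_class F : cmeasurable F -> (exists K, forall x, Cabs (F x) <= K) ->
  H F.
Proof.
move=> [Fr Fi] [K FK].
have Hr : H (fun x => (Cre (F x))%:C%C).
  by apply: (H_real (K := K)) => // x; exact: le_trans (Cabs_Re _) (FK x).
have Hi : H (fun x => (Cim (F x))%:C%C).
  by apply: (H_real (K := K)) => // x; exact: le_trans (Cabs_Im _) (FK x).
apply: eqH (HD 'i%C Hi Hr) _ => x; rewrite addrC.
by case: (F x) => a b; apply: complexP; simpc.
Qed.

End monotone_class.

Section bounded_borel_functions.
Context {R : realType} {M : completeMetricType R}.
Implicit Types (f g h : Bb M) (F : M -> R[i]).

Lemma Bb_ext f g : (forall x, f x = g x) -> f = g.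
Proof. by move=> fg; apply: val_inj; apply/funext. Qed.

Lemma BbD f g x : (f + g) x = f x + g x. Proof. by []. Qed.
Lemma BbB f g x : (f - g) x = f x - g x. Proof. by []. Qed.
Lemma BbZ (a : R[i]) f x : (a *: f) x = a * f x. Proof. by []. Qed.
Lemma Bb0 x : (0 : Bb M) x = 0. Proof. by []. Qed.

Lemma cmeasurable_Bb f : cmeasurable (f : borel M -> R[i]).
Proof.
case: f => f /=; rewrite inE/= => -[mf _].
exact: ((measurable_complexP (f : borel M -> R[i]) measurableT).1 mf).
Qed.

Lemma Bb_bounded f : exists2 K, 0 <= K & forall x, Cabs (f x) <= K.
Proof.
case: f => f /=; rewrite inE/= => -[_ [K fK]]; exists `|K| => // x.
exact: le_trans (fK x) (ler_norm _).
Qed.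

(** Junk value 0 outside the bounded Borel functions. *)
Definition to_Bb F : Bb M := insubd 0 (F : M -> R[i]^o).

Lemma to_BbE F : cmeasurable (F : borel M -> R[i]) ->
  (exists K, forall x, Cabs (F x) <= K) -> forall x, to_Bb F x = F x.
Proof.
move=> mF FK x; rewrite /to_Bb insubdK// inE/=; split => //.
exact: ((measurable_complexP (F : borel M -> R[i]) measurableT).2 mF).
Qed.

Lemma to_Bb_id f : to_Bb f = f.
Proof. by apply: Bb_ext; apply: to_BbE; [exact: cmeasurable_Bb|have [K _] := Bb_bounded f; exists K]. Qed.

Definition indicb (A : set (borel M)) : Bb M :=
  to_Bb (fun x => (\1_A x : R)%:C%C).

Lemma indicbE (A : set (borel M)) x : measurable A ->
  indicb A x = (\1_A x : R)%:C%C.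
Proof.
move=> mA; apply: to_BbE; first exact: cmeasurable_indic.
by exists 1 => y; rewrite Cabs_real indicE ger0_norm// lern1 leq_b1.
Qed.

Definition bpcvg (f_ : nat -> Bb M) f : Prop :=
  (exists K, forall n x, Cabs (f_ n x) <= K) /\
  (forall x, ccvg (f_^~ x) (f x)).

(** The linear functionals obeying dominated convergence: exactly those given
    by complex measures, by [bp_functional_pairing] and
    [bp_functional_represent]. *)
Definition bp_functional (l : Bb M -> R[i]) : Prop :=
  (forall a f g, l (a *: f + g) = a * l f + l g) /\
  (forall (f_ : nat -> Bb M) f, bpcvg f_ f -> ccvg (fun n => l (f_ n)) (l f)).

Lemma bp_functional0 l : bp_functional l -> l 0 = 0.
Proof.
move=> [lin _]; have := lin (-1) 0 0.
by rewrite scaler0 addr0 mulN1r addNr.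
Qed.

Lemma bp_functionalZ l a f : bp_functional l -> l (a *: f) = a * l f.
Proof.
by move=> bl; rewrite -[_ *: _]addr0 (bl.1) (bp_functional0 bl) addr0.
Qed.

Lemma bp_functionalD l f g : bp_functional l -> l (f + g) = l f + l g.
Proof. by move=> bl; rewrite -[in LHS](scale1r f) bl.1 mul1r. Qed.

Lemma bp_functionalB l f g : bp_functional l -> l (f - g) = l f - l g.
Proof.
move=> bl; have -> : f - g = (-1) *: g + f by rewrite scaleN1r addrC.
by rewrite bl.1 mulN1r addrC.
Qed.

Lemma eq_bp_functional l l' : l =1 l' -> bp_functional l -> bp_functional l'.
Proof. by move=> /funext ->. Qed.

Lemma bp_functional_lincomb (a : R[i]) l l' : bp_functional l ->
  bp_functional l' -> bp_functional (fun f => a * l f + l' f).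
Proof.
move=> bl bl'; split.
  by move=> b f g; rewrite bl.1 bl'.1; ring.
by move=> f_ f ff; apply: ccvgD; [apply: ccvgZ; exact: bl.2|exact: bl'.2].
Qed.

Lemma bp_functional_eval x : bp_functional (fun f => f x).
Proof. by split => // f_ f [_]; exact. Qed.

Lemma bp_functional_cintegral (m : {measure set (borel M) -> \bar R}) :
  (m setT < +oo)%E -> bp_functional (cintegral m setT).
Proof.
move=> mfin.
have icst (K : R) : m.-integrable setT (EFin \o cst K).
  apply: measurable_bounded_integrable => //.
  exact/bounded_cst.
have iB f : cintegrable m setT f.
  have [K K0 fK] := Bb_bounded f.
  by apply: cintegrable_dom (icst K) _ => //; exact: cmeasurable_Bb.
split.
  move=> a f g; rewrite -cintegralZ// -cintegralD//.
  exact: cintegrableZ.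
move=> f_ f [[K f_K] ff].
by apply: (@cdominated_convergence _ _ _ _ _ _ (cst K)) => // n;
  exact: cmeasurable_Bb.
Qed.

(** Two such functionals are equal once they agree on a generating pi-system. *)
Lemma eq_bp_functional_on l l' (G : set (set (borel M))) :
  bp_functional l -> bp_functional l' ->
  @measurable _ (borel M) = <<s G >> -> setI_closed G ->
  l (indicb setT) = l' (indicb setT) ->
  (forall A, G A -> l (indicb A) = l' (indicb A)) -> l =1 l'.
Proof.
move=> bl bl' GE GI lT lG f.
pose H := [set F : borel M -> R[i] |
  exists g : Bb M, (forall x, g x = F x) /\ l g = l' g].
suff [g [gf lg]] : H (f : M -> R[i]) by rewrite -(_ : g = f)//; exact: Bb_ext.
apply: (monotone_class GE GI) => //.
- by exists (indicb setT); split => // x; rewrite indicbE// indicT.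
- move=> a F F' [g [gF lg]] [g' [gF' lg']]; exists (a *: g + g'); split.
    by move=> x; rewrite BbD BbZ gF gF'.
  by rewrite bl.1 bl'.1 lg lg'.
- move=> A GA; exists (indicb A); split; last exact: lG.
  by move=> x; rewrite indicbE// GE; exact: sub_sigma_algebra.
- move=> F_ F K HF FK FF; have [g_ gF] := choice HF.
  have mF : cmeasurable F.
    apply: cmeasurable_lim FF => n; rewrite (_ : F_ n = g_ n).
      exact: cmeasurable_Bb.
    by apply/funext => x; rewrite (gF n).1.
  have FE : forall x, to_Bb F x = F x.
    by apply: to_BbE => //; exists K => x; apply: ccvg_Cabs_le (FF x) _.
  have gb : bpcvg g_ (to_Bb F).
    split; first by exists K => n x; rewrite (gF n).1.
    by move=> x; rewrite FE; apply: eq_ccvg (FF x) => n; rewrite (gF n).1.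
  exists (to_Bb F); split => //; apply: ccvg_unique (bl.2 _ _ gb) _.
  by apply: eq_ccvg (bl'.2 _ _ gb) => n; rewrite (gF n).2.
- exact: cmeasurable_Bb.
- by have [K _ fK] := Bb_bounded f; exists K.
Qed.

Lemma eq_bp_functional_indic l l' : bp_functional l -> bp_functional l' ->
  (forall A, measurable A -> l (indicb A) = l' (indicb A)) -> l =1 l'.
Proof.
move=> bl bl' ll'; apply: (eq_bp_functional_on (G := measurable)) => //.
- by rewrite sigma_algebra_id//; exact: sigma_algebra_measurable.
- by move=> A B mA mB; exact: measurableI.
- exact: ll'.
Qed.

End bounded_borel_functions.

(** * Representation of functionals by complex measures *)

Section representation.
Context {R : realType} {M : completeMetricType R}.
Implicit Types (f g h : Bb M) (A : set (borel M)) (mu : cmeasure R (borel M)).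

Lemma bp_functionalM (a : R[i]) (l : Bb M -> R[i]) : bp_functional l ->
  bp_functional (fun f => a * l f).
Proof.
move=> bl; split; first by move=> b f g; rewrite bl.1; ring.
by move=> f_ f ff; apply: ccvgZ; exact: bl.2.
Qed.

Lemma indicbU A A' : measurable A -> measurable A' -> A `&` A' = set0 ->
  indicb (A `|` A') = indicb A + indicb A'.
Proof.
move=> mA mA' AA'; apply: Bb_ext => x.
rewrite BbD !indicbE//; last exact: measurableU.
rewrite -rmorphD/=; congr (_%:C%C).
rewrite !indicE in_setU; case: (boolP (x \in A)) => xA;
  case: (boolP (x \in A')) => xA' /=; rewrite ?addr0 ?add0r//.
have : (A `&` A') x by split; exact: set_mem.
by rewrite AA'.
Qed.

Lemma indicb0 : indicb (set0 : set (borel M)) = 0.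
Proof. by apply: Bb_ext => x; rewrite indicbE// indic0. Qed.

Lemma Cabs_indicb A x : measurable A -> Cabs (indicb A x) <= 1.
Proof.
by move=> mA; rewrite indicbE// Cabs_real indicE ger0_norm// lern1 leq_b1.
Qed.

Section functional_charge.
Variables (l : Bb M -> R[i]) (bl : bp_functional l).

Definition functional_charge of bp_functional l : set (borel M) -> \bar R :=
  fun A => (Cre (l (indicb A)))%:E.

Let nu := functional_charge bl.

Let nu0 : nu set0 = 0%E.
Proof. by rewrite /nu /functional_charge indicb0 bp_functional0. Qed.

Let nu_fin A : measurable A -> nu A \is a fin_num.
Proof. by []. Qed.

(** Partial unions of the pieces converge boundedly and pointwise, so countable
    additivity is continuity of the functional. *)
Let nu_sigma_additive : semi_sigma_additive nu.
Proof.
move=> F mF tF mUF; pose S n := \big[setU/set0]_(i < n) F i.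
have mS n : measurable (S n) by exact: bigsetU_measurable.
have SE n : (\sum_(0 <= i < n) nu (F i))%E = (Cre (l (indicb (S n))))%:E.
  elim: n => [|n ih]; first by rewrite big_nil /S big_ord0 indicb0 bp_functional0.
  rewrite big_nat_recr//= ih /S big_ord_recr/= indicbU//; last 2 first.
  - exact: mS.
  - by apply: (@trivIset_bigsetUI _ predT) => //; exact: sub_trivIset tF.
  by rewrite bp_functionalD// CreD.
under eq_fun do rewrite SE.
apply/cvg_EFin; first exact: nearW.
apply: (bl.2 (fun n => indicb (S n)) _ _).1; split.
  by exists 1 => n x; exact: Cabs_indicb.
move=> x; apply/ccvgP => e e0.
have [[N _ FN]|nF] := pselect ((\bigcup_k F k) x).
  exists N.+1 => n Nn; rewrite !indicbE// !indicE.
  rewrite (mem_set (_ : S n x)); last first.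
    by rewrite /S -bigcup_mkord; exists N.
  by rewrite mem_set ?subrr ?Cabs0//; exists N.
exists 0%N => n _; rewrite !indicbE// !indicE (memNset nF) memNset.
  by rewrite subrr Cabs0.
by rewrite /S -bigcup_mkord => -[k _ Fk]; apply: nF; exists k.
Qed.

HB.instance Definition _ :=
  isCharge.Build _ _ _ (functional_charge bl) nu0 nu_fin nu_sigma_additive.

End functional_charge.

Lemma cintegral_indicb (m : {finite_measure set (borel M) -> \bar R}) A :
  measurable A -> cintegral m setT (indicb A) = (fine (m A))%:C%C.
Proof.
move=> mA; apply: complexP => /=; rewrite /Rintegral.
  under eq_integral do rewrite indicbE//=.
  by rewrite integral_indic// setIT.
under eq_integral do rewrite indicbE//=.
by rewrite integral0.
Qed.

Lemma charge_integral_indicb (nu : {charge set (borel M) -> \bar R}) A :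
  measurable A -> charge_integral nu (indicb A) = (fine (nu A))%:C%C.
Proof.
move=> mA; rewrite /charge_integral !cintegral_indicb// -rmorphB/=.
congr (_%:C%C); rewrite (jordan_decomp (hahnP nu) mA) /cadd.
rewrite fineD ?fin_num_measure//; congr (_ + _); rewrite -fineN; congr fine.
transitivity ((-1)%:E * jordan_neg (hahnP nu) A)%E; last by [].
by rewrite EFinN mulN1e.
Qed.

Lemma bp_functional_charge_integral (nu : {charge set (borel M) -> \bar R}) :
  bp_functional (charge_integral nu).
Proof.
have bp : bp_functional (cintegral (jordan_pos (hahnP nu)) setT).
  by apply: bp_functional_cintegral; rewrite ltey_eq fin_num_measure.
have bn : bp_functional (cintegral (jordan_neg (hahnP nu)) setT).
  by apply: bp_functional_cintegral; rewrite ltey_eq fin_num_measure.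
apply: eq_bp_functional (bp_functional_lincomb (-1) bn bp) => f.
by rewrite mulN1r addrC.
Qed.

Lemma bp_functional_pairing mu : bp_functional (fun f => pairing f mu).
Proof.
apply: eq_bp_functional (bp_functional_lincomb 'i%C
  (bp_functional_charge_integral (cmeas_im mu))
  (bp_functional_charge_integral (cmeas_re mu))) => f.
by rewrite addrC.
Qed.

(** The values on indicators of a functional continuous for bounded pointwise
    convergence form a complex measure, by which it is then given. *)
Lemma bp_functional_represent (l : Bb M -> R[i]) : bp_functional l ->
  exists mu : cmeasure R (borel M), forall f, pairing f mu = l f.
Proof.
move=> bl; have bil := bp_functionalM (- 'i%C) bl.
exists (CMeasure (functional_charge bl) (functional_charge bil)).
apply: eq_bp_functional_indic => //; first exact: bp_functional_pairing.
move=> A mA; rewrite /pairing /cmeasure_integral/=.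
rewrite !charge_integral_indicb//= /functional_charge/=.
by case: (l _) => a b; apply: complexP => /=; ring.
Qed.

(** Every such functional is a linear combination of integrals against finite
    measures; this is how Fubini's theorem reaches it. *)
Lemma bp_functional_ind (P : (Bb M -> R[i]) -> Prop) :
  (forall m : {finite_measure set (borel M) -> \bar R}, P (fun f => cintegral m setT f)) ->
  (forall (a : R[i]) l l', P l -> P l' -> P (fun f => a * l f + l' f)) ->
  forall l, bp_functional l -> P l.
Proof.
move=> Pm PD l /bp_functional_represent[mu muE].
have Pc (nu : {charge set (borel M) -> \bar R}) : P (fun f => charge_integral nu f).
  rewrite (_ : (fun f => _) = fun f : Bb M =>
      -1 * cintegral (jordan_neg (hahnP nu)) setT f +
      cintegral (jordan_pos (hahnP nu)) setT f); first exact: (PD (-1) _ _ (Pm _) (Pm _)).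
  by apply/funext => f; rewrite mulN1r addrC.
rewrite (_ : l = fun f : Bb M =>
    'i%C * charge_integral (cmeas_im mu) f + charge_integral (cmeas_re mu) f).
  exact: (PD _ _ _ (Pc _) (Pc _)).
by apply/funext => f; rewrite -muE addrC.
Qed.

End representation.

(** * Sigma-continuity as bounded pointwise continuity *)

(** Convergence in the initial topology of a map that need not be onto. *)
Lemma cvg_initial_topology (S : choiceType) (T : topologicalType) (f : S -> T)
    (F : set_system S) (s : S) : Filter F ->
  F --> (s : initial_topology f) <-> f @ F --> f s.
Proof.
move=> FF; split=> [Fs A /initial_continuous/Fs//|Fs].
move=> A [_ [[B oB <-] Bs] BA]; apply: filterS BA _.
by apply: Fs; exact: open_nbhs_nbhs.
Qed.

Section sigma_continuity.
Context {R : realType} {M : completeMetricType R}.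
Implicit Types (f g h : Bb M) (mu : cmeasure R (borel M)) (U V : Bb M -> Bb M).

Lemma cvg_sigma_top (F : set_system (sigma_top M)) f : Filter F ->
  F --> (f : sigma_top M) <->
  forall mu, (fun g : sigma_top M => pairing g mu : Cplx R) @ F --> (pairing f mu : Cplx R).
Proof.
move=> FF; apply: (iff_trans (@cvg_initial_topology (Bb M)
  {ptws cmeasure R (borel M) -> Cplx R} (@pairing R M) F f FF)).
apply: (iff_trans (@cvg_sup _ _ _ (@pairing R M @ F) (@pairing R M f) _)).
split=> H mu; have := H mu.
  move=> /(@cvg_initial_topology {ptws cmeasure R (borel M) -> Cplx R}).
  exact.
by move=> ?; apply/(@cvg_initial_topology {ptws cmeasure R (borel M) -> Cplx R}).
Qed.

(** The pointwise form of sigma-continuity: each [U f x] depends on [f] through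
    a complex measure, the kernel of [U] at [x]. *)
Definition bp_operator U : Prop := forall x, bp_functional (fun f => U f x).

Definition bounded_operator U (K : R) : Prop :=
  forall f b, (forall x, Cabs (f x) <= b) -> forall x, Cabs (U f x) <= K * b.

Lemma bp_operator_linear U : bp_operator U ->
  forall a f g, U (a *: f + g) = a *: U f + U g.
Proof. by move=> bU a f g; apply: Bb_ext => x; rewrite (bU x).1. Qed.

Lemma bp_operator0 U : bp_operator U -> U 0 = 0.
Proof. by move=> bU; apply: Bb_ext => x; exact: (bp_functional0 (bU x)). Qed.

Lemma bp_operatorZ U a f : bp_operator U -> U (a *: f) = a *: U f.
Proof.
by move=> bU; apply: Bb_ext => x; rewrite (bp_functionalZ _ _ (bU x)).
Qed.

Lemma bp_operatorD U f g : bp_operator U -> U (f + g) = U f + U g.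
Proof.
by move=> bU; apply: Bb_ext => x; rewrite (bp_functionalD _ _ (bU x)).
Qed.

Lemma bp_operatorB U f g : bp_operator U -> U (f - g) = U f - U g.
Proof.
by move=> bU; apply: Bb_ext => x; rewrite (bp_functionalB _ _ (bU x)).
Qed.

(** Bounded pointwise convergence implies convergence for [sigma] by dominated
    convergence, and evaluation at a point is pairing with a measure. *)
Lemma sigma_operator_bp U : sigma_operator U -> bp_operator U.
Proof.
move=> [lU cU] x; split=> [a f g|f_ f ff]; first by rewrite lU.
have [mu muE] := bp_functional_represent (@bp_functional_eval R M x).
have fs : (f_ : nat -> sigma_top M) @ \oo --> (f : sigma_top M).
  apply/cvg_sigma_top => nu.
  by apply/ccvg_topP; exact: (bp_functional_pairing nu).2.
have /cvg_sigma_top /(_ mu) := cvg_comp _ _ fs (cU f).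
by move=> /ccvg_topP; rewrite muE; apply: eq_ccvg => n; rewrite muE.
Qed.

Lemma bp_functional_comp (l : Bb M -> R[i]) U K : bp_functional l ->
  bp_operator U -> bounded_operator U K -> bp_functional (l \o U).
Proof.
move=> bl bU UK; split=> [a f g|f_ f ff] /=.
  by rewrite bp_operator_linear// bl.1.
apply: bl.2; split; last by move=> x; apply: (bU x).2.
by have [[b fb] _] := ff; exists (K * b) => n; apply: UK.
Qed.

(** For the converse, the functional [f |-> <U f, mu>] is again given by a
    measure, so [U] has an adjoint on measures. *)
Lemma bp_operator_sigma U K : bp_operator U -> bounded_operator U K ->
  sigma_operator U.
Proof.
move=> bU UK; split; first by move=> a f g; exact: bp_operator_linear.
move=> f; apply/(@cvg_sigma_top (U @ nbhs (f : sigma_top M))) => mu.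
have [nu nuE] := bp_functional_represent
  (bp_functional_comp (bp_functional_pairing mu) bU UK).
have FF : Filter (nbhs (f : sigma_top M)) by exact: nbhs_filter.
have h := (cvg_sigma_top f FF).1 (@cvg_id _ _) nu.
have E : (fun g : sigma_top M => pairing g nu : Cplx R) =
    (fun g => pairing (U g) mu) by apply/funext => g; rewrite nuE.
by rewrite E nuE in h; exact: h.
Qed.

Lemma bp_operator_comp U V : bp_operator U -> bp_operator V ->
  (exists K, bounded_operator V K) -> bp_operator (U \o V).
Proof. by move=> bU bV [K VK] x; exact: (bp_functional_comp (bU x) bV VK). Qed.

Lemma Cabs_supnorm f x : Cabs (f x) <= supnorm f.
Proof.
apply: ub_le_sup; last by exists x.
by have [K _ fK] := Bb_bounded f; exists K => _ [y _ <-].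
Qed.

Lemma supnorm_le f b : 0 <= b -> (forall x, Cabs (f x) <= b) -> supnorm f <= b.
Proof.
move=> b0 fb; have [E|/set0P ne] := eqVneq [set Cabs (f x) | x in [set: M]] set0.
  by rewrite /supnorm E sup0.
by apply: ge_sup => // _ [y _ <-].
Qed.

Lemma bounded_operator_opnorm U K : linear U ->
  (opnorm U <= K%:E)%E -> bounded_operator U K.
Proof.
move=> lU UK f b fb x.
have bU f' : supnorm f' <= 1 -> Cabs (U f' x) <= K.
  move=> f1; apply: le_trans (Cabs_supnorm _ _) _; rewrite -lee_fin.
  by apply: le_trans UK; apply: ereal_sup_ubound; exists f'.
have U0 : U 0 = 0.
  by have := lU (-1) 0 0; rewrite scaler0 addr0 scaleN1r addNr.
have UZ a g : U (a *: g) = a *: U g.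
  by rewrite -[a *: g]addr0 lU U0 addr0.
have b0 : 0 <= b := le_trans (Cabs_ge0 _) (fb x).
have K0 : 0 <= K.
  apply: le_trans (Cabs_ge0 (U 0 x)) (bU 0 _).
  by apply: supnorm_le => // y; rewrite Bb0 Cabs0.
have [b00|bn0] := eqVneq b 0.
  have -> : f = 0.
    by apply: Bb_ext => y; apply: Cabs_eq0; rewrite -b00.
  by rewrite U0 Bb0 Cabs0 mulr_ge0.
have bp : 0 < b by rewrite lt_def bn0.
have -> : f = b%:C%C *: (b^-1%:C%C *: f).
  by rewrite scalerA -rmorphM/= divff// scale1r.
rewrite UZ BbZ CabsM Cabs_real ger0_norm// mulrC ler_wpM2r// bU//.
apply: supnorm_le => // y; rewrite BbZ CabsM Cabs_real ger0_norm ?invr_ge0//.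
by rewrite mulrC ler_pdivrMr// mul1r.
Qed.

Lemma opnorm_le U K : 0 <= K -> bounded_operator U K -> (opnorm U <= K%:E)%E.
Proof.
move=> K0 UK; apply: ge_ereal_sup => _ [f f1 <-]; rewrite lee_fin.
apply: supnorm_le => // x; rewrite -[leRHS]mulr1.
by apply: UK => y; exact: le_trans (Cabs_supnorm _ _) f1.
Qed.

End sigma_continuity.

(** * Joint measurability and integrals of families *)

Section joint_measurability.
Context {R : realType} {M : completeMetricType R}.
Implicit Types (f g h : Bb M).
Local Notation RR := (measurableTypeR R).

Lemma cmeasurable_pair2 d (Z : measurableType d) (F : Z * borel M -> R[i]) z :
  cmeasurable F -> cmeasurable (fun x => F (z, x)).
Proof. by move=> mF; exact: (cmeasurable_comp mF (@measurable_pair1 _ _ _ _ z)). Qed.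

Lemma cmeasurable_Bb2 d (Z : measurableType d) f :
  cmeasurable (fun p : Z * borel M => f p.2).
Proof. exact: (cmeasurable_comp (cmeasurable_Bb f) measurable_snd). Qed.

(** By linearity and continuity, joint measurability of [U z f x] for every
    fixed [f] allows [f] itself to depend measurably on [z]: check it on
    indicators of rectangles. *)
Lemma cmeasurable_operator_apply d (Z : measurableType d)
    (U : Z -> Bb M -> Bb M) (G : Z -> Bb M) :
  (forall z, bp_operator (U z)) ->
  (forall f, cmeasurable (fun p : Z * borel M => U p.1 f p.2)) ->
  cmeasurable (fun p : Z * borel M => G p.1 p.2) ->
  cmeasurable (fun p : Z * borel M => U p.1 (G p.1) p.2).
Proof.
move=> bU mU mG.
pose sec (F : Z * borel M -> R[i]) z : Bb M := to_Bb (fun y => F (z, y)).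
pose H := [set F : Z * borel M -> R[i] |
  [/\ cmeasurable F, exists K, forall p, Cabs (F p) <= K &
      cmeasurable (fun p : Z * borel M => U p.1 (sec F p.1) p.2)]].
have secE F z : cmeasurable F -> (exists K, forall p, Cabs (F p) <= K) ->
    forall x, sec F z x = F (z, x).
  move=> mF [K FK]; apply: to_BbE; first exact: cmeasurable_pair2.
  by exists K => x.
have Hlim (F_ : nat -> Z * borel M -> R[i]) F :
    (forall n, H (F_ n)) ->
    (forall z, exists K, forall n x, Cabs (F_ n (z, x)) <= K) ->
    (forall p, ccvg (F_^~ p) (F p)) ->
    cmeasurable F /\
    cmeasurable (fun p : Z * borel M => U p.1 (sec F p.1) p.2).
  move=> HF FK FF; have mF : cmeasurable F.
    by apply: cmeasurable_lim FF => n; have [] := HF n.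
  split => //; apply: (cmeasurable_lim (F_ := fun n (p : Z * borel M) =>
      U p.1 (sec (F_ n) p.1) p.2)).
    by move=> n; have [] := HF n.
  move=> -[z x] /=; apply: (bU z x).2; have [K Kb] := FK z; split.
    exists K => n y; rewrite secE//; have [] := HF n => //.
  move=> y; rewrite /sec to_BbE; last 2 first.
  - exact: cmeasurable_pair2.
  - by exists K => {}x; apply: ccvg_Cabs_le (FF (z, x)) _.
  by apply: eq_ccvg (FF (z, y)) => n; rewrite secE//; have [] := HF n.
have Hb F : cmeasurable F -> (exists K, forall p, Cabs (F p) <= K) -> H F.
  have Hrect (A : set Z) (C : set (borel M)) : measurable A -> measurable C ->
      H (fun p => (\1_(A `*` C) p : R)%:C%C).
    move=> mA mC; have mAC : measurable (A `*` C) by exact: measurableX.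
    have bAC : exists K, forall p, Cabs ((\1_(A `*` C) p : R)%:C%C) <= K.
      by exists 1 => p; rewrite Cabs_real indicE ger0_norm// lern1 leq_b1.
    have cAC := @cmeasurable_indic R _ _ _ mAC.
    split => //; rewrite (_ : (fun p => _) = fun p =>
        (\1_A p.1 : R)%:C%C * U p.1 (indicb C) p.2).
      apply: cmeasurableM => //.
      exact: (cmeasurable_comp (cmeasurable_indic mA) measurable_fst).
    apply/funext => -[z x] /=; rewrite -BbZ -bp_operatorZ//; congr (U _ _ _).
    apply: Bb_ext => y; rewrite secE// BbZ indicbE// -rmorphM/=.
    by rewrite !indicE in_setX/= -natrM mulnb.
  move=> mF bF; refine (monotone_class (H := H) (measurable_prod_measurableType Z (borel M)) _ _ _ _ _ mF bF).
  - move=> _ _ [A1 mA1 [C1 mC1 <-]] [A2 mA2 [C2 mC2 <-]].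
    exists (A1 `&` A2); first exact: measurableI.
    exists (C1 `&` C2); first exact: measurableI.
    by rewrite setXI.
  - have := Hrect _ _ measurableT measurableT.
    by under [X in H X]eq_fun do rewrite setXTT indicT.
  - move=> a F1 F2 [mF1 [K1 FK1] mUF1] [mF2 [K2 FK2] mUF2].
    have mF12 : cmeasurable (fun p => a * F1 p + F2 p).
      by apply: cmeasurableD => //; exact: cmeasurableZ.
    have bF12 : exists K, forall p, Cabs (a * F1 p + F2 p) <= K.
      exists (Cabs a * K1 + K2) => p.
      apply: le_trans (CabsD _ _) _; rewrite lerD// CabsM ler_wpM2l//.
      exact: Cabs_ge0.
    split => //; rewrite (_ : (fun p => _) = fun p =>
        a * U p.1 (sec F1 p.1) p.2 + U p.1 (sec F2 p.1) p.2).
      by apply: cmeasurableD => //; exact: cmeasurableZ.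
    apply/funext => -[z x] /=; rewrite -(bU z x).1; congr (U _ _ _).
    apply: Bb_ext => y; rewrite BbD BbZ (secE _ z mF12 bF12).
    rewrite (secE _ z mF1 (ex_intro _ K1 FK1)).
    by rewrite (secE _ z mF2 (ex_intro _ K2 FK2)).
  - by move=> _ [A mA [C mC <-]]; exact: Hrect.
  - move=> F_ F0 K HF FK FF; have [|mF0 mU0] := Hlim F_ F0 HF _ FF.
      by exists K.
    by split => //; exists K => p; apply: ccvg_Cabs_le (FF p) _.
(* [G z] is bounded for each [z] but not uniformly in [z]: truncate. *)
pose F_ n (p : Z * borel M) : R[i] :=
  (\1_[set q : Z * borel M | Cabs (G q.1 q.2) <= n%:R] p : R)%:C%C * G p.1 p.2.
have mn n : measurable [set q : Z * borel M | Cabs (G q.1 q.2) <= n%:R].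
  have := measurable_Cabs mG measurableT (measurable_itv `]-oo, n%:R]).
  rewrite setTI (_ : _ @^-1` _ =
    [set q : Z * borel M | Cabs (G q.1 q.2) <= n%:R]).
    exact.
  by apply/seteqP; split => p /=; rewrite in_itv.
have HF n : H (F_ n).
  apply: Hb; first by apply: cmeasurableM => //; exact: cmeasurable_indic.
  exists n%:R => p; rewrite CabsM Cabs_real indicE.
  have [/set_mem/= pn|_] := boolP (_ \in _); first by rewrite normr1 mul1r.
  by rewrite normr0 mul0r.
have [] := Hlim F_ (fun p => G p.1 p.2) HF.
- move=> z; have [K K0 GK] := Bb_bounded (G z); exists K => n x.
  rewrite CabsM Cabs_real indicE; case: (_ \in _); first by rewrite normr1 mul1r.
  by rewrite normr0 mul0r.
- move=> [z x]; have [K K0 GK] := Bb_bounded (G z).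
  apply/ccvgP => e e0; exists (Num.truncn K).+1 => n Kn; rewrite /F_ indicE mem_set/=.
    by rewrite mul1r subrr Cabs0.
  apply: le_trans (GK x) _; apply: ltW; apply: lt_le_trans (truncnS_gt K) _.
  by rewrite ler_nat.
move=> _; rewrite /sec/=.
by under eq_fun do rewrite to_Bb_id.
Qed.

(** A right-continuous family is the pointwise limit of the step families
    obtained by rounding the parameter up to the grid of mesh [1/(n+1)]. *)
Lemma cmeasurable_right_continuous (G : R -> Bb M) :
  (forall s, s <= 0 -> G s = 0) ->
  (forall (u : nat -> R) s x, 0 < s -> (forall n, s < u n) -> u @ \oo --> s ->
    ccvg (fun n => G (u n) x) (G s x)) ->
  cmeasurable (fun p : RR * borel M => G p.1 p.2).
Proof.
move=> G0 Gr; pose I n k : set RR :=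
  `[k%:R / n.+1%:R, k.+1%:R / n.+1%:R[%classic `&` `]0, +oo[%classic.
have mI n k : measurable (I n k) by apply: measurableI; exact: measurable_itv.
pose F_ n (p : RR * borel M) : R[i] :=
  \sum_(0 <= k < n.+1 ^ 2) (\1_(I n k) p.1 : R)%:C%C * G (k.+1%:R / n.+1%:R) p.2.
apply: (cmeasurable_lim (F_ := F_)) => [n|[s x]].
  rewrite /F_; elim: (n.+1 ^ 2)%N => [|m ih].
    under eq_fun do rewrite big_nil; exact: cmeasurable_cst.
  under eq_fun do rewrite big_nat_recr//=; apply: cmeasurableD => //.
  apply: cmeasurableM; last exact: cmeasurable_Bb2.
  exact: (cmeasurable_comp (cmeasurable_indic (mI n m)) measurable_fst).
have [s0|s0] := leP s 0.
  rewrite /= G0//; apply: eq_ccvg (ccvg_cst 0) => n; rewrite /F_ big1//= => k _.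
  rewrite indicE memNset ?mul0r// => -[_] /=; rewrite in_itv/= andbT.
  by rewrite ltNge s0.
pose j n := Num.truncn (s * n.+1%:R).
have jP n : (j n)%:R <= s * n.+1%:R < (j n).+1%:R.
  by apply: truncn_itv; rewrite mulr_ge0// ltW.
pose u n : R := (j n).+1%:R / n.+1%:R.
have su n : s < u n by rewrite /u ltr_pdivlMr//; have /andP[] := jP n.
have us n : u n - s <= n.+1%:R^-1.
  rewrite lerBlDr /u ler_pdivrMr// mulrDl mulVf ?pnatr_eq0// -natr1 addrC lerD2l.
  by have /andP[] := jP n.
have uc : u @ \oo --> s.
  apply/cvgrPdist_lt => e e0; have [N _ HN] := near_infty_natSinv_lt (PosNum e0).
  exists N => // n /= /HN /= ne; apply: le_lt_trans ne.
  by rewrite distrC ger0_norm// subr_ge0 ltW.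
have /ccvgP cu := Gr u s x s0 su uc.
apply/ccvgP => e /cu[N HN]; exists (maxn N (Num.truncn s).+1) => n.
rewrite geq_max => /andP[Nn sn]; have := HN n Nn.
suff -> : F_ n (s, x) = G (u n) x by [].
have Isk k : \1_(I n k) s = (k == j n)%:R :> R.
  rewrite indicE; congr (_%:R); congr nat_of_bool; apply/idP/eqP => [|->].
    move=> /set_mem[/=]; rewrite !in_itv/= ler_pdivrMr// ltr_pdivlMr//.
    by move=> /andP[k1 k2] _; apply/esym/truncn_def; rewrite k1 k2.
  apply/mem_set; split; rewrite /= in_itv/= ?s0//.
  by rewrite ler_pdivrMr// ltr_pdivlMr.
have jn : (j n < n.+1 ^ 2)%N.
  rewrite -(ltr_nat R); have /andP[js _] := jP n; apply: le_lt_trans js _.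
  rewrite -mulnn natrM ltr_pM2r// (lt_le_trans (truncnS_gt s))// ler_nat.
  exact: leqW.
rewrite /F_ big_mkord (bigD1 (Ordinal jn))//= Isk eqxx mul1r big1 ?addr0//.
move=> k /eqP kj; rewrite Isk; have [kjn|_] := eqP; last by rewrite mul0r.
by exfalso; apply: kj; exact: val_inj.
Qed.

End joint_measurability.

Section measure_integral.
Context {R : realType} {M : completeMetricType R}.
Implicit Types (f g h : Bb M) (Phi : R -> Bb M) (k : R -> R).
Local Notation lebesgue := (@lebesgue_measure R).
Local Notation RR := (measurableTypeR R).

Definition dominated_family Phi k : Prop :=
  [/\ cmeasurable (fun p : RR * borel M => Phi p.1 p.2),
      lebesgue.-integrable setT (EFin \o (k : RR -> R)) &
      forall s x, Cabs (Phi s x) <= k s].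

Lemma dominated_family_section Phi k x : dominated_family Phi k ->
  cmeasurable (fun s : RR => Phi s x).
Proof.
case=> mP _ _; apply: (cmeasurable_comp (h := fun s : RR => (s, x : borel M)) mP).
exact: measurable_pair2.
Qed.

Definition mint Phi : Bb M :=
  to_Bb (fun x => cintegral lebesgue setT (fun s : RR => Phi s x)).

Lemma mintE Phi k x : dominated_family Phi k ->
  mint Phi x = cintegral lebesgue setT (fun s : RR => Phi s x).
Proof.
move=> dP; apply: to_BbE; case: (dP) => mP ik Pk.
  exact: (cmeasurable_cintegral lebesgue mP).
exists (2 * \int[lebesgue]_s k s) => y.
by apply: Cabs_cintegral => //; exact: (dominated_family_section _ dP).
Qed.

Lemma cintegrable_dominated Phi k x : dominated_family Phi k ->
  cintegrable lebesgue setT (fun s : RR => Phi s x).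
Proof.
move=> dP; case: (dP) => _ ik Pk; apply: cintegrable_dom ik _ => //.
exact: (dominated_family_section _ dP).
Qed.

Lemma Cabs_mint Phi k x : dominated_family Phi k ->
  Cabs (mint Phi x) <= 2 * \int[lebesgue]_s k s.
Proof.
move=> dP; rewrite (mintE _ dP); case: (dP) => _ ik Pk.
by apply: Cabs_cintegral => //; exact: (dominated_family_section _ dP).
Qed.

(** Sigma-continuous operations commute with integrals over the parameter: this
    is Fubini's theorem for the measure representing the functional. It makes
    [mint Phi] an M-integral. *)
Lemma bp_functional_mint (l : Bb M -> R[i]) Phi k : bp_functional l ->
  dominated_family Phi k ->
  cintegrable lebesgue setT (fun s : RR => l (Phi s)) /\
  l (mint Phi) = cintegral lebesgue setT (fun s : RR => l (Phi s)).
Proof.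
move=> bl dP; move: l bl; apply: bp_functional_ind; last first.
  move=> a l l' [il lE] [il' lE']; split.
    by apply: cintegrableD => //; exact: cintegrableZ.
  by rewrite lE lE' -cintegralZ// -cintegralD//; exact: cintegrableZ.
move=> m; case: (dP) => mP ik Pk.
pose g (z : RR * borel M) := k z.1.
have mk : measurable_fun setT (k : RR -> R).
  by apply/measurable_EFinP; exact: (measurable_int lebesgue).
have mg : measurable_fun setT g by exact: (measurableT_comp mk measurable_fst).
have k0 s : 0 <= k s by exact: le_trans (Cabs_ge0 _) (Pk s point).
have ig : (lebesgue \x m)%E.-integrable setT (EFin \o g).
  apply/integrable12ltyP; first exact/measurable_EFinP.
  have Ei s : (\int[m]_y `|(EFin \o g) (s, y)| = (k s * fine (m setT))%:E)%E.
    under eq_integral do rewrite /= /g/= ger0_norm//.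
    by rewrite integral_cst// EFinM fineK// fin_num_measure.
  under eq_integral do rewrite Ei.
  apply: integrable_lty => //.
  by apply: eq_integrable (integrableZr measurableT (fine (m setT)) ik).
have [] := @cintegral_fubini _ _ _ _ _ lebesgue m
  (fun z : RR * borel M => Phi z.1 z.2) g mP _ ig.
- by move=> [s x] /=; exact: Pk.
- move=> s.
  by apply: eq_integrable (finite_measure_integrable_cst m (k s) measurableT).
- by [].
move=> i1 i2; split => //; rewrite [RHS]i2.
by apply: eq_cintegral => x _; rewrite (mintE _ dP).
Qed.

End measure_integral.

(** * Right continuity of strong Feller semigroups *)

Section real_exponential.
Context {R : realType}.
Local Notation lebesgue := (@lebesgue_measure R).
Local Notation RR := (measurableTypeR R).
Implicit Types (r s t : R).

Definition half_exp r : RR -> R := fun t => if 0 <= t then expR (- r * t) else 0.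

Lemma half_exp_ge0 r t : 0 <= half_exp r t.
Proof. by rewrite /half_exp; case: ifP => // _; exact: expR_ge0. Qed.

Lemma half_expE r : 0 < r ->
  half_exp r = (fun t : RR => r^-1 * exponential_pdf r t).
Proof.
move=> r0; apply/funext => t; rewrite /half_exp; have [t0|t0] := leP 0 t.
  by rewrite exponential_pdfE// mulrA mulVf ?mul1r// gt_eqF.
by rewrite lt0_exponential_pdf// mulr0.
Qed.

Lemma integrable_half_exp r : 0 < r ->
  lebesgue.-integrable setT (EFin \o half_exp r).
Proof.
move=> r0; rewrite (half_expE r0).
have := integrableZl measurableT r^-1 (integrable_exponential_pdf r0).
exact: eq_integrable.
Qed.

Lemma Rintegral_half_exp r : 0 < r -> \int[lebesgue]_t half_exp r t = r^-1.
Proof.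
move=> r0; rewrite (half_expE r0) RintegralZl//.
  by rewrite /Rintegral integral_exponential_pdf// mulr1.
exact: integrable_exponential_pdf.
Qed.

Lemma measurable_half_exp r : measurable_fun setT (half_exp r).
Proof.
rewrite /half_exp; apply: measurable_fun_ifT => //.
  exact: measurable_fun_ler.
by apply: measurableT_comp => //; exact: measurable_funM.
Qed.

Lemma indic_expE r t :
  (\1_(`[0, +oo[ : set RR) t : R) * expR (- (r * t)) = half_exp r t.
Proof.
rewrite /half_exp indicE mulNr; have [t0|t0] := leP 0 t.
  by rewrite mem_set ?mul1r//= in_itv/= t0.
by rewrite memNset ?mul0r//= in_itv/= andbT leNgt t0.
Qed.

Lemma half_exp_le1 r t : 0 < r -> half_exp r t <= 1.
Proof.
move=> r0; rewrite /half_exp; case: ifP => // t0.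
by rewrite -expR0 ler_expR mulNr oppr_le0 mulr_ge0// ltW.
Qed.

(** [expR y >= y ^+ 2 / 4], since [expR y] is the square of [expR (y / 2)]. *)
Lemma exp_decay_beats_linear (c d e : R) : 0 <= c -> 0 < d -> 0 < e ->
  exists N, forall n, (N <= n)%N -> n.+1%:R * c * expR (- (n.+1%:R * d)) < e.
Proof.
move=> c0 d0 e0; exists (Num.truncn (4 * c / (d ^+ 2 * e))).+1 => n Nn.
have n0 : 0 < n.+1%:R :> R by [].
set y := n.+1%:R * d; have y0 : 0 < y by rewrite mulr_gt0.
have ey : y ^+ 2 / 4 <= expR y.
  rewrite [X in expR X](splitr y) expRD -expr2.
  have -> : y ^+ 2 / 4 = (y / 2) ^+ 2 by field.
  rewrite lerXn2r ?nnegrE ?expR_ge0//; first by rewrite divr_ge0// ltW.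
  by apply: le_trans (expR_ge1Dx _); rewrite lerDr.
have hn : 4 * c < n.+1%:R * (d ^+ 2 * e).
  rewrite -ltr_pdivrMr ?mulr_gt0 ?exprn_gt0//.
  apply: lt_le_trans (truncnS_gt _) _; rewrite ler_nat.
  exact: leqW.
rewrite expRN ltr_pdivrMr ?expR_gt0//; apply: lt_le_trans (ler_wpM2l (ltW e0) ey).
rewrite /y; have -> : e * ((n.+1%:R * d) ^+ 2 / 4) =
  n.+1%:R * (n.+1%:R * (d ^+ 2 * e)) / 4 by ring.
rewrite ltr_pdivlMr// -mulrA ltr_pM2l//.
by rewrite mulrC.
Qed.

Lemma cvg_seq_ub (u : nat -> R) s : u @ \oo --> s -> exists b, forall n, u n <= b.
Proof.
move=> us; have [b [_ ub]] : bounded_fun u.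
  by apply: cvg_seq_bounded; apply/cvg_ex; exists s.
exists (b + 1) => n; have := ub (b + 1); rewrite ltrDl ltr01 => /(_ isT n I) /=.
exact: le_trans (ler_norm _).
Qed.

End real_exponential.

Section strong_feller_semigroups.
Context {R : realType} {M : completeMetricType R}.
Variables (T : R -> Bb M -> Bb M) (C w : R).
Hypotheses (T_sfs : strong_feller_semigroup T) (T_type : of_type T C w).
Implicit Types (f g h : Bb M) (x : M) (s t r : R).
Local Notation lebesgue := (@lebesgue_measure R).
Local Notation RR := (measurableTypeR R).

Lemma semigroup_bp t : 0 <= t -> bp_operator (T t).
Proof. by move=> /(sfs_operator T_sfs)/sigma_operator_bp. Qed.

Lemma semigroup_bounded t : 0 <= t -> bounded_operator (T t) (C * expR (w * t)).
Proof.
move=> t0; apply: bounded_operator_opnorm; last exact: T_type.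
by have [] := sfs_operator T_sfs t0.
Qed.

Lemma semigroupD r t f : 0 <= r -> 0 <= t -> T r (T t f) = T (r + t) f.
Proof. by move=> r0 t0; rewrite (sfsD T_sfs). Qed.

Lemma semigroup_near0 f x : continuous (f : M -> Cplx R) ->
  forall e : R, 0 < e ->
  exists2 d : R, 0 < d & forall t, 0 < t -> t < d -> Cabs (T t f x - f x) < e.
Proof.
move=> cf e e0.
have [mu muE] := bp_functional_represent (@bp_functional_eval R M x).
have h := (cvg_sigma_top f _).1 (sfs_cvg T_sfs cf) mu.
have he : 0 < e%:C%C by rewrite ltcR.
have [d /= d0 dP] := (cvg_ballP _ _).1 (h _) _ he.
exists d => // t t0 td; have : ball_ Num.norm 0 d t by rewrite /= sub0r normrN gtr0_norm.
move=> /dP /(_ t0); rewrite /ball/= CnormE ltcR !muE.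
by rewrite CabsB.
Qed.

Lemma semigroup_bpcvg0 f (u : nat -> R) : continuous (f : M -> Cplx R) ->
  (forall n, 0 < u n) -> u @ \oo --> 0 -> bpcvg (fun n => T (u n) f) f.
Proof.
move=> cf u0 uc; split.
  have [b ub] := cvg_seq_ub uc; have [K K0 fK] := Bb_bounded f.
  exists (`|C| * expR (`|w| * b) * K) => n x.
  apply: le_trans (semigroup_bounded (ltW (u0 n)) fK x) _.
  apply: ler_wpM2r => //; apply: le_trans (ler_wpM2r (expR_ge0 _) (ler_norm _)) _.
  apply: ler_wpM2l => //; rewrite ler_expR (le_trans (ler_norm _))// normrM.
  by rewrite ler_wpM2l// gtr0_norm.
move=> x; apply/ccvgP => e /(semigroup_near0 x cf)[d d0 dP].
move/cvgrPdist_lt : uc => /(_ _ d0)[N _ HN]; exists N => n Nn.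
apply: dP => //; have := HN _ Nn; rewrite /= sub0r normrN.
exact/le_lt_trans/ler_norm.
Qed.

Lemma bpcvg_operator (U : Bb M -> Bb M) K (f_ : nat -> Bb M) f :
  bp_operator U -> bounded_operator U K ->
  bpcvg f_ f -> bpcvg (fun n => U (f_ n)) (U f).
Proof.
move=> bU UK ff; split; last by move=> x; exact: (bU x).2.
by have [[b fb] _] := ff; exists (K * b) => n; apply: UK.
Qed.

(** Right continuity holds for every [f]: the strong Feller property puts
    [T (s / 2) f] among the continuous functions. *)
Lemma semigroup_bpcvg f (u : nat -> R) s : 0 < s -> (forall n, s < u n) ->
  u @ \oo --> s -> bpcvg (fun n => T (u n) f) (T s f).
Proof.
move=> s0 su us; have s20 : 0 < s / 2 by rewrite divr_gt0.
have cg := sfs_strong_feller T_sfs s20 (f := f).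
have vc : (fun n => u n - s) @ \oo --> 0.
  by rewrite -(subrr s); apply: cvgB => //; exact: cvg_cst.
have v0 n : 0 < u n - s by rewrite subr_gt0.
have := bpcvg_operator (semigroup_bp (ltW s20)) (semigroup_bounded (ltW s20))
  (semigroup_bpcvg0 cg v0 vc).
have Ts n : T (s / 2) (T (u n - s) (T (s / 2) f)) = T (u n) f.
  have v1 : 0 <= s / 2 + (u n - s) by rewrite addr_ge0 ?ltW.
  rewrite semigroupD ?(ltW s20) ?(ltW (v0 n))// semigroupD ?(ltW s20)//.
  by rewrite (_ : s / 2 + (u n - s) + s / 2 = u n)//; lra.
rewrite (_ : (fun n => T (s / 2) (T (u n - s) _)) = fun n => T (u n) f); last exact/funext.
by rewrite semigroupD ?ltW// -splitr.
Qed.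

(** A family of the form [U (r + t) = U r \o T t] inherits right continuity in
    [t] from [T]; this covers both [T] and the extension of [B T]. *)
Section evolved_family.
Variables (U : R -> Bb M -> Bb M) (f : Bb M).
Hypothesis bU : forall r, 0 < r -> bp_operator (U r).
Hypothesis UT : forall r t, 0 < r -> 0 < t -> U (r + t) f = U r (T t f).

Lemma evolved_family_right_continuous (u : nat -> R) s x : 0 < s ->
  (forall n, s < u n) -> u @ \oo --> s -> ccvg (fun n => U (u n) f x) (U s f x).
Proof.
move=> s0 su us; have s20 : 0 < s / 2 by rewrite divr_gt0.
have v0 n : s / 2 < u n - s / 2 by have := su n; lra.
have vc : (fun n => u n - s / 2) @ \oo --> s / 2.
  rewrite [X in _ --> X](_ : _ = s - s / 2); last by lra.
  by apply: cvgB => //; exact: cvg_cst.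
have := (bU s20 x).2 _ _ (semigroup_bpcvg f s20 v0 vc).
rewrite -UT// -splitr; apply: eq_ccvg => n; rewrite -UT//.
  by congr (U _ f x); lra.
by apply: lt_trans (v0 n).
Qed.

Lemma evolved_family_measurable :
  cmeasurable (fun p : RR * borel M => (if 0 < p.1 then U p.1 f else 0) p.2).
Proof.
apply: (cmeasurable_right_continuous (G := fun s => if 0 < s then U s f else 0)).
  by move=> s; rewrite ltNge => ->.
move=> u s x s0 su us; rewrite s0.
apply: eq_ccvg (evolved_family_right_continuous x s0 su us) => n.
by rewrite (lt_trans s0 (su n)).
Qed.

End evolved_family.

(** Extension by 0 to negative times turns Volterra integrals into integrals
    over the whole line, where translation applies directly. *)
Definition extend0 (U : R -> Bb M -> Bb M) t : Bb M -> Bb M :=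
  fun f => if 0 <= t then U t f else 0.

Lemma semigroup_measurable f :
  cmeasurable (fun p : RR * borel M => extend0 T p.1 f p.2).
Proof.
have m1 := @evolved_family_measurable T f _ _.
rewrite (_ : (fun p => _) = fun p : RR * borel M =>
    (if 0 < p.1 then T p.1 f else 0) p.2 + (\1_[set (0 : RR)] p.1 : R)%:C%C * f p.2).
  apply: cmeasurableD.
    apply: m1 => [r r0|r h r0 h0]; first exact/semigroup_bp/ltW.
    by rewrite (sfsD T_sfs) ?ltW.
  apply: cmeasurableM; last exact: cmeasurable_Bb2.
  exact: (cmeasurable_comp (cmeasurable_indic (measurable_set1 _)) measurable_fst).
apply/funext => -[t x] /=; rewrite /extend0 indicE le_eqVlt eq_sym.
have [->|t0] /= := eqVneq t 0.
  by rewrite ltxx Bb0 add0r mem_set// mul1r (sfs0 T_sfs).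
by rewrite memNset ?mul0r ?addr0//= => E; rewrite E eqxx in t0.
Qed.

End strong_feller_semigroups.

(** * Continuous functions determine measures *)

Section continuous_functions.
Context {R : realType} {M : completeMetricType R}.
Implicit Types (f g h : Bb M) (x y : M).

Lemma continuous_CabsP (F : M -> R[i]) : continuous (F : M -> Cplx R) <->
  forall x (e : R), 0 < e ->
    exists2 d : R, 0 < d & forall y, mdist x y < d -> Cabs (F x - F y) < e.
Proof.
split=> [cF x e e0|H x].
  have e0' : 0 < e%:C%C by rewrite ltcR.
  have /nbhs_ballP[d /= d0 dP] : \forall y \near x, ball (F x : Cplx R) e%:C%C (F y).
    by apply: (cvg_ballP _ _).1 e0'; exact: cF.
  exists d => // y xy.
  have : ball x d y by rewrite ballEmdist.
  by move=> /dP; rewrite /ball/= CnormE ltcR.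
apply/cvg_ballP => -[e1 e2]; rewrite ltcE/= => /andP[/eqP -> e0].
have [d d0 dP] := H x _ e0; apply/nbhs_ballP; exists d => //= y.
by rewrite ballEmdist => /dP xy; rewrite /ball/= CnormE ltcR.
Qed.

Lemma sequentially_continuous (F : M -> R[i]) :
  (forall x (u : nat -> M), (forall n, mdist x (u n) < n.+1%:R^-1) ->
    ccvg (F \o u) (F x)) ->
  continuous (F : M -> Cplx R).
Proof.
move=> H; apply/continuous_CabsP => x e e0; apply: contrapT => nd.
have bad n : exists y, mdist x y < n.+1%:R^-1 /\ e <= Cabs (F x - F y).
  apply: contrapT => ny; apply: nd; exists n.+1%:R^-1; rewrite ?invr_gt0// => y xy.
  by rewrite ltNge; apply/negP => ey; apply: ny; exists y.
have [u uP] := choice bad.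
have /ccvgP /(_ e e0)[N /(_ _ (leqnn _))] := H x u (fun n => (uP n).1).
by rewrite /= CabsB ltNge (uP N).2.
Qed.

Lemma continuous_cst (c : R[i]) : continuous ((fun=> c) : M -> Cplx R).
Proof. by move=> x; exact: cvg_cst. Qed.

Section distance_to_set.
Variables (A : set M) (a0 : M).
Hypothesis Aa0 : A a0.

Let dist x : R := inf [set mdist x a | a in A].

Let dist_has_inf x : has_inf [set mdist x a | a in A].
Proof.
split; first by exists (mdist x a0); exists a0.
by exists 0 => _ [a _ <-]; exact: mdist_ge0.
Qed.

Let dist_ge0 x : 0 <= dist x.
Proof.
apply: lb_le_inf; first by have [] := dist_has_inf x.
by move=> _ [a _ <-]; exact: mdist_ge0.
Qed.

Let dist_lipschitz x y : dist x <= mdist x y + dist y.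
Proof.
rewrite -lerBlDl; apply: lb_le_inf; first by have [] := dist_has_inf y.
move=> _ [a Aa <-]; rewrite lerBlDl; apply: le_trans (metric_triangle x y a).
by apply: ge_inf; [have [] := dist_has_inf x|exists a].
Qed.

Let dist0 x : A x -> dist x = 0.
Proof.
move=> Ax; apply/le_anti; rewrite dist_ge0 andbT -(mdistxx x).
by apply: ge_inf; [have [] := dist_has_inf x|exists x].
Qed.

Let dist_gt0 x : open (~` A) -> ~ A x -> 0 < dist x.
Proof.
move=> oA nAx; have /nbhs_ballP[d /= d0 dP] := open_nbhs_nbhs (conj oA nAx).
apply: lt_le_trans d0 _; apply: lb_le_inf; first by have [] := dist_has_inf x.
move=> _ [a Aa <-]; rewrite leNgt; apply/negP => xa.
have xda : ball x d a by rewrite ballEmdist.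
exact: dP xda Aa.
Qed.

(** The approximants are [min 1 (n * dist(x, A))]. *)
Lemma open_indic_limit : open (~` A) -> exists f_ : nat -> Bb M,
  (forall n, continuous (f_ n : M -> Cplx R)) /\ bpcvg f_ (indicb (~` A)).
Proof.
move=> oA; pose F n x := Num.min 1 (n%:R * dist x).
have F0 n x : 0 <= F n x by rewrite le_min ler01 mulr_ge0.
have F1 n x : F n x <= 1 by rewrite ge_min lexx.
have cF n : continuous ((fun x => (F n x)%:C%C) : M -> Cplx R).
  apply/continuous_CabsP => x e e0; exists (e / n.+1%:R); first by rewrite divr_gt0.
  move=> y; rewrite ltr_pdivlMr// => xy.
  have -> : (F n x)%:C%C - (F n y)%:C%C = (F n x - F n y)%:C%C by rewrite rmorphB.
  rewrite Cabs_real.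
  apply: le_lt_trans xy; have xy := dist_lipschitz x y.
  have yx := dist_lipschitz y x; rewrite metric_sym in yx.
  have n0 : 0 <= n%:R :> R by [].
  have H1 : n%:R * dist x <= n%:R * mdist x y + n%:R * dist y.
    by rewrite -mulrDr ler_wpM2l.
  have H2 : n%:R * dist y <= n%:R * mdist x y + n%:R * dist x.
    by rewrite -mulrDr ler_wpM2l.
  have := mdist_ge0 x y; have : 0 <= n%:R * mdist x y.
    by rewrite mulr_ge0// mdist_ge0.
  rewrite -natr1 mulrDr mulr1 [_ * n%:R]mulrC.
  rewrite ler_norml /F /Num.min.
  by case: ifP; case: ifP; lra.
have mF n : cmeasurable ((fun x => (F n x)%:C%C) : borel M -> R[i]).
  have mc : measurable_fun setT ((fun x => (F n x)%:C%C) : borel M -> borel (Cplx R)).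
    apply: (measurability _ (erefl : (@measurable _ (borel (Cplx R))) = _)).
    move=> _ [U oU <-]; rewrite setTI; apply: sub_sigma_algebra.
    by move/continuousP : (cF n); exact.
  exact: ((measurable_complexP _ measurableT).1 mc).
have FE n x : to_Bb (fun x => (F n x)%:C%C) x = (F n x)%:C%C.
  by apply: to_BbE => //; exists 1 => y; rewrite Cabs_real ger0_norm.
exists (fun n => to_Bb (fun x => (F n x)%:C%C)); split.
  by move=> n; rewrite (_ : Bb_fun _ = fun x => (F n x)%:C%C)//; exact/funext.
have mA : measurable (~` A : set (borel M)) by exact: sub_sigma_algebra.
split; first by exists 1 => n x; rewrite FE Cabs_real ger0_norm.
move=> x; rewrite indicbE// indicE; apply/ccvgP => e e0.
have [Ax|nAx] := pselect (A x).
  exists 0%N => n _; rewrite FE memNset// /F dist0// mulr0 min_r//.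
  by rewrite subrr Cabs0.
have dx := dist_gt0 oA nAx.
exists (Num.truncn (dist x)^-1).+1 => n Nn; rewrite FE mem_set// /F min_l.
  by rewrite subrr Cabs0.
rewrite -ler_pdivrMr// mul1r ltW// (lt_le_trans (truncnS_gt _))//.
by rewrite ler_nat.
Qed.

End distance_to_set.

(** Continuous functions determine a measure: indicators of open sets are
    bounded pointwise limits of them. *)
Lemma eq_bp_functional_continuous (l l' : Bb M -> R[i]) :
  bp_functional l -> bp_functional l' ->
  (forall f, continuous (f : M -> Cplx R) -> l f = l' f) -> l =1 l'.
Proof.
move=> bl bl' ll'.
have lT : l (indicb setT) = l' (indicb setT).
  apply: ll'; rewrite (_ : Bb_fun _ = fun=> 1); first exact: continuous_cst.
  by apply/funext => x; rewrite indicbE// indicT.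
apply: (eq_bp_functional_on (G := open)) => //; first exact: openI.
move=> U oU; have [->//|/setTPn[a0 na0]] := eqVneq U setT.
have oU' : open (~` ~` U) by rewrite setCK.
have [f_ [cf ff]] := @open_indic_limit (~` U) a0 na0 oU'.
rewrite setCK in ff; apply: ccvg_unique (bl.2 _ _ ff) _.
by apply: eq_ccvg (bl'.2 _ _ ff) => n; rewrite ll'.
Qed.

End continuous_functions.

(** * Laplace transform and resolvent *)

Section decay.
Context {R : realType}.
Local Notation lebesgue := (@lebesgue_measure R).
Local Notation RR := (measurableTypeR R).
Implicit Types (lam : R[i]) (r s t : R).

Definition cdecay lam : RR -> R[i] :=
  fun t => (\1_(`[0, +oo[ : set RR) t : R)%:C%C * cexp (- (lam * t%:C%C)).

Lemma Cabs_cdecay lam t : Cabs (cdecay lam t) = half_exp (Cre lam) t.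
Proof.
rewrite CabsM Cabs_real Cabs_cexp ger0_norm ?indicE// -[in RHS]indic_expE indicE.
by congr (_ * expR _); case: lam => a b /=; ring.
Qed.

Lemma cdecay_lt0 lam t : t < 0 -> cdecay lam t = 0.
Proof.
move=> t0; apply: Cabs_eq0; rewrite Cabs_cdecay /half_exp.
by rewrite [0 <= t]leNgt t0.
Qed.

Lemma cdecay_real r t : cdecay r%:C%C t = (half_exp r t)%:C%C.
Proof.
rewrite /cdecay -indic_expE rmorphM/=; congr (_ * _).
rewrite -rmorphM/= -rmorphN/= cexp_real.
by [].
Qed.

Lemma cdecayD lam s t : 0 <= s -> 0 <= t ->
  cdecay lam (s + t) = cdecay lam s * cdecay lam t.
Proof.
move=> s0 t0; rewrite /cdecay !indicE !mem_set/= ?in_itv/= ?andbT ?addr_ge0//.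
rewrite !mul1r -cexpD; congr cexp.
by rewrite rmorphD/=; ring.
Qed.

Lemma cmeasurable_cdecay lam : cmeasurable (cdecay lam).
Proof.
apply: cmeasurableM; first exact: cmeasurable_indic.
case: lam => a b; have mc (f : R -> R) (c : R) : continuous f ->
    measurable_fun setT (fun t : RR => f (c * t)).
  move=> cf; apply: (@measurableT_comp _ _ _ _ _ _ f).
    exact: continuous_measurable_fun.
  exact: measurable_funM.
split.
  rewrite (_ : _ \o _ = fun t : RR => expR ((- a) * t) * cos ((- b) * t)).
    apply: measurable_funM; apply: mc; first exact: continuous_expR.
    exact: continuous_cos.
  by apply/funext => t; rewrite /cexp/=; congr (expR _ * cos _); ring.
rewrite (_ : _ \o _ = fun t : RR => expR ((- a) * t) * sin ((- b) * t)).
  apply: measurable_funM; apply: mc; first exact: continuous_expR.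
  exact: continuous_sin.
by apply/funext => t; rewrite /cexp/=; congr (expR _ * sin _); ring.
Qed.

Lemma half_expM r s t : half_exp r t * expR (s * t) = half_exp (r - s) t.
Proof.
rewrite /half_exp; case: ifP => _; last by rewrite mul0r.
by rewrite -expRD; congr expR; ring.
Qed.

End decay.

Section resolvents.
Context {R : realType} {M : completeMetricType R}.
Variables (T : R -> Bb M -> Bb M) (C w : R) (Rs : R[i] -> Bb M -> Bb M).
Variable (L : set (Bb M * Bb M)).
Hypotheses (T_sfs : strong_feller_semigroup T) (T_type : of_type T C w).
Hypotheses (T_laplace : laplace_transform T w Rs) (L_res : has_resolvent L w Rs).
Implicit Types (f g h : Bb M) (x : M) (s t r : R) (lam mu : R[i]).
Local Notation lebesgue := (@lebesgue_measure R).
Local Notation RR := (measurableTypeR R).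

Lemma dominated_laplace lam f b : w < Cre lam -> (forall x, Cabs (f x) <= b) ->
  dominated_family (fun t => cdecay lam t *: extend0 T t f)
    (fun t => `|C| * b * half_exp (Cre lam - w) t).
Proof.
move=> wl fb; split.
- apply: cmeasurableM; last exact: semigroup_measurable T_sfs T_type f.
  exact: (cmeasurable_comp (cmeasurable_cdecay lam) measurable_fst).
- apply: integrable_EFinZ; apply: integrable_half_exp.
  by rewrite subr_gt0.
- move=> t x; rewrite BbZ CabsM Cabs_cdecay -half_expM /half_exp /extend0.
  case: ifPn => t0; last by rewrite !mul0r mulr0.
  rewrite mulrCA ler_wpM2l ?expR_ge0//.
  apply: le_trans (semigroup_bounded T_sfs T_type t0 fb x) _.
  rewrite -!mulrA [b * _]mulrC !mulrA ler_wpM2r//.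
    exact: le_trans (Cabs_ge0 _) (fb x).
  by rewrite ler_wpM2r ?expR_ge0// ler_norm.
Qed.

Lemma resolvent_bp lam : w < Cre lam -> bp_operator (Rs lam).
Proof. by move=> /T_laplace[/sigma_operator_bp]. Qed.

Lemma resolvent_mint lam f : w < Cre lam ->
  Rs lam f = mint (fun t => cdecay lam t *: extend0 T t f).
Proof.
move=> wl; have [b b0 fb] := Bb_bounded f.
apply: Bb_ext => x; rewrite (mintE _ (dominated_laplace wl fb)).
have [mu muE] := bp_functional_represent (@bp_functional_eval R M x).
have [_ /(_ f mu)[_]] := T_laplace wl; rewrite muE => ->.
rewrite cintegral_mkcond; apply: eq_cintegral => t _.
rewrite BbZ /cdecay -mulrA indicE muE /extend0.
have [t0|t0] := leP 0 t; first by rewrite mulrA.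
by rewrite memNset ?mul0r//= in_itv/= andbT leNgt t0.
Qed.

Lemma resolvent_bounded lam : w < Cre lam ->
  bounded_operator (Rs lam) (2 * (`|C| / (Cre lam - w))).
Proof.
move=> wl f b fb x; rewrite (resolvent_mint f wl).
have wl0 : 0 < Cre lam - w by rewrite subr_gt0.
apply: le_trans (Cabs_mint x (dominated_laplace wl fb)) _.
rewrite RintegralZl//; last exact: integrable_half_exp.
by rewrite Rintegral_half_exp// le_eqVlt; apply/orP; left; apply/eqP; ring.
Qed.

Lemma generator_resolvent lam f g : w < Cre lam ->
  L (f, g) <-> f = Rs lam (lam *: f - g).
Proof.
move=> wl; have /seteqP[LG GL] := L_res wl; split => [Lfg|fE].
  have : graph (Rs lam) (lam *: f - g, f).
    by apply: LG; exists (f, lam *: f - g) => //; exists (f, g).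
  by case=> h _ [-> ->].
have : graph (Rs lam) (lam *: f - g, f).
  by exists (lam *: f - g) => //; rewrite -fE.
move=> /GL[_ [[f' g'] Lfg' <-]] /= E.
have E1 := congr1 fst E; have E2 := congr1 snd E; rewrite /= in E1 E2.
by rewrite E2 in E1 Lfg'; rewrite -(@oppr_inj (Bb M) _ _ (@addrI (Bb M) _ _ _ E1)).
Qed.

Lemma dom_resolvent lam f : w < Cre lam -> dom L f <-> exists h, f = Rs lam h.
Proof.
move=> wl; split => [[g /(generator_resolvent _ _ wl) fE]|[h ->]].
  by exists (lam *: f - g).
exists (lam *: Rs lam h - h); apply/(generator_resolvent _ _ wl).
by rewrite opprB addrC subrK.
Qed.

Lemma resolvent_identity lam mu f : w < Cre lam -> w < Cre mu ->
  Rs mu f = Rs lam (f + (lam - mu) *: Rs mu f).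
Proof.
move=> wl wm; have : L (Rs mu f, mu *: Rs mu f - f).
  by apply/(generator_resolvent _ _ wm); rewrite opprB addrC subrK.
move=> /(generator_resolvent _ _ wl) {1}->; congr (Rs lam _).
by rewrite scalerBl opprB addrCA addrC.
Qed.

(** [T s] passes under the Laplace integral. *)
Lemma semigroup_resolvent lam s f : w < Cre lam -> 0 <= s ->
  T s (Rs lam f) = Rs lam (T s f).
Proof.
move=> wl s0; have [b b0 fb] := Bb_bounded f; have [b' _ fb'] := Bb_bounded (T s f).
apply: Bb_ext => x; rewrite !resolvent_mint//.
rewrite (mintE x (dominated_laplace wl fb')).
have [_ ->] := bp_functional_mint (semigroup_bp T_sfs s0 x) (dominated_laplace wl fb).
apply: eq_cintegral => t _; rewrite bp_operatorZ ?BbZ; last exact: semigroup_bp.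
rewrite /extend0; case: ifPn => t0.
  by rewrite !(semigroupD T_sfs)// addrC.
by rewrite bp_operator0//; exact: semigroup_bp.
Qed.

Lemma resolvent_comm lam mu f : w < Cre lam -> w < Cre mu ->
  Rs mu (Rs lam f) = Rs lam (Rs mu f).
Proof.
move=> wl wm; have [b b0 fb] := Bb_bounded f; have [b' _ fb'] := Bb_bounded (Rs mu f).
apply: Bb_ext => x; rewrite !(resolvent_mint _ wl).
rewrite (mintE x (dominated_laplace wl fb')).
have [_ ->] := bp_functional_mint (resolvent_bp wm x)
  (dominated_laplace wl fb).
apply: eq_cintegral => t _; rewrite bp_operatorZ ?BbZ; last exact: (resolvent_bp wm).
rewrite /extend0; case: ifPn => t0.
  by rewrite semigroup_resolvent.
by rewrite bp_operator0//; exact: (resolvent_bp wm).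
Qed.

(** [r Rs(r) f -> f] as [r -> oo]: on [`[0, d]] the integrand is close to [f x],
    and beyond [d] the exponential wins. *)
Lemma resolvent_near f x (r d e K : R) : 0 < r -> `|w| + 1 < r -> 0 <= e -> 0 < d ->
  0 <= K -> (forall t, 0 <= t -> Cabs (T t f x - f x) <= K * expR (`|w| * t)) ->
  (forall t, 0 < t -> t < d -> Cabs (T t f x - f x) <= e) ->
  Cabs (r%:C%C * Rs r%:C%C f x - f x) <=
    2 * (e + r * K * expR (- (r - `|w| - 1) * d)).
Proof.
move=> r0 wr e0 d0 K0 TK Te.
have wr' : w < Cre r%:C%C.
  by rewrite /= (le_lt_trans (ler_norm w))// (lt_trans _ wr)// ltrDl.
have [b b0 fb] := Bb_bounded f.
have dL := dominated_laplace wr' fb.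
pose F t := r%:C%C * (cdecay r%:C%C t * extend0 T t f x) - (r * half_exp r t)%:C%C * f x.
have iL := cintegrable_dominated x dL.
have iE : cintegrable lebesgue setT (fun t : RR => (r * half_exp r t)%:C%C * f x).
  have ib := integrable_EFinZ (r * b) (integrable_half_exp r0).
  apply: cintegrable_dom _ ib _.
  - apply: cmeasurableM; last exact: cmeasurable_cst.
    apply: cmeasurable_real; apply: measurable_funM => //.
    exact: measurable_half_exp.
  - move=> t; rewrite CabsM Cabs_real ger0_norm ?mulr_ge0 ?half_exp_ge0 ?(ltW r0)//.
    by rewrite -!mulrA [b * _]mulrC ler_wpM2l ?(ltW r0)// ler_wpM2l// half_exp_ge0.
have FE : r%:C%C * Rs r%:C%C f x - f x = cintegral lebesgue setT F.
  rewrite /F cintegralB//; last exact: cintegrableZ.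
  rewrite cintegralZ// -(mintE x dL) -resolvent_mint//; congr (_ - _).
  under eq_cintegral do rewrite mulrC.
  rewrite cintegralZ.
    transitivity (f x * (\int[lebesgue]_t (r * half_exp r t))%:C%C).
      rewrite RintegralZl ?integrable_half_exp// Rintegral_half_exp//.
      by rewrite divff ?gt_eqF// mulr1.
    congr (_ * _); apply: complexP => //=.
    by rewrite /Rintegral integral0.
  split => /=.
    exact: integrable_EFinZ (integrable_half_exp r0).
  exact: integrable0.
rewrite FE.
pose k t := e * r * half_exp r t + r * K * expR (- (r - `|w| - 1) * d) * half_exp 1 t.
have ik : lebesgue.-integrable setT (EFin \o (k : RR -> R)).
  by apply: integrable_EFinD; apply: integrable_EFinZ; exact: integrable_half_exp.
have mF : cmeasurable (F : RR -> R[i]).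
  apply: cmeasurableB.
    apply: cmeasurableZ; exact: (dominated_family_section x dL).
  apply: cmeasurableM; last exact: cmeasurable_cst.
  apply: cmeasurable_real; apply: measurable_funM => //.
  exact: measurable_half_exp.
have Fk t : Cabs (F t) <= k t.
  rewrite /F /k cdecay_real.
  have [t0|t0] := ltP t 0.
    by rewrite /half_exp [0 <= t]leNgt t0/= !mulr0 !mul0r mulr0 subrr Cabs0 addr0.
  rewrite /extend0 t0 mulrA -rmorphM/= -mulrBr CabsM Cabs_real.
  rewrite ger0_norm ?mulr_ge0 ?half_exp_ge0 ?(ltW r0)//.
  have p1 : 0 <= e * r * half_exp r t by rewrite !mulr_ge0 ?half_exp_ge0 ?(ltW r0).
  have p2 : 0 <= r * K * expR (- (r - `|w| - 1) * d) * half_exp 1 t.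
    by rewrite !mulr_ge0 ?half_exp_ge0 ?expR_ge0 ?(ltW r0).
  have [td|td] := ltP t d.
    apply: le_trans (_ : e * r * half_exp r t <= _); last by rewrite lerDl.
    rewrite [leRHS](_ : _ = r * half_exp r t * e); last by ring.
    rewrite ler_wpM2l ?mulr_ge0 ?half_exp_ge0 ?(ltW r0)//.
    move: t0; rewrite le_eqVlt => /predU1P[<-|t0]; last exact: Te.
    by rewrite (sfs0 T_sfs) subrr Cabs0.
  apply: le_trans (_ : r * K * expR (- (r - `|w| - 1) * d) * half_exp 1 t <= _).
    apply: le_trans (ler_wpM2l _ (TK t t0)) _.
      by rewrite mulr_ge0 ?half_exp_ge0 ?(ltW r0).
    rewrite /half_exp t0 -!mulrA ler_wpM2l ?(ltW r0)// mulrCA ler_wpM2l//.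
    rewrite -!expRD ler_expR; have : (r - `|w| - 1) * d <= (r - `|w| - 1) * t.
      by rewrite ler_wpM2l//; lra.
    by lra.
  by rewrite lerDr.
apply: le_trans (Cabs_cintegral mF ik Fk) _.
rewrite ler_wpM2l// RintegralD//.
- rewrite !RintegralZl ?integrable_half_exp// !Rintegral_half_exp// invr1 mulr1.
  by rewrite -mulrA divff ?gt_eqF// mulr1.
- by apply: integrable_EFinZ; exact: integrable_half_exp.
- by apply: integrable_EFinZ; exact: integrable_half_exp.
Qed.

End resolvents.

(** * Functionals vanishing on the domain; operators given by integrals *)

Section domain_density.
Context {R : realType} {M : completeMetricType R}.
Variables (T : R -> Bb M -> Bb M) (C w : R) (Rs : R[i] -> Bb M -> Bb M).
Variable (L : set (Bb M * Bb M)).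
Hypotheses (T_sfs : strong_feller_semigroup T) (T_type : of_type T C w).
Hypotheses (T_laplace : laplace_transform T w Rs) (L_res : has_resolvent L w Rs).
Implicit Types (f g h : Bb M) (x : M).

Lemma resolvent_approximation f : continuous (f : M -> Cplx R) ->
  exists r : nat -> R, (forall n, w < r n) /\
    bpcvg (fun n => (r n)%:C%C *: Rs (r n)%:C%C f) f.
Proof.
move=> cf; pose r n : R := n.+1%:R + `|w| + 1; exists r.
have r0 n : 0 < r n by rewrite ltr_wpDl// addr_ge0.
have wr n : `|w| < n.+1%:R + `|w| by rewrite ltrDr.
have wr1 n : `|w| + 1 < r n by rewrite /r ltrD2r.
have wrn n : w < r n.
  by rewrite (le_lt_trans (ler_norm w))// (lt_trans _ (wr1 n))// ltrDl.
split => //; have [b b0 fb] := Bb_bounded f; split.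
  exists (2 * `|C| * (1 + `|w|) * b) => n x; rewrite BbZ CabsM Cabs_real gtr0_norm//.
  apply: le_trans (ler_wpM2l (ltW (r0 n)) (resolvent_bounded T_sfs T_type T_laplace (wrn n : w < Cre (r n)%:C%C) fb x)) _.
  have p : 0 < r n - w by rewrite subr_gt0.
  rewrite /= (_ : r n * _ = 2 * `|C| * (r n / (r n - w)) * b); last by ring.
  rewrite ler_wpM2r// ler_wpM2l ?mulr_ge0// ler_pdivrMr//.
  have nw := ler_norm w; have n1 : 1 <= n.+1%:R :> R by rewrite ler1n.
  have w0 : 0 <= `|w| by [].
  have : (1 + `|w|) * (n.+1%:R + 1) <= (1 + `|w|) * (r n - w).
    by rewrite ler_wpM2l ?addr_ge0// /r; lra.
  apply: le_trans; rewrite /r.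
  have : `|w| * 1 <= `|w| * n.+1%:R by rewrite ler_wpM2l.
  by rewrite mulrDl mul1r mulrDr mulr1; lra.
move=> x; apply/ccvgP => e e0.
have e40 : 0 < e / 4 by rewrite divr_gt0.
have [d d0 dP] := semigroup_near0 T_sfs x cf e40.
pose K := (`|C| + 1) * b; have K0 : 0 <= K by rewrite mulr_ge0// addr_ge0.
have TK t : 0 <= t -> Cabs (T t f x - f x) <= K * expR (`|w| * t).
  move=> t0; apply: le_trans (CabsD _ _) _; rewrite CabsN.
  have := semigroup_bounded T_sfs T_type t0 fb x; have := fb x.
  have w1 : 1 <= expR (`|w| * t) by rewrite -expR0 ler_expR mulr_ge0.
  have w2 : C * expR (w * t) <= `|C| * expR (`|w| * t).
    apply: le_trans (ler_wpM2r (expR_ge0 _) (ler_norm _)) _.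
    by rewrite ler_wpM2l// ler_expR ler_wpM2r// ler_norm.
  have w3 := ler_wpM2r b0 w2; have w4 := ler_wpM2r b0 w1; rewrite /K.
  have -> : (`|C| + 1) * b * expR (`|w| * t) =
    `|C| * expR (`|w| * t) * b + expR (`|w| * t) * b by ring.
  by rewrite mul1r in w4; lra.
have c0 : 0 <= (`|w| + 2) * K by rewrite mulr_ge0// addr_ge0.
have [N HN] := exp_decay_beats_linear c0 d0 e40.
exists N => n /HN; rewrite BbZ => ne.
have Te t : 0 < t -> t < d -> Cabs (T t f x - f x) <= e / 4.
  by move=> t0 td; rewrite ltW// dP.
have := resolvent_near T_sfs T_type T_laplace (r0 n) (wr1 n) (ltW e40) d0 K0 TK Te.
move=> /le_lt_trans; apply.
have -> : r n - `|w| - 1 = n.+1%:R by rewrite /r; ring.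
have rn : r n * K <= n.+1%:R * ((`|w| + 2) * K).
  rewrite mulrA ler_wpM2r// /r mulrDr.
  have n1 : 1 <= n.+1%:R :> R by rewrite ler1n.
  have : 1 * `|w| <= n.+1%:R * `|w| by rewrite ler_wpM2r.
  by rewrite mul1r; lra.
have := ler_wpM2r (expR_ge0 (- (n.+1%:R * d))) rn.
by rewrite mulNr; lra.
Qed.

(** On a continuous [f] the functionals are limits of their values at
    [r Rs(r) f], which lies in the domain; continuous functions determine them. *)
Lemma eq_bp_functional_dom (l l' : Bb M -> R[i]) :
  bp_functional l -> bp_functional l' ->
  (forall f, dom L f -> l f = l' f) -> l =1 l'.
Proof.
move=> bl bl' ll'; apply: eq_bp_functional_continuous => // f cf.
have [r [wr rf]] := resolvent_approximation cf.
apply: ccvg_unique (bl.2 _ _ rf) _; apply: eq_ccvg (bl'.2 _ _ rf) => n.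
rewrite !bp_functionalZ// ll'//.
by apply/(dom_resolvent L_res _ (wr n : w < Cre (r n)%:C%C)); exists f.
Qed.

End domain_density.

Section integral_operators.
Context {R : realType} {M : completeMetricType R}.
Implicit Types (f g h : Bb M) (x : M) (W : R -> Bb M -> Bb M) (k : R -> R).
Local Notation lebesgue := (@lebesgue_measure R).
Local Notation RR := (measurableTypeR R).

Definition integrable_family W k : Prop :=
  [/\ forall s, bp_operator (W s),
      forall f, cmeasurable (fun p : RR * borel M => W p.1 f p.2),
      forall s, bounded_operator (W s) (k s) &
      lebesgue.-integrable setT (EFin \o (k : RR -> R))].

Definition integral_operator W : Bb M -> Bb M := fun f => mint (fun s => W s f).

Lemma integrable_family_dominated W k f b : integrable_family W k ->
  (forall x, Cabs (f x) <= b) ->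
  dominated_family (fun s => W s f) (fun s => b * k s).
Proof.
move=> [bW mW Wk ik] fb; split => //; first exact: integrable_EFinZ.
by move=> s x; rewrite mulrC; exact: Wk.
Qed.

Lemma integral_operatorE W k f x : integrable_family W k ->
  integral_operator W f x = cintegral lebesgue setT (fun s : RR => W s f x).
Proof.
move=> iW; have [b b0 fb] := Bb_bounded f.
exact: mintE (integrable_family_dominated iW fb).
Qed.

Lemma integral_operator_bounded W k : integrable_family W k ->
  bounded_operator (integral_operator W) (2 * \int[lebesgue]_s k s).
Proof.
move=> iW f b fb x; apply: le_trans (Cabs_mint x (integrable_family_dominated iW fb)) _.
case: iW => _ _ _ ik; rewrite RintegralZl//.
by rewrite mulrCA [leRHS]mulrC.
Qed.

Lemma integral_operator_bp W k : integrable_family W k ->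
  bp_operator (integral_operator W).
Proof.
move=> iW x; split.
  move=> a f g; rewrite !(integral_operatorE _ _ iW).
  have [bf _ /(integrable_family_dominated iW) df] := Bb_bounded f.
  have [bg _ /(integrable_family_dominated iW) dg] := Bb_bounded g.
  have [bW _ _ _] := iW.
  rewrite -cintegralZ; last exact: cintegrable_dominated df.
  rewrite -cintegralD.
  - by apply: eq_cintegral => s _; rewrite (bW s x).1.
  - by apply: cintegrableZ; exact: cintegrable_dominated df.
  - exact: cintegrable_dominated dg.
move=> f_ f ff; rewrite (integral_operatorE _ _ iW).
apply: (@eq_ccvg _ (fun n => cintegral lebesgue setT (fun s : RR => W s (f_ n) x))).
  by move=> n; rewrite (integral_operatorE _ _ iW).
have [[b fb] _] := ff.
have mF n : cmeasurable (fun s : RR => W s (f_ n) x).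
  exact: dominated_family_section (integrable_family_dominated iW (fb n)).
have FF s : ccvg (fun n => W s (f_ n) x) (W s f x).
  by case: (iW) => bW _ _ _; exact: (bW s x).2.
have ik : lebesgue.-integrable setT (EFin \o (fun s : RR => b * k s)).
  by apply: integrable_EFinZ; case: iW.
have Fk n (s : RR) : Cabs (W s (f_ n) x) <= b * k s.
  by case: (integrable_family_dominated iW (fb n)).
exact: cdominated_convergence mF FF ik Fk.
Qed.

End integral_operators.

(** A family [Bt] to which the iteration applies: its norm is dominated by
    [psi], and the weight [expR (- (l0 * s))] makes the integral of the norm so
    small that right convolution with [Bt] is a contraction. *)
Record miyadera_family {R : realType} {M : completeMetricType R} (l0 : R)
    (Bt : R -> Bb M -> Bb M) (psi : R -> R) : Prop := {
  miyadera_ge0 : forall s, 0 <= psi s ;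
  miyadera_le0 : forall s, s <= 0 -> psi s = 0 ;
  miyadera_integrable : lebesgue_measure.-integrable setT
    (EFin \o (fun s : measurableTypeR R => expR (- (l0 * s)) * psi s)) ;
  miyadera_small :
    \int[lebesgue_measure]_(s in [set: measurableTypeR R])
      (expR (- (l0 * s)) * psi s) <= 4^-1 ;
  miyadera_bp : forall s, bp_operator (Bt s) ;
  miyadera_measurable : forall f : Bb M,
    cmeasurable (fun p : measurableTypeR R * borel M => Bt p.1 f p.2) ;
  miyadera_bounded : forall s, bounded_operator (Bt s) (psi s) }.


(** * The perturbing family and its Laplace transform *)

Section perturbing_family.
Context {R : realType} {M : completeMetricType R}.
Variables (T : R -> Bb M -> Bb M) (C w : R) (Rs : R[i] -> Bb M -> Bb M).
Variable (L : set (Bb M * Bb M)).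
Hypotheses (T_sfs : strong_feller_semigroup T) (T_type : of_type T C w).
Hypotheses (T_laplace : laplace_transform T w Rs) (L_res : has_resolvent L w Rs).
Variable B : Bb M -> Bb M.
Hypothesis BR_sigma : exists2 lam : R[i], w < Cre lam & sigma_operator (B \o Rs lam).
Variable BT : R -> Bb M -> Bb M.
Hypothesis BT_extension : forall t, 0 < t ->
  sigma_operator (BT t) /\ forall f, dom L f -> BT t f = B (T t f).
Variable phi : R -> R.
Hypothesis phi_integrable : forall a, 0 <= a ->
  lebesgue_measure.-integrable `[0, a] (EFin \o phi).
Hypothesis BT_bound : forall s, 0 < s -> (opnorm (BT s) <= (phi s)%:E)%E.
Implicit Types (f g h : Bb M) (x : M) (s t r a : R) (lam mu : R[i]).
Local Notation lebesgue := (@lebesgue_measure R).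
Local Notation RR := (measurableTypeR R).

Lemma BT_bp t : 0 < t -> bp_operator (BT t).
Proof. by move=> /BT_extension[/sigma_operator_bp]. Qed.

Lemma BT_bounded t : 0 < t -> bounded_operator (BT t) (phi t).
Proof.
move=> t0; apply: bounded_operator_opnorm; last exact: BT_bound.
by have [[]] := BT_extension t0.
Qed.

(** Both sides are sigma-continuous in [f] and agree on the domain, where they
    are [B (T (r + t) f)]. *)
Lemma BT_semigroup r t f : 0 < r -> 0 <= t -> BT (r + t) f = BT r (T t f).
Proof.
move=> r0 t0; have rt0 : 0 < r + t by rewrite ltr_wpDr.
have [lam wl _] := BR_sigma.
apply: Bb_ext => x; move: f.
apply: (eq_bp_functional_dom T_sfs T_type T_laplace L_res).
- exact: BT_bp.
- exact: (bp_functional_comp (BT_bp r0 x) (semigroup_bp T_sfs t0)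
    (semigroup_bounded T_sfs T_type t0)).
move=> f df; have [_ ->//] := BT_extension rt0; have [_ BTr] := BT_extension r0.
rewrite BTr ?(semigroupD T_sfs) ?(ltW r0)//.
have /(dom_resolvent L_res _ wl)[h ->] := df.
rewrite (semigroup_resolvent T_sfs T_type T_laplace)//.
by apply/(dom_resolvent L_res _ wl); exists (T t h).
Qed.

Definition extendB s f : Bb M := if 0 < s then BT s f else 0.

(** A global bound of the norm of the perturbing family: [phi] up to time 1,
    and beyond 1 the exponential bound given by [BT s = BT 1 \o T (s - 1)]. *)
Definition psi : RR -> R := fun s =>
  if s <= 0 then 0 else
  if s <= 1 then `|phi s| else `|phi 1| * `|C| * expR (w * (s - 1)).

Lemma psi_ge0 s : 0 <= psi s.
Proof.
by rewrite /psi; case: ifP => // _; case: ifP => // _; rewrite !mulr_ge0 ?expR_ge0.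
Qed.

Lemma psi_le0 s : s <= 0 -> psi s = 0.
Proof. by rewrite /psi => ->. Qed.

Lemma extendB_bp s : bp_operator (extendB s).
Proof.
have [s0|/negbTE s0] := boolP (0 < s).
  rewrite (_ : extendB s = BT s); first exact: BT_bp.
  by apply/funext => f; rewrite /extendB s0.
rewrite (_ : extendB s = fun=> 0); last by apply/funext => f; rewrite /extendB s0.
move=> x; split; first by move=> c f g; rewrite Bb0 mulr0 addr0.
by move=> f_ f _; exact: ccvg_cst.
Qed.

Lemma extendB_bounded s : bounded_operator (extendB s) (psi s).
Proof.
move=> f b fb x; have b0 : 0 <= b := le_trans (Cabs_ge0 _) (fb x).
rewrite /extendB /psi; have [s0|s0] := leP s 0; first by rewrite mul0r Bb0 Cabs0.
case: ifP => [s1|/negbT].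
  by apply: le_trans (BT_bounded s0 fb x) _; rewrite ler_wpM2r// ler_norm.
rewrite -ltNge => s1; have s10 : 0 <= s - 1 by rewrite subr_ge0 ltW.
have {1}-> : s = 1 + (s - 1) by lra.
rewrite BT_semigroup//.
apply: le_trans (BT_bounded ltr01 (semigroup_bounded T_sfs T_type s10 fb) x) _.
have e0 := expR_ge0 (w * (s - 1)).
have H1 : C * expR (w * (s - 1)) * b <= `|C| * expR (w * (s - 1)) * b.
  by rewrite ler_wpM2r// ler_wpM2r// ler_norm.
have H0 : 0 <= C * expR (w * (s - 1)) * b.
  exact: le_trans (Cabs_ge0 _) (semigroup_bounded T_sfs T_type s10 fb x).
apply: le_trans (ler_wpM2r H0 (ler_norm _)) _.
by rewrite -!mulrA ler_wpM2l// !mulrA.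
Qed.

Lemma extendB_measurable f :
  cmeasurable (fun p : RR * borel M => extendB p.1 f p.2).
Proof.
apply: (evolved_family_measurable T_sfs T_type (U := BT)); first exact: BT_bp.
by move=> r t r0 t0; rewrite BT_semigroup// ltW.
Qed.

Definition kappa a : RR -> R := fun s => expR (- (a * s)) * psi s.

Lemma kappa_ge0 a s : 0 <= kappa a s.
Proof. by rewrite mulr_ge0 ?expR_ge0 ?psi_ge0. Qed.

Lemma kappa_le a a' s : a <= a' -> kappa a' s <= kappa a s.
Proof.
move=> aa'; rewrite /kappa; have [s0|s0] := leP s 0; first by rewrite psi_le0// !mulr0.
by rewrite ler_wpM2r ?psi_ge0// ler_expR lerN2 ler_wpM2r// ltW.
Qed.

Lemma integrable_phi01 : lebesgue.-integrable setT
  (EFin \o (fun s : RR => (\1_(`[0, 1] : set RR) s : R) * phi s)).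
Proof.
have mI : measurable (`[0, 1] : set RR) by exact: measurable_itv.
have := (integrable_mkcond (EFin \o (phi : RR -> R)) mI).1 (phi_integrable ler01).
apply: eq_integrable => // s _; rewrite /= indicE patchE.
by case: ifP; rewrite ?mul1r ?mul0r.
Qed.

Lemma measurable_psi : measurable_fun setT psi.
Proof.
have mp : measurable_fun setT (fun s : RR => (\1_(`[0, 1] : set RR) s : R) * phi s).
  apply/measurable_EFinP; exact: (measurable_int lebesgue integrable_phi01).
have m1 : measurable_fun setT (fun s : RR => (\1_(`]0, 1] : set RR) s : R) * `|phi s|).
  rewrite (_ : (fun s => _) = fun s : RR => (\1_(`]0, 1] : set RR) s : R) *
     `|(\1_(`[0, 1] : set RR) s : R) * phi s|).
    apply: measurable_funM; first exact: measurable_indic.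
    exact: measurableT_comp.
  apply/funext => s; rewrite !indicE.
  have [/set_mem/=|_] := boolP (s \in `]0, 1]%classic); last by rewrite !mul0r.
  by rewrite in_itv/= => /andP[s0 s1]; rewrite (mem_set (_ : `[0, 1]%classic s)) ?mul1r//= in_itv/= s1 ltW.
rewrite (_ : psi = fun s : RR => (\1_(`]0, 1] : set RR) s : R) * `|phi s| +
   (\1_(`]1, +oo[ : set RR) s : R) * (`|phi 1| * `|C| * expR (w * (s - 1)))).
  apply: measurable_funD => //; apply: measurable_funM.
    exact: measurable_indic.
  apply: measurable_funM => //; apply: measurableT_comp => //.
  apply: measurable_funM => //; exact: measurable_funB.
apply/funext => s; rewrite /psi !indicE !mem_setE !in_itv/= andbT.
have [s0|s0] := leP s 0; first by rewrite /= ltNge (le_trans s0)//= !mul0r addr0.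
rewrite ltNge; case: (leP s 1) => /= _; first by rewrite mul1r mul0r addr0.
by rewrite mul0r mul1r add0r.
Qed.

Lemma measurable_kappa a : measurable_fun setT (kappa a).
Proof.
apply: measurable_funM; last exact: measurable_psi.
by apply: measurableT_comp => //; apply: measurable_funN; exact: measurable_funM.
Qed.

Lemma integrable_kappa a : `|w| < a -> lebesgue.-integrable setT (EFin \o kappa a).
Proof.
move=> wa; have a0 : 0 < a by exact: le_lt_trans wa.
have wa' : 0 < a - w by rewrite subr_gt0 (le_lt_trans (ler_norm w)).
have i2 := integrable_EFinZ (`|phi 1| * `|C| * expR (- w)) (integrable_half_exp wa').
have i3 := integrable_EFinD (integrable_norm integrable_phi01) i2.
apply: le_integrable i3 => //; first by apply/measurable_EFinP; exact: measurable_kappa.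
move=> s _; rewrite /= lee_fin ger0_norm ?kappa_ge0//; apply: le_trans (ler_norm _).
have p1 : 0 <= `|(\1_(`[0, 1] : set RR) s : R) * phi s| by [].
have p2 : 0 <= `|phi 1| * `|C| * expR (- w) * half_exp (a - w) s.
  by rewrite !mulr_ge0 ?expR_ge0 ?half_exp_ge0.
rewrite /kappa; have [s0|s0] := leP s 0.
  by rewrite psi_le0// mulr0 addr_ge0.
rewrite /psi [s <= 0]leNgt s0/=; case: ifP => s1.
  apply: le_trans (_ : `|phi s| <= _).
    by rewrite ler_piMl// -expR0 ler_expR oppr_le0 mulr_ge0// ltW.
  rewrite indicE mem_set ?mul1r ?lerDl//=.
  by rewrite in_itv/= s1 ltW.
rewrite -[leLHS]add0r lerD// /half_exp (ltW s0).
rewrite mulrCA -!mulrA ler_wpM2l// ler_wpM2l//.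
by rewrite -!expRD ler_expR; lra.
Qed.

(** As [a] grows the weighted norm of the family tends to 0, by dominated
    convergence. *)
Lemma small_kappa : exists2 a, `|w| < a & \int[lebesgue]_s kappa a s <= 4^-1.
Proof.
pose a0 := `|w| + 1; have wa0 : `|w| < a0 by rewrite ltrDl.
have wa n : `|w| < a0 + n%:R by rewrite ltr_wpDr.
have c0 s : ccvg (fun n => (kappa (a0 + n%:R) s)%:C%C) 0.
  apply/ccvgP => e e0; have [s0|s0] := leP s 0.
    by exists 0%N => n _; rewrite /kappa psi_le0// mulr0 subrr Cabs0.
  have [N HN] := exp_decay_beats_linear (psi_ge0 s) s0 e0.
  exists N.+1 => -[//|n] Nn; rewrite subr0 Cabs_real ger0_norm ?kappa_ge0//.
  apply: le_lt_trans (HN n Nn).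
  rewrite /kappa mulrC; apply: le_trans (_ : psi s * expR (- (n.+1%:R * s)) <= _).
    rewrite ler_wpM2l ?psi_ge0// ler_expR lerN2 ler_wpM2r ?(ltW s0)//.
    by rewrite lerDr addr_ge0.
  by rewrite -mulrA ler_peMl ?mulr_ge0 ?psi_ge0 ?expR_ge0// ler1n.
have mk n : cmeasurable (fun s : RR => (kappa (a0 + n%:R) s)%:C%C).
  by apply: cmeasurable_real; exact: measurable_kappa.
have dk n s : Cabs (kappa (a0 + n%:R) s)%:C%C <= kappa a0 s.
  by rewrite Cabs_real ger0_norm ?kappa_ge0// kappa_le// lerDl.
have [+ _] := cdominated_convergence mk c0 (integrable_kappa wa0) dk.
rewrite /= (_ : \int[_]_x 0 = 0); last by rewrite /Rintegral integral0.
move=> /cvgrPdist_lt /(_ 4^-1) []; first by rewrite invr_gt0.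
move=> N _ /(_ N (leqnn N)); rewrite /= sub0r normrN => H.
exists (a0 + N%:R) => //; apply: le_trans (ltW H).
exact: ler_norm.
Qed.

Lemma integrable_family_decay lam : `|w| < Cre lam ->
  integrable_family (fun s f => cdecay lam s *: extendB s f) (kappa (Cre lam)).
Proof.
move=> wl; split.
- move=> s x; apply: eq_bp_functional (bp_functionalM (cdecay lam s) (extendB_bp s x)).
  by move=> f; rewrite BbZ.
- move=> f; apply: cmeasurableM; last exact: extendB_measurable.
  exact: (cmeasurable_comp (cmeasurable_cdecay lam) measurable_fst).
- move=> s f b fb x; rewrite BbZ CabsM Cabs_cdecay /kappa -mulrA.
  apply: le_trans (ler_wpM2l (half_exp_ge0 _ _) (extendB_bounded s fb x)) _.
  rewrite ler_wpM2r//; last first.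
    by rewrite /half_exp; case: ifP => _; rewrite ?mulNr// expR_ge0.
  by rewrite mulr_ge0 ?psi_ge0//; exact: le_trans (Cabs_ge0 _) (fb x).
- exact: integrable_kappa.
Qed.

(** One [lam] suffices, by the resolvent identity. *)
Lemma BR_bp lam : w < Cre lam -> bp_operator (B \o Rs lam).
Proof.
move=> wl; have [mu wm /sigma_operator_bp bBR] := BR_sigma.
have E : B \o Rs lam =
    fun f => (B \o Rs mu) f + (mu - lam) *: (B \o Rs mu) (Rs lam f).
  apply/funext => f; rewrite /= {1}(resolvent_identity L_res f wm wl).
  rewrite -[LHS]/((B \o Rs mu) (f + (mu - lam) *: Rs lam f)).
  by rewrite (bp_operatorD _ _ bBR) (bp_operatorZ _ _ bBR).
move=> x; rewrite E.
have bc := bp_functional_comp (bBR x) (resolvent_bp T_laplace wl)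
  (resolvent_bounded T_sfs T_type T_laplace wl).
apply: eq_bp_functional (bp_functional_lincomb (mu - lam) bc (bBR x)) => f.
by rewrite BbD BbZ addrC.
Qed.

(** [B R(lam)] is the Laplace transform of [BT]. On the domain, where
    [f = R(mu) g], this follows by letting the sigma-continuous [B R(mu)] pass
    under the integral defining [R(lam) g]. *)
Lemma BR_integral lam f : `|w| < Cre lam ->
  B (Rs lam f) = integral_operator (fun s f => cdecay lam s *: extendB s f) f.
Proof.
move=> wl'; have wl : w < Cre lam := le_lt_trans (ler_norm w) wl'.
have iW := integrable_family_decay wl'.
apply: Bb_ext => x; move: f.
apply: (eq_bp_functional_dom T_sfs T_type T_laplace L_res (BR_bp wl x)
  (integral_operator_bp iW x)).
have [mu wm _] := BR_sigma.
move=> f /[dup] df /(dom_resolvent L_res _ wm)[g fE].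
have [b b0 gb] := Bb_bounded g; have [b' _ fb] := Bb_bounded f.
rewrite (integral_operatorE _ _ iW) /= {1}fE (resolvent_comm T_sfs T_type T_laplace)//.
rewrite (resolvent_mint T_sfs T_type T_laplace g wl).
have [i1 ->] := bp_functional_mint (BR_bp wm x)
  (dominated_laplace T_sfs T_type wl gb).
(* at [s = 0] the family [BT] is extended by 0, but [T] by the identity *)
apply: (eq_cintegral_except (a := 0)).
- exact: cintegrable_measurable i1.
- exact: dominated_family_section (integrable_family_dominated iW fb).
move=> s s0 /=; rewrite -[B (Rs mu _)]/((B \o Rs mu) _).
rewrite (bp_operatorZ _ _ (BR_bp wm)) BbZ [RHS]BbZ; have [s1|s1] := ltP s 0.
  by rewrite cdecay_lt0// !mul0r.
rewrite /extendB.
have s2 : 0 < s by rewrite lt_def s0.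
rewrite s2 /extend0 s1; have [_ ->//] := BT_extension s2.
by rewrite fE (semigroup_resolvent T_sfs T_type T_laplace).
Qed.

Lemma extendB_miyadera : exists2 l0, `|w| < l0 & miyadera_family l0 extendB psi.
Proof.
have [l0 wl0 small] := small_kappa; exists l0 => //; split.
- exact: psi_ge0.
- exact: psi_le0.
- exact: integrable_kappa.
- exact: small.
- exact: extendB_bp.
- exact: extendB_measurable.
- exact: extendB_bounded.
Qed.

End perturbing_family.

(** * Convolution and the Dyson-Phillips iteration *)

Section dyson_phillips.
Context {R : realType} {M : completeMetricType R}.
Local Notation lebesgue := (@lebesgue_measure R).
Local Notation RR := (measurableTypeR R).
Implicit Types (f g h : Bb M) (x : M) (s t r a : R) (U : R -> Bb M -> Bb M).
Variables (l0 : R) (Bt : R -> Bb M -> Bb M) (psi : R -> R).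
Hypothesis HB : miyadera_family l0 Bt psi.
Let E t := half_exp (- l0) t.
Let k : RR -> R := fun s => expR (- (l0 * s)) * psi s.
Let psi_ge0 := miyadera_ge0 HB.
Let psi_le0 := miyadera_le0 HB.
Let ik : lebesgue.-integrable setT (EFin \o k) := miyadera_integrable HB.
Let k_small : \int[lebesgue]_s k s <= 4^-1 := miyadera_small HB.
Let Bt_bp := miyadera_bp HB.
Let Bt_measurable := miyadera_measurable HB.
Let Bt_bounded := miyadera_bounded HB.

(** The bound vanishes for negative [t], so such a family is 0 there; see
    [evolution_family_lt0]. *)
Definition evolution_family U (K : R) : Prop :=
  [/\ forall t, bp_operator (U t),
      forall f, cmeasurable (fun p : RR * borel M => U p.1 f p.2) &
      forall t, bounded_operator (U t) (K * half_exp (- l0) t)].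

(** Since both families vanish for negative times, this is an integral over
    [`[0, t]]. *)
Definition convol U t : Bb M -> Bb M :=
  integral_operator (fun s f => U (t - s) (Bt s f)).

Let E_ge0 t : 0 <= E t. Proof. exact: half_exp_ge0. Qed.

Let k_ge0 s : 0 <= k s. Proof. by rewrite mulr_ge0 ?expR_ge0. Qed.

(** The exponential weight is multiplicative, so that it commutes with
    convolution. *)
Lemma half_exp_weight t s : half_exp (- l0) (t - s) * psi s <=
  half_exp (- l0) t * (expR (- (l0 * s)) * psi s).
Proof.
have [s0|s0] := leP s 0; first by rewrite psi_le0// !mulr0.
rewrite /half_exp; have [ts|ts] := leP 0 (t - s); last first.
  by rewrite mul0r mulr_ge0 ?mulr_ge0 ?expR_ge0//; case: ifP => // _; exact: expR_ge0.
rewrite (_ : 0 <= t = true); last by apply/idP; lra.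
rewrite mulrA -expRD le_eqVlt; apply/orP; left; apply/eqP; congr (expR _ * _).
by ring.
Qed.

Lemma evolution_family_apply U K t s f b x : evolution_family U K -> 0 <= K ->
  (forall x, Cabs (f x) <= b) ->
  Cabs (U (t - s) (Bt s f) x) <= K * E t * k s * b.
Proof.
move=> [bU mU UK] K0 fb; have b0 : 0 <= b := le_trans (Cabs_ge0 _) (fb x).
apply: le_trans (UK (t - s) _ _ (Bt_bounded s fb) x) _.
have := ler_wpM2r b0 (ler_wpM2l K0 (half_exp_weight t s)).
by rewrite /E !mulrA.
Qed.

Lemma convol_family U K t : evolution_family U K -> 0 <= K ->
  integrable_family (fun s f => U (t - s) (Bt s f)) (fun s => K * E t * k s).
Proof.
move=> eU K0; have [bU mU UK] := eU; split.
- move=> s; apply: (bp_operator_comp (bU (t - s)) (Bt_bp s)).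
  by exists (psi s).
- move=> f; apply: (cmeasurable_operator_apply (Z := RR) (U := fun s => U (t - s))
      (G := fun s => Bt s f)) => // g.
  apply: (cmeasurable_comp (h := fun p : RR * borel M => (t - p.1, p.2) : RR * borel M) (mU g)).
  apply: measurable_fun_pair; last exact: measurable_snd.
  apply: measurable_funB => //; exact: measurable_fst.
- by move=> s f b fb x; exact: evolution_family_apply.
- exact: integrable_EFinZ.
Qed.

Lemma convolE U K t f x : evolution_family U K -> 0 <= K ->
  convol U t f x = cintegral lebesgue setT (fun s : RR => U (t - s) (Bt s f) x).
Proof. by move=> eU K0; exact: (integral_operatorE _ _ (convol_family t eU K0)). Qed.

Lemma convol_integrand_measurable U K f : evolution_family U K ->
  cmeasurable (fun q : (RR * RR) * borel M => U (q.1.2 - q.1.1) (Bt q.1.1 f) q.2).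
Proof.
move=> [bU mU UK].
apply: (cmeasurable_operator_apply (Z := (RR * RR)%type)
  (U := fun z : RR * RR => U (z.2 - z.1)) (G := fun z => Bt z.1 f)).
- by move=> z.
- move=> g.
  apply: (cmeasurable_comp (h := fun p : (RR * RR) * borel M =>
    (p.1.2 - p.1.1, p.2) : RR * borel M) (mU g)).
  apply: measurable_fun_pair; last exact: measurable_snd.
  by apply: measurable_funB; apply: measurableT_comp => //; exact: measurable_fst.
- apply: (cmeasurable_comp (h := fun p : (RR * RR) * borel M =>
    (p.1.1, p.2) : RR * borel M) (Bt_measurable f)).
  apply: measurable_fun_pair; last exact: measurable_snd.
  by apply: measurableT_comp => //; exact: measurable_fst.
Qed.

Lemma convol_measurable U K f : evolution_family U K -> 0 <= K ->
  cmeasurable (fun p : RR * borel M => convol U p.1 f p.2).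
Proof.
move=> eU K0.
rewrite (_ : (fun p => _) = fun p : RR * borel M =>
    cintegral lebesgue setT (fun s : RR => U (p.1 - s) (Bt s f) p.2)); last first.
  by apply/funext => p; rewrite (convolE _ _ _ eU).
apply: (cmeasurable_cintegral lebesgue
  (F := fun q : RR * (RR * borel M) => U (q.2.1 - q.1) (Bt q.1 f) q.2.2)).
apply: (cmeasurable_comp
  (h := fun q : RR * (RR * borel M) => ((q.1, q.2.1), q.2.2) : (RR * RR) * borel M)
  (convol_integrand_measurable f eU)).
apply: measurable_fun_pair.
  apply: measurable_fun_pair; first exact: measurable_fst.
  by apply: measurableT_comp => //; exact: measurable_snd.
by apply: measurableT_comp => //; exact: measurable_snd.
Qed.

Let half_bound c t b : 0 <= c -> 0 <= b ->
  2 * \int[lebesgue]_s (c * E t * k s) * b <= c / 2 * E t * b.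
Proof.
move=> c0 b0; rewrite RintegralZl//.
have : c * E t * b * \int[lebesgue]_s k s <= c * E t * b * 4^-1.
  by rewrite ler_wpM2l ?mulr_ge0.
by lra.
Qed.

Lemma convol_evolution U K : evolution_family U K -> 0 <= K ->
  evolution_family (convol U) (K / 2).
Proof.
move=> eU K0; split.
- by move=> t; exact: integral_operator_bp (convol_family t eU K0).
- by move=> f; exact: convol_measurable eU K0.
- move=> t f b fb x.
  apply: le_trans (integral_operator_bounded (convol_family t eU K0) fb x) _.
  by apply: half_bound => //; exact: le_trans (Cabs_ge0 _) (fb x).
Qed.

(** The right convolution with the perturbing family halves distances in the
    exponentially weighted norm; existence and uniqueness both rest on this. *)
Lemma convol_contraction U U' K K' (c : R) : evolution_family U K -> 0 <= K ->
  evolution_family U' K' -> 0 <= K' -> 0 <= c ->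
  (forall t, bounded_operator (fun f => U t f - U' t f) (c * E t)) ->
  forall t, bounded_operator (fun f => convol U t f - convol U' t f) (c / 2 * E t).
Proof.
move=> eU K0 eU' K'0 c0 UU' t f b fb x; have b0 := le_trans (Cabs_ge0 _) (fb x).
have dU := integrable_family_dominated (convol_family t eU K0) fb.
have dU' := integrable_family_dominated (convol_family t eU' K'0) fb.
rewrite BbB (convolE _ _ _ eU)// (convolE _ _ _ eU')// -cintegralB; last 2 first.
- exact: cintegrable_dominated dU.
- exact: cintegrable_dominated dU'.
have ic : lebesgue.-integrable setT (EFin \o (fun s : RR => b * (c * E t * k s))).
  by do 2 apply: integrable_EFinZ.
have mF : cmeasurable (fun s : RR => U (t - s) (Bt s f) x - U' (t - s) (Bt s f) x).
  by apply: cmeasurableB; [exact: dominated_family_section dU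
                          |exact: dominated_family_section dU'].
have Fb (s : RR) : Cabs (U (t - s) (Bt s f) x - U' (t - s) (Bt s f) x) <=
    b * (c * E t * k s).
  have := UU' (t - s) _ _ (Bt_bounded s fb) x; rewrite BbB => /le_trans; apply.
  have := ler_wpM2r b0 (ler_wpM2l c0 (half_exp_weight t s)).
  by rewrite /E /k; lra.
apply: le_trans (Cabs_cintegral mF ic Fb) _.
rewrite RintegralZl//; last exact: integrable_EFinZ.
by have := half_bound t c0 b0; lra.
Qed.

Section fixed_point.
Variables (T0 : R -> Bb M -> Bb M) (A : R).
Hypothesis A0 : 0 <= A.
Hypothesis T0_evolution : evolution_family T0 A.

Fixpoint dyson n : R -> Bb M -> Bb M :=
  if n is m.+1 then fun t f => T0 t f + convol (dyson m) t f else T0.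

Lemma evolution_familyD U U' K K' : evolution_family U K -> evolution_family U' K' ->
  evolution_family (fun t f => U t f + U' t f) (K + K').
Proof.
move=> [bU mU UK] [bU' mU' UK']; split.
- move=> t x; apply: eq_bp_functional (bp_functional_lincomb 1 (bU t x) (bU' t x)) => f.
  by rewrite BbD mul1r.
- by move=> f; exact: (cmeasurableD (mU f) (mU' f)).
- move=> t f b fb x; rewrite BbD; apply: le_trans (CabsD _ _) _.
  by rewrite !mulrDl lerD//; [exact: UK|exact: UK'].
Qed.

Lemma evolution_family_le U K K' : K <= K' -> evolution_family U K ->
  evolution_family U K'.
Proof.
move=> KK' [bU mU UK]; split => // t f b fb x; apply: le_trans (UK t f b fb x) _.
by rewrite ler_wpM2r ?ler_wpM2r//; exact: le_trans (Cabs_ge0 _) (fb x).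
Qed.

Lemma dyson_evolution n : evolution_family (dyson n) (2 * A).
Proof.
elim: n => [|n ih]; first by apply: evolution_family_le T0_evolution; have := A0; lra.
have A20 : 0 <= 2 * A by rewrite mulr_ge0.
apply: evolution_family_le (evolution_familyD T0_evolution (convol_evolution ih A20)).
by have := A0; lra.
Qed.

Lemma dyson_step n t :
  bounded_operator (fun f => dyson n.+1 t f - dyson n t f) (A / 2 ^+ n * E t).
Proof.
have A20 : 0 <= 2 * A by rewrite mulr_ge0.
elim: n t => [|n ih] t.
  move=> f b fb x; rewrite /= addrC addKr expr0 divr1.
  have [_ _ /(_ t f b fb x)] := convol_evolution T0_evolution A0; move=> /le_trans; apply.
  rewrite ler_wpM2r ?(le_trans (Cabs_ge0 _) (fb x))// ler_wpM2r//; lra.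
move=> f b fb x.
have := convol_contraction (dyson_evolution n.+1) A20 (dyson_evolution n) A20 _ ih t fb x.
rewrite divr_ge0 ?exprn_ge0// => /(_ isT).
have -> : dyson n.+2 t f - dyson n.+1 t f = convol (dyson n.+1) t f - convol (dyson n) t f.
  by rewrite [dyson n.+2 t f]/= [dyson n.+1 t f in LHS]/= opprD addrACA subrr add0r.
by rewrite exprS invfM (_ : A / 2 ^+ n / 2 = A * (2^-1 / 2 ^+ n)); [exact|ring].
Qed.

Lemma dyson_limit t f : exists g, forall x,
  ccvg (fun n => dyson n t f x) (g x) /\
  forall n b, (forall x, Cabs (f x) <= b) ->
    Cabs (g x - dyson n t f x) <= 2 * A / 2 ^+ n * E t * b.
Proof.
have cauchy b x : (forall x, Cabs (f x) <= b) -> forall n,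
    Cabs (dyson n.+1 t f x - dyson n t f x) <= (A * E t * b) / 2 ^+ n.
  move=> fb n; have := dyson_step n t fb x; rewrite BbB.
  by congr (_ <= _); ring.
have [b0 b00 fb0] := Bb_bounded f.
have ex x : exists l, ccvg (fun n => dyson n t f x) l /\
    forall n b, (forall x, Cabs (f x) <= b) ->
    Cabs (l - dyson n t f x) <= 2 * A / 2 ^+ n * E t * b.
  have [l cl _] := ccvg_geometric (cauchy b0 x fb0).
  exists l; split => // n b fb.
  have [l' cl' l'b] := ccvg_geometric (cauchy b x fb).
  rewrite (ccvg_unique cl cl'); apply: le_trans (l'b n) _.
  by rewrite le_eqVlt; apply/orP; left; apply/eqP; ring.
have [g gP] := choice ex; exists (to_Bb g) => x.
rewrite to_BbE; first exact: gP.
- apply: (cmeasurable_lim (F_ := fun n => (dyson n t f : borel M -> R[i]))).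
    by move=> n; exact: cmeasurable_Bb.
  by move=> y; have [] := gP y.
- exists (2 * A * E t * b0) => y; have [cy _] := gP y.
  apply: ccvg_Cabs_le cy _ => n; have [_ _ dn] := dyson_evolution n.
  exact: dn.
Qed.

Definition perturbed t f : Bb M := sval (cid (dyson_limit t f)).

Lemma perturbed_ccvg t f x : ccvg (fun n => dyson n t f x) (perturbed t f x).
Proof. by have [] := svalP (cid (dyson_limit t f)) x. Qed.

Lemma perturbed_dist n t :
  bounded_operator (fun f => perturbed t f - dyson n t f) (2 * A / 2 ^+ n * E t).
Proof.
move=> f b fb x; rewrite BbB.
by have [_ /(_ n b fb)] := svalP (cid (dyson_limit t f)) x.
Qed.

(** Continuity in [f] survives the limit because the convergence is uniform on
    bounded sets of functions. *)
Lemma perturbed_evolution : evolution_family perturbed (2 * A).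
Proof.
split.
- move=> t x; split.
    move=> a f g; apply: ccvg_unique (perturbed_ccvg _ _ _) _.
    have := ccvgD (ccvgZ a (perturbed_ccvg t f x)) (perturbed_ccvg t g x).
    apply: eq_ccvg => n; have [bD _ _] := dyson_evolution n.
    by rewrite (bD t x).1.
  move=> f_ f /[dup] ff [[b fb] fx]; apply/ccvgP => e e0.
  have fb' y : Cabs (f y) <= b by apply: ccvg_Cabs_le (fx y) _.
  pose c := 2 * A * E t * b.
  have e40 : 0 < e / 4 by rewrite divr_gt0.
  have /cvgrPdist_lt /(_ _ e40) [N _ /(_ N (leqnn N))] := cvg_geom2 c.
  rewrite /= sub0r normrN => Nc.
  have dN g : (forall y, Cabs (g y) <= b) -> Cabs (perturbed t g x - dyson N t g x) < e / 4.
    move=> gb; have := perturbed_dist N t gb x; rewrite BbB => /le_lt_trans; apply.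
    apply: le_lt_trans Nc; apply: le_trans (ler_norm _).
    by rewrite le_eqVlt; apply/orP; left; apply/eqP; rewrite /c; ring.
  have [bD _ _] := dyson_evolution N.
  have /ccvgP /(_ _ e40)[n0 Hn0] := (bD t x).2 _ _ ff.
  exists n0 => n /Hn0 Hn.
  rewrite (_ : _ - _ = (perturbed t (f_ n) x - dyson N t (f_ n) x) +
    ((dyson N t (f_ n) x - dyson N t f x) -
     (perturbed t f x - dyson N t f x))); last by ring.
  apply: le_lt_trans (CabsD _ _) _; have := dN _ (fb n); have := dN _ fb'.
  have := CabsD (dyson N t (f_ n) x - dyson N t f x) (- (perturbed t f x - dyson N t f x)).
  by rewrite CabsN; lra.
- move=> f; apply: (cmeasurable_lim (F_ := fun n (p : RR * borel M) => dyson n p.1 f p.2)).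
    by move=> n; have [_ + _] := dyson_evolution n; exact.
  by move=> p; exact: perturbed_ccvg.
- move=> t f b fb x; apply: ccvg_Cabs_le (perturbed_ccvg t f x) _ => n.
  by have [_ _] := dyson_evolution n; apply.
Qed.

(** The Duhamel equation: pass to the limit in the iteration. *)
Lemma perturbed_eq t f : perturbed t f = T0 t f + convol perturbed t f.
Proof.
have A20 : 0 <= 2 * A by rewrite mulr_ge0.
have [b b0 fb] := Bb_bounded f.
apply: Bb_ext => x; apply: ccvg_unique (ccvg_shift (perturbed_ccvg t f x)) _.
apply: (@ccvg_dist _ _ _ (fun n => A * E t * b / 2 ^+ n)); last exact: cvg_geom2.
move=> n; have cn : 0 <= 2 * A / 2 ^+ n by rewrite divr_ge0// exprn_ge0.
have := convol_contraction perturbed_evolution A20 (dyson_evolution n) A20 cn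
  (perturbed_dist n) t fb x.
have -> : dyson n.+1 t f x - (T0 t f + convol perturbed t f) x =
    - (convol perturbed t f - convol (dyson n) t f) x.
  by rewrite -[dyson n.+1 t f]/(T0 t f + convol (dyson n) t f) BbB !BbD; ring.
rewrite CabsN => /le_trans; apply.
by rewrite le_eqVlt; apply/orP; left; apply/eqP; field; rewrite expf_neq0.
Qed.

End fixed_point.

End dyson_phillips.

(** * The perturbed semigroup *)

Section perturbed_semigroup.
Context {R : realType} {M : completeMetricType R}.
Local Notation lebesgue := (@lebesgue_measure R).
Local Notation RR := (measurableTypeR R).
Implicit Types (f g h : Bb M) (x : M) (s t r a : R) (U : R -> Bb M -> Bb M).
Variables (l0 : R) (Bt : R -> Bb M -> Bb M) (psi : R -> R).
Hypothesis HB : miyadera_family l0 Bt psi.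
Variables (T0 : R -> Bb M -> Bb M) (A : R).
Hypothesis A0 : 0 <= A.
Hypothesis T0_evolution : evolution_family l0 T0 A.
Hypothesis T00 : forall f, T0 0 f = f.
Hypothesis T0D : forall t s f, 0 <= t -> 0 <= s -> T0 (t + s) f = T0 t (T0 s f).
Hypothesis BtD : forall r s f, 0 < r -> 0 <= s -> Bt (r + s) f = Bt r (T0 s f).
Hypothesis T0_feller : forall t, 0 < t -> strong_feller (T0 t).
Hypothesis T0_cvg : forall f (u : nat -> R), continuous (f : M -> Cplx R) ->
  (forall n, 0 < u n) -> u @ \oo --> 0 -> bpcvg (fun n => T0 (u n) f) f.

Let P := perturbed HB A0 T0_evolution.
Let P_evolution : evolution_family l0 P (2 * A) := perturbed_evolution HB A0 T0_evolution.
Let A20 : 0 <= 2 * A. Proof. by rewrite mulr_ge0. Qed.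

Lemma evolution_family_lt0 U K t f : evolution_family l0 U K -> t < 0 -> U t f = 0.
Proof.
move=> [_ _ UK] t0; have [b b0 fb] := Bb_bounded f; apply: Bb_ext => x.
apply: Cabs_eq0; apply: le_trans (UK t f b fb x) _.
by rewrite /half_exp [0 <= t]leNgt t0 mulr0 mul0r.
Qed.

Lemma miyadera_operator_le0 s f : s <= 0 -> Bt s f = 0.
Proof.
move=> s0; have [b b0 fb] := Bb_bounded f; apply: Bb_ext => x.
apply: Cabs_eq0; apply: le_trans (miyadera_bounded HB s fb x) _.
by rewrite (miyadera_le0 HB s0) mul0r.
Qed.

Lemma perturbed0 f : P 0 f = f.
Proof.
rewrite /P perturbed_eq T00 -[RHS]addr0; congr (_ + _); apply: Bb_ext => x.
rewrite (convolE HB _ _ _ P_evolution)//; apply: cintegral0 => s.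
have [s0|s0] := leP s 0.
  rewrite miyadera_operator_le0// bp_operator0//.
  by have [bP _ _] := P_evolution.
by rewrite (evolution_family_lt0 _ P_evolution)// sub0r oppr_lt0.
Qed.

(** The integrand is continuous in the space variable except for [s = t], and
    dominated; continuity of the integral follows along sequences. *)
Lemma convol_feller U K : evolution_family l0 U K -> 0 <= K ->
  (forall t, 0 < t -> strong_feller (U t)) ->
  forall t, strong_feller (convol Bt U t).
Proof.
move=> eU K0 Uf t f; apply: sequentially_continuous => x u xu.
have [b b0 fb] := Bb_bounded f.
have dU := integrable_family_dominated (convol_family HB t eU K0) fb.
rewrite (convolE HB _ _ _ eU)//.
apply: (@eq_ccvg _ (fun n => cintegral lebesgue setT
    (fun s : RR => U (t - s) (Bt s f) (u n)))).
  by move=> n; rewrite /= (convolE HB _ _ _ eU).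
have [_ ik kU] := dU.
apply: (cdominated_convergence_ae _ _ _ ik).
- by move=> n; exact: dominated_family_section (u n) dU.
- exact: dominated_family_section x dU.
- exists [set t]; split => //; first exact: lebesgue_measure_set1.
  move=> s /= ns; apply: contrapT => /eqP st; apply: ns.
  have [ts|ts] := ltP t s.
    rewrite (evolution_family_lt0 _ eU) ?subr_lt0//; exact: ccvg_cst.
  have ts0 : 0 < t - s by rewrite subr_gt0 lt_def ts eq_sym st.
  apply/ccvgP => e e0.
  have [d d0 dP] := (continuous_CabsP _).1 (Uf _ ts0 (Bt s f)) x e e0.
  exists (Num.truncn d^-1) => n dn; rewrite CabsB; apply: dP.
  apply: lt_le_trans (xu n) _; rewrite -[leRHS]invrK lef_pV2 ?posrE ?invr_gt0//.
  by rewrite ltW// (lt_le_trans (truncnS_gt _))// ler_nat.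
- by move=> n s; exact: kU.
Qed.

Lemma dyson_feller n t : 0 < t -> strong_feller (dyson Bt T0 n t).
Proof.
elim: n t => [|n ih] t t0; first exact: T0_feller.
have cv := convol_feller (dyson_evolution HB A0 T0_evolution n) A20 ih.
move=> f x; rewrite (_ : Bb_fun _ = fun x => T0 t f x + convol Bt (dyson Bt T0 n) t f x)//.
exact: continuousD (T0_feller t0 (f := f) (x := x)) (cv t f x).
Qed.

Lemma perturbed_feller t : 0 < t -> strong_feller (P t).
Proof.
move=> t0 f; apply/continuous_CabsP => x e e0.
have [b b0 fb] := Bb_bounded f; have e40 : 0 < e / 4 by rewrite divr_gt0.
have /cvgrPdist_lt /(_ _ e40) [N _ /(_ N (leqnn N))] :=
  cvg_geom2 (2 * A * half_exp (- l0) t * b).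
rewrite /= sub0r normrN => Nc.
have dN y : Cabs (P t f y - dyson Bt T0 N t f y) < e / 4.
  have := perturbed_dist HB A0 T0_evolution N t fb y; rewrite BbB => /le_lt_trans; apply.
  apply: le_lt_trans Nc; apply: le_trans (ler_norm _).
  by rewrite le_eqVlt; apply/orP; left; apply/eqP; ring.
have [d d0 dP] := (continuous_CabsP _).1 (@dyson_feller N t t0 f) x _ e40.
exists d => // y /dP xy.
rewrite (_ : _ - _ = (P t f x - dyson Bt T0 N t f x) +
    ((dyson Bt T0 N t f x - dyson Bt T0 N t f y) -
     (P t f y - dyson Bt T0 N t f y))); last by ring.
apply: le_lt_trans (CabsD _ _) _; have := dN x; have := dN y.
have := CabsD (dyson Bt T0 N t f x - dyson Bt T0 N t f y)
  (- (P t f y - dyson Bt T0 N t f y)).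
by rewrite CabsN; lra.
Qed.

Lemma half_exp_bounded (u : nat -> R) (b : R) : (forall n, 0 <= u n) ->
  (forall n, u n <= b) -> forall n, half_exp (- l0) (u n) <= expR (`|l0| * b).
Proof.
move=> u0 ub n; rewrite /half_exp u0 ler_expR opprK.
apply: le_trans (ler_norm _) _; rewrite normrM (ger0_norm (u0 n)).
by rewrite ler_wpM2l.
Qed.

(** For [s > 0] the integrand of the convolution vanishes as soon as
    [u n < s]. *)
Lemma perturbed_cvg f (u : nat -> R) : continuous (f : M -> Cplx R) ->
  (forall n, 0 < u n) -> u @ \oo --> 0 -> bpcvg (fun n => P (u n) f) f.
Proof.
move=> cf u0 uc; have [b b0 fb] := Bb_bounded f.
have [c uk] := cvg_seq_ub uc.
have uE := half_exp_bounded (fun n => ltW (u0 n)) uk.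
have [_ _ PK] := P_evolution; split.
  exists (2 * A * expR (`|l0| * c) * b) => n x; apply: le_trans (PK _ _ _ fb x) _.
  by rewrite ler_wpM2r// ler_wpM2l.
move=> x; rewrite -[f x]addr0.
apply: (@eq_ccvg _ (fun n => T0 (u n) f x + convol Bt P (u n) f x)).
  by move=> n; rewrite -BbD /P -perturbed_eq.
apply: ccvgD; first by have [_] := T0_cvg cf u0 uc; exact.
rewrite -(@cintegral0 _ _ _ lebesgue (fun=> 0))//.
apply: (@eq_ccvg _ (fun n => cintegral lebesgue setT
    (fun s : RR => P (u n - s) (Bt s f) x))).
  by move=> n; rewrite (convolE HB _ _ _ P_evolution).
pose k s : R := expR (- (l0 * s)) * psi s.
have ik : lebesgue.-integrable setT
    (EFin \o (fun s : RR => 2 * A * expR (`|l0| * c) * b * k s)).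
  apply: integrable_EFinZ; exact: (miyadera_integrable HB).
have k0 s : 0 <= k s by rewrite mulr_ge0 ?expR_ge0// (miyadera_ge0 HB).
apply: (cdominated_convergence _ _ ik).
- move=> n; apply: dominated_family_section x _.
  exact: integrable_family_dominated (convol_family HB (u n) P_evolution A20) fb.
- move=> s; have [s0|s0] := leP s 0.
    rewrite miyadera_operator_le0//; apply: eq_ccvg (ccvg_cst 0) => n.
    by have [bP _ _] := P_evolution; rewrite bp_operator0.
  apply/ccvgP => e e0; move/cvgrPdist_lt : uc => /(_ _ s0)[N _ HN].
  exists N => n Nn; rewrite (evolution_family_lt0 _ P_evolution) ?subrr ?Cabs0//.
  rewrite subr_lt0; have := HN n Nn; rewrite /= sub0r normrN.
  exact/le_lt_trans/ler_norm.
- move=> n s.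
  apply: le_trans (evolution_family_apply HB (u n) s x P_evolution A20 fb) _.
  have := ler_wpM2r (k0 s) (ler_wpM2r b0 (ler_wpM2l A20 (uE n))).
  by rewrite /k; lra.
Qed.

(** Split at [r = s] and shift the part beyond [s], where
    [Bt (r + s) = Bt r \o T0 s]. *)
Lemma convol_split U K t s f x : evolution_family l0 U K -> 0 <= K ->
  0 <= t -> 0 <= s ->
  let F := fun r : RR =>
    (\1_(`]-oo, s] : set RR) r : R)%:C%C * U (t + (s - r)) (Bt r f) x in
  cintegrable lebesgue setT F /\
  convol Bt U (t + s) f x = convol Bt U t (T0 s f) x + cintegral lebesgue setT F.
Proof.
move=> eU K0 t0 s0; have [b b0 fb] := Bb_bounded f.
have dU := integrable_family_dominated (convol_family HB (t + s) eU K0) fb.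
rewrite !(convolE HB _ _ _ eU)//.
pose F r := U (t + s - r) (Bt r f) x.
pose G (r : RR) := (\1_(`]s, +oo[ : set RR) r : R)%:C%C * F r.
pose G' (r : RR) := (\1_(`]-oo, s] : set RR) r : R)%:C%C * F r.
have iF : cintegrable lebesgue setT (F : RR -> R[i]) := cintegrable_dominated x dU.
have mF := cintegrable_measurable iF.
have mI1 : measurable (`]s, +oo[ : set RR) by exact: measurable_itv.
have mI2 : measurable (`]-oo, s] : set RR) by exact: measurable_itv.
have iI (D : set RR) : measurable D ->
    cintegrable lebesgue setT (fun r : RR => (\1_D r : R)%:C%C * F r).
  move=> mD; have [_ ik Fk] := dU; apply: cintegrable_dom _ ik _.
    by apply: cmeasurableM => //; exact: cmeasurable_indic.
  move=> r; rewrite CabsM Cabs_real indicE; apply: le_trans (Fk r x).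
  by case: (_ \in _); rewrite ?normr1 ?mul1r// normr0 mul0r Cabs_ge0.
split.
  by apply: eq_cintegrable (iI _ mI2) => // r _; rewrite /F addrA.
transitivity (cintegral lebesgue setT (fun r : RR => G r + G' r)).
  apply: eq_cintegral => r _; rewrite /G /G' -mulrDl -rmorphD/= !indicE !mem_setE.
  by rewrite !in_itv/= andbT; case: ltP => _; rewrite /= ?addr0 ?add0r mul1r.
rewrite cintegralD; [|exact: iI|exact: iI]; congr (_ + _); last first.
  by apply: eq_cintegral => r _; rewrite /G' /F addrA.
rewrite -(cintegral_shift s (F := G)); last first.
  by apply: cmeasurableM => //; exact: cmeasurable_indic.
apply: eq_cintegral => r _; rewrite /G /F indicE mem_setE in_itv/= andbT ltrDr.
have -> : t + s - (r + s) = t - r by ring.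
have [r0|r0] := ltP 0 r; first by rewrite mul1r BtD.
rewrite mul0r miyadera_operator_le0//.
by have [bU _ _] := eU; rewrite bp_operator0.
Qed.

(** For fixed [t] the defect [D s = P (t + s) - P t \o P s] satisfies the
    homogeneous equation [D s = \int_0^s D (s - r) \o Bt r dr], hence vanishes
    by contraction. *)
Lemma perturbedD t s f : 0 <= t -> 0 <= s -> P (t + s) f = P t (P s f).
Proof.
move=> t0; have [bP mP PK] := P_evolution.
pose D s f x := P (t + s) f x - P t (P s f) x.
have DE s' f' x : 0 <= s' -> let F := fun r : RR =>
      (\1_(`]-oo, s'] : set RR) r : R)%:C%C * D (s' - r) (Bt r f') x in
    cmeasurable F /\ D s' f' x = cintegral lebesgue setT F.
  move=> s0 F; have [b b0 fb] := Bb_bounded f'.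
  have [i1 E1] := convol_split f' x P_evolution A20 t0 s0.
  have dU := integrable_family_dominated (convol_family HB s' P_evolution A20) fb.
  have [i2 E2] := bp_functional_mint (bP t x) dU.
  have FE r : F r = (\1_(`]-oo, s'] : set RR) r : R)%:C%C * P (t + (s' - r)) (Bt r f') x
      - P t (P (s' - r) (Bt r f')) x.
    rewrite /F /D indicE mem_setE in_itv/=; have [rs|rs] := leP r s'.
      by rewrite !mul1r.
    rewrite !mul0r (evolution_family_lt0 (t := s' - r) _ P_evolution) ?subr_lt0//.
    by rewrite bp_operator0// Bb0 subr0.
  have iF := cintegrableB i1 i2; split.
    by rewrite (funext FE); exact: cintegrable_measurable iF.
  rewrite (funext FE) cintegralB//.
  have E2' : P t (convol Bt P s' f') x =
    cintegral lebesgue setT (fun r : RR => P t (P (s' - r) (Bt r f')) x) := E2.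
  rewrite -E2' /D.
  have PE r g : P r g x = T0 r g x + convol Bt P r g x.
    by rewrite /P {1}perturbed_eq.
  have -> : P t (P s' f') x = P t (T0 s' f') x + P t (convol Bt P s' f') x.
    rewrite -BbD -bp_operatorD//; congr (Bb_fun (P t _) x).
    exact: perturbed_eq.
  rewrite (PE (t + s') f') E1 T0D// (PE t (T0 s' f')).
  by ring.
pose c := (2 * A + 2 * A * (2 * A)) * expR (l0 * t).
have c0 : 0 <= c by rewrite mulr_ge0 ?expR_ge0// addr_ge0// mulr_ge0.
have EM s' : 0 <= s' -> half_exp (- l0) (t + s') = expR (l0 * t) * half_exp (- l0) s'.
  move=> s0; rewrite /half_exp s0 addr_ge0// -expRD; congr expR.
  by ring.
(* the contraction, iterated [n] times from the bounds of [P] *)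
have Db n s' f' b x : 0 <= s' -> (forall x, Cabs (f' x) <= b) ->
    Cabs (D s' f' x) <= c / 2 ^+ n * half_exp (- l0) s' * b.
  elim: n s' f' b x => [|n ih] s' f' b x s0 fb.
    have b0 := le_trans (Cabs_ge0 _) (fb x).
    apply: le_trans (CabsD _ _) _; rewrite CabsN.
    have := PK (t + s') f' b fb x; have := PK t _ _ (PK s' f' b fb) x.
    have -> : half_exp (- l0) t = expR (l0 * t) by rewrite /half_exp t0 opprK.
    rewrite EM// expr0 divr1 /c; lra.
  have b0 := le_trans (Cabs_ge0 _) (fb x).
  have [mF ->] := DE s' f' x s0.
  have cn : 0 <= c / 2 ^+ n by rewrite divr_ge0// exprn_ge0.
  have ik := integrable_EFinZ (c / 2 ^+ n * half_exp (- l0) s' * b)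
    (miyadera_integrable HB).
  apply: le_trans (Cabs_cintegral mF ik _) _.
    move=> r; rewrite CabsM Cabs_real indicE mem_setE in_itv/=.
    have := ler_wpM2r b0 (ler_wpM2l cn (half_exp_weight HB s' r)).
    have [rs|rs] := leP r s'; last first.
      rewrite normr0 mul0r => _; have pr := miyadera_ge0 HB r.
      have er := expR_ge0 (- (l0 * r)); have hs := half_exp_ge0 (- l0) s'.
      exact: mulr_ge0 (mulr_ge0 (mulr_ge0 cn hs) b0) (mulr_ge0 er pr).
    rewrite normr1 mul1r => H.
    have sr : 0 <= s' - r by rewrite subr_ge0.
    have := ih _ _ _ x sr (miyadera_bounded HB r fb); move=> /le_trans; apply.
    by move: H; lra.
  rewrite RintegralZl//; last exact: (miyadera_integrable HB).
  have cb : 0 <= c / 2 ^+ n * half_exp (- l0) s' * b.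
    exact: mulr_ge0 (mulr_ge0 cn (half_exp_ge0 _ _)) b0.
  have := ler_wpM2l cb (miyadera_small HB).
  by rewrite exprS invfM; lra.
move=> s0; apply: Bb_ext => x; apply/eqP; rewrite -subr_eq0; apply/eqP.
have [b b0 fb] := Bb_bounded f.
pose c' := c * half_exp (- l0) s * b.
apply: (@ccvg_unique _ (fun=> D s f x) _ 0 (ccvg_cst _)).
apply: (@ccvg_dist _ _ _ (fun n => c' / 2 ^+ n)); last exact: cvg_geom2.
move=> n; rewrite subr0; apply: le_trans (Db n s f b x s0 fb) _.
by rewrite le_eqVlt; apply/orP; left; apply/eqP; rewrite /c'; ring.
Qed.

End perturbed_semigroup.

(** * Laplace transform of convolutions and Neumann series *)

Section laplace_transforms.
Context {R : realType} {M : completeMetricType R}.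
Local Notation lebesgue := (@lebesgue_measure R).
Local Notation RR := (measurableTypeR R).
Implicit Types (f g h : Bb M) (x : M) (s t r a : R) (U : R -> Bb M -> Bb M).
Variables (l0 : R) (Bt : R -> Bb M -> Bb M) (psi : R -> R).
Hypothesis HB : miyadera_family l0 Bt psi.
Variable lam : R[i].
Hypothesis lam_gt : l0 < Cre lam.

Let a := Cre lam.
Let al0 : 0 < a - l0. Proof. by rewrite subr_gt0. Qed.
Let ka s := expR (- (a * s)) * psi s.

Let ka_ge0 s : 0 <= ka s.
Proof. by rewrite mulr_ge0 ?expR_ge0// (miyadera_ge0 HB). Qed.

Let ka_le s : ka s <= expR (- (l0 * s)) * psi s.
Proof.
rewrite /ka; have [s0|s0] := leP s 0; first by rewrite (miyadera_le0 HB)// !mulr0.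
rewrite ler_wpM2r ?(miyadera_ge0 HB)// ler_expR lerN2 ler_wpM2r ?(ltW s0)//.
exact: ltW.
Qed.

Let measurable_expN (c : R) : measurable_fun setT (fun s : RR => expR (- (c * s))).
Proof.
by apply: measurableT_comp => //; apply: measurable_funN; exact: measurable_funM.
Qed.

Let measurable_ka : measurable_fun setT (ka : RR -> R).
Proof.
rewrite (_ : ka = fun s : RR => expR (- (- (l0 - a) * s)) *
    (expR (- (l0 * s)) * psi s)).
  apply: measurable_funM => //; apply/measurable_EFinP.
  exact: (measurable_int lebesgue (miyadera_integrable HB)).
apply/funext => s; rewrite mulrA -expRD; congr (expR _ * _).
by rewrite /a; ring.
Qed.

Let integrable_ka : lebesgue.-integrable setT (EFin \o (ka : RR -> R)).
Proof.
apply: le_integrable (miyadera_integrable HB) => //; first exact/measurable_EFinP.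
move=> s _; rewrite /= lee_fin !ger0_norm//.
by rewrite mulr_ge0 ?expR_ge0// (miyadera_ge0 HB).
Qed.

Definition laplace U : Bb M -> Bb M :=
  integral_operator (fun t f => cdecay lam t *: U t f).

Lemma laplace_evolution_family U K : evolution_family l0 U K -> 0 <= K ->
  integrable_family (fun t f => cdecay lam t *: U t f)
    (fun t => K * half_exp (a - l0) t).
Proof.
move=> [bU mU UK] K0; split.
- move=> t x; apply: eq_bp_functional (bp_functionalM (cdecay lam t) (bU t x)).
  by move=> f; rewrite BbZ.
- move=> f; apply: cmeasurableM; last exact: mU.
  exact: (cmeasurable_comp (cmeasurable_cdecay lam) measurable_fst).
- move=> t f b fb x; rewrite BbZ CabsM Cabs_cdecay.
  apply: le_trans (ler_wpM2l (half_exp_ge0 _ _) (UK t f b fb x)) _.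
  rewrite le_eqVlt; apply/orP; left; apply/eqP; rewrite -/a /half_exp.
  case: ifP => _; last by rewrite !mulr0 !mul0r.
  rewrite (_ : - (a - l0) * t = - a * t + - - l0 * t); last by ring.
  by rewrite expRD; ring.
- exact: integrable_EFinZ (integrable_half_exp al0).
Qed.

Lemma laplace_miyadera_family :
  integrable_family (fun t f => cdecay lam t *: Bt t f)
    (fun s => expR (- (l0 * s)) * psi s).
Proof.
split.
- move=> t x.
  apply: eq_bp_functional (bp_functionalM (cdecay lam t) (miyadera_bp HB t x)).
  by move=> f; rewrite BbZ.
- move=> f; apply: cmeasurableM; last exact: (miyadera_measurable HB f).
  exact: (cmeasurable_comp (cmeasurable_cdecay lam) measurable_fst).
- move=> s f b fb x; rewrite BbZ CabsM Cabs_cdecay.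
  have b0 := le_trans (Cabs_ge0 _) (fb x).
  apply: le_trans (ler_wpM2l (half_exp_ge0 _ _) (miyadera_bounded HB s fb x)) _.
  apply: le_trans (ler_wpM2r b0 (ka_le s)); rewrite /ka mulrA ler_wpM2r//.
  rewrite ler_wpM2r ?(miyadera_ge0 HB)// /half_exp; case: ifP => _.
    by rewrite mulNr.
  exact: expR_ge0.
- exact: miyadera_integrable HB.
Qed.

Lemma laplace_miyadera_bounded : bounded_operator (laplace Bt) 2^-1.
Proof.
move=> f b fb x; have b0 := le_trans (Cabs_ge0 _) (fb x).
apply: le_trans (integral_operator_bounded laplace_miyadera_family fb x) _.
rewrite ler_wpM2r//; have := miyadera_small HB; lra.
Qed.

Lemma laplace_miyadera_bp : bp_operator (laplace Bt).
Proof. exact: integral_operator_bp laplace_miyadera_family. Qed.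

(** Neumann series: [laplace Bt] has norm at most 1/2, and the iterates
    converge uniformly. *)
Lemma laplace_miyadera_surjective g : exists h, h - laplace Bt h = g.
Proof.
have [u [u0 uS]] : exists u : nat -> Bb M,
    u 0%N = g /\ forall n, u n.+1 = g + laplace Bt (u n).
  by exists (fix u n := if n is m.+1 then g + laplace Bt (u m) else g).
have [b b0 gb] := Bb_bounded g.
have us n : forall x, Cabs (u n.+1 x - u n x) <= b / 2 ^+ n.
  elim: n => [|n ih] x.
    rewrite uS u0 BbD [X in X - _]addrC addrK expr0 divr1.
    apply: le_trans (laplace_miyadera_bounded gb x) _; lra.
  rewrite (_ : u n.+2 x - u n.+1 x = laplace Bt (u n.+1 - u n) x).
    have ih' y : Cabs ((u n.+1 - u n) y) <= b / 2 ^+ n by exact: ih.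
    by have := laplace_miyadera_bounded ih' x; rewrite exprS invfM; lra.
  rewrite (bp_operatorB _ _ laplace_miyadera_bp) BbB.
  have -> : u n.+2 x = g x + laplace Bt (u n.+1) x by rewrite -BbD -uS.
  have -> : u n.+1 x = g x + laplace Bt (u n) x by rewrite -BbD -uS.
  by rewrite opprD addrACA subrr add0r.
have lim x : exists l, ccvg (fun n => u n x) l /\
    forall n, Cabs (l - u n x) <= 2 * b / 2 ^+ n.
  have [l ul lb] := ccvg_geometric (fun n => us n x).
  by exists l; split.
have [F FP] := choice lim.
have FE x : to_Bb F x = F x.
  apply: to_BbE.
    apply: (cmeasurable_lim (F_ := fun n => (u n : borel M -> R[i]))).
      by move=> n; exact: cmeasurable_Bb.
    by move=> y; have [] := FP y.
  exists (2 * b + b) => y; rewrite -(subrK (g y) (F y)).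
  apply: le_trans (CabsD _ _) _; rewrite lerD//.
  by have [_ /(_ 0%N)] := FP y; rewrite expr0 divr1 u0.
exists (to_Bb F); apply/eqP; rewrite subr_eq; apply/eqP; apply: Bb_ext => x.
have cF : ccvg (fun n => u n.+1 x) (to_Bb F x).
  by rewrite FE; exact: (ccvg_shift (FP x).1).
apply: ccvg_unique cF _.
apply: (@ccvg_dist _ _ _ (fun n => b / 2 ^+ n)); last exact: cvg_geom2.
move=> n; rewrite (_ : u n.+1 x - _ = - laplace Bt (to_Bb F - u n) x).
  rewrite CabsN.
  have Fu y : Cabs ((to_Bb F - u n) y) <= 2 * b / 2 ^+ n.
    by rewrite BbB FE; have [_] := FP y; exact.
  have := laplace_miyadera_bounded Fu x; lra.
rewrite (bp_operatorB _ _ laplace_miyadera_bp) BbB.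
have -> : u n.+1 x = g x + laplace Bt (u n) x by rewrite -BbD -uS.
by rewrite BbD opprD addrACA subrr add0r opprB.
Qed.

Section convolution_theorem.
Variables (U : R -> Bb M -> Bb M) (K : R).
Hypotheses (eU : evolution_family l0 U K) (K0 : 0 <= K).

Let F f x (z : RR * RR) : R[i] := cdecay lam z.1 * U (z.1 - z.2) (Bt z.2 f) x.
Let G (c : R) (z : RR * RR) : R := c * (half_exp (a - l0) (z.1 - z.2) * ka z.2).

Let F_dom f x b z : (forall x, Cabs (f x) <= b) ->
  Cabs (F f x z) <= G (K * b) z.
Proof.
case: z => t s fb; have b0 := le_trans (Cabs_ge0 _) (fb x).
have [_ _ UK] := eU.
rewrite /F /G CabsM Cabs_cdecay /=.
have H := UK (t - s) _ _ (miyadera_bounded HB s fb) x.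
apply: le_trans (ler_wpM2l (half_exp_ge0 _ _) H) _.
rewrite /ka; have [s0|s0] := leP s 0.
  by rewrite (miyadera_le0 HB)// mul0r !mulr0.
rewrite le_eqVlt; apply/orP; left; apply/eqP.
rewrite -/a /half_exp; have [ts|ts] := leP 0 (t - s); last by rewrite !mulr0 !mul0r !mulr0.
rewrite (_ : 0 <= t = true); last by apply/idP; lra.
have -> : expR (- a * t) * (K * expR (- - l0 * (t - s)) * (psi s * b)) =
  K * b * ((expR (- a * t) * expR (- - l0 * (t - s))) * psi s) by ring.
have -> : expR (- a * t) * expR (- - l0 * (t - s)) =
    expR (- (a - l0) * (t - s)) * expR (- (a * s)).
  by rewrite -!expRD; congr expR; ring.
by rewrite !mulrA.
Qed.

Let measurable_F f x : cmeasurable (F f x).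
Proof.
apply: cmeasurableM.
  exact: (cmeasurable_comp (cmeasurable_cdecay lam) measurable_fst).
apply: (cmeasurable_comp (h := fun z : RR * RR => ((z.2, z.1), x) : (RR * RR) * borel M)
  (convol_integrand_measurable HB f eU)).
apply: measurable_fun_pair; last exact: measurable_cst.
by apply: measurable_fun_pair; [exact: measurable_snd|exact: measurable_fst].
Qed.

Let measurable_G c : measurable_fun setT (G c).
Proof.
apply: measurable_funM => //; apply: measurable_funM; last first.
  exact: (measurableT_comp measurable_ka measurable_snd).
apply: (measurableT_comp (measurable_half_exp (a - l0))).
by apply: measurable_funB; [exact: measurable_fst|exact: measurable_snd].
Qed.

Let integrable_G1 c s : lebesgue.-integrable setT (fun t : RR => (G c (t, s))%:E).
Proof.
have i1 := integrable_shift (- s) (integrable_half_exp al0).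
have := integrable_EFinZ (c * ka s) i1.
by apply: eq_integrable => // t _; rewrite /G /=; congr EFin; ring.
Qed.

Let integrable_G2 c t : lebesgue.-integrable setT (fun s : RR => (G c (t, s))%:E).
Proof.
apply: le_integrable (integrable_EFinZ c integrable_ka) => //.
  apply/measurable_EFinP.
  exact: (measurableT_comp (measurable_G c) (@measurable_pair1 _ _ _ _ t)).
move=> s _; rewrite /G /= lee_fin !normrM ler_wpM2l// ler_piMl//.
by rewrite ger0_norm ?half_exp_ge0 ?half_exp_le1.
Qed.

Let integrable_G c : 0 <= c -> (lebesgue \x lebesgue)%E.-integrable setT (EFin \o G c).
Proof.
move=> c0; apply/integrable21ltyP; first exact/measurable_EFinP.
have Ei s : (\int[lebesgue]_t `|(EFin \o G c) (t, s)| =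
    (c * (a - l0)^-1 * ka s)%:E)%E.
  under eq_integral => t _.
    rewrite /= /G/= ger0_norm; last first.
      exact: mulr_ge0 c0 (mulr_ge0 (half_exp_ge0 _ _) (ka_ge0 s)).
    over.
  rewrite (_ : (c * _ * _)%:E = (\int[lebesgue]_t G c (t, s))%:E).
    by rewrite /Rintegral fineK//; exact: integrable_fin_num (integrable_G1 c s).
  congr EFin.
  rewrite (_ : \int[_]_t _ = \int[lebesgue]_t ((c * ka s) * half_exp (a - l0) (t + - s))).
    rewrite RintegralZl//; last exact: integrable_shift (integrable_half_exp al0).
    rewrite (Rintegral_shift (- s) (measurable_half_exp (a - l0))).
    by rewrite Rintegral_half_exp//; ring.
  by apply: eq_Rintegral => t _; rewrite /G/=; ring.
under eq_integral do rewrite Ei.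
by apply: integrable_lty => //; exact: integrable_EFinZ.
Qed.

(** The Laplace transform turns convolution into composition: Fubini's theorem,
    then a shift by [s] in the inner integral. *)
Lemma laplace_convol f : laplace (convol Bt U) f = laplace U (laplace Bt f).
Proof.
have [b b0 fb] := Bb_bounded f; apply: Bb_ext => x.
have [bU _ _] := eU.
have FE t s : F f x (t, s) = cdecay lam t * U (t - s) (Bt s f) x by [].
have Kb : 0 <= K * b by rewrite mulr_ge0.
have K20 : 0 <= K / 2 by rewrite divr_ge0.
have iU := laplace_evolution_family eU K0.
rewrite (integral_operatorE _ _
  (laplace_evolution_family (convol_evolution HB eU K0) K20)).
have [_ Efub] := cintegral_fubini (measurable_F f x) (fun z => F_dom x z fb)
  (integrable_G Kb) (integrable_G2 (K * b)) (integrable_G1 (K * b)).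
transitivity (cintegral lebesgue setT (fun t : RR =>
    cintegral lebesgue setT (fun s : RR => F f x (t, s)))).
  apply: eq_cintegral => t _; rewrite BbZ (convolE HB t f x eU K0).
  have dU := integrable_family_dominated (convol_family HB t eU K0) fb.
  exact: (esym (cintegralZ (cdecay lam t) (cintegrable_dominated x dU))).
rewrite Efub.
have dB := integrable_family_dominated laplace_miyadera_family fb.
have [_ ->] := bp_functional_mint (integral_operator_bp iU x) dB.
apply: eq_cintegral => s _.
rewrite (bp_operatorZ _ _ (integral_operator_bp iU)) BbZ.
have [s0|s0] := leP s 0.
  have Bs0 : Bt s f = 0 by exact: (miyadera_operator_le0 HB).
  rewrite Bs0 (bp_operator0 (integral_operator_bp iU)) Bb0 mulr0.
  suff Z t : F f x (t, s) = 0.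
    by exact: (@cintegral0 _ _ _ lebesgue (fun t => F f x (t, s)) Z).
  by rewrite FE Bs0 (bp_operator0 (bU (t - s))) Bb0 mulr0.
rewrite (integral_operatorE _ _ iU) -cintegralZ; last first.
  have [b' _ fb'] := Bb_bounded (Bt s f).
  exact: cintegrable_dominated x (integrable_family_dominated iU fb').
rewrite -(cintegral_shift s (F := fun t => F f x (t, s))); last first.
  exact: (cmeasurable_comp (measurable_F f x) (@measurable_pair2 _ _ _ _ s)).
apply: eq_cintegral => t _; rewrite FE addrK BbZ.
have [t0|t0] := leP 0 t; last first.
  by rewrite (evolution_family_lt0 _ eU t0) Bb0 !mulr0.
by rewrite [t + s]addrC (cdecayD lam (ltW s0) t0) -mulrA.
Qed.

End convolution_theorem.

End laplace_transforms.

(** * The generator and the integral equation *)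

Lemma at_right_ccvg {R : realType} (F : R -> R[i]) (l : R[i]) :
  (forall u : nat -> R, (forall n, 0 < u n) -> u @ \oo --> 0 ->
    ccvg (fun n => F (u n)) l) ->
  (fun t => F t : Cplx R) @ 0^'+ --> (l : Cplx R).
Proof.
move=> H; apply/cvg_ballP => -[e1 e2]; rewrite ltcE/= => /andP[/eqP -> e0].
apply: contrapT => nF.
have bad n : exists t, [/\ 0 < t, t < n.+1%:R^-1 & e1 <= Cabs (F t - l)].
  apply: contrapT => nt; apply: nF; exists n.+1%:R^-1; rewrite /= ?invr_gt0// => t.
  rewrite /= sub0r normrN => tn t0; rewrite /ball/= CnormE ltcR CabsB ltNge.
  apply/negP => le; apply: nt; exists t; split => //.
  exact: le_lt_trans (ler_norm t) tn.
have [u uP] := choice bad.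
have u0 n : 0 < u n by have [] := uP n.
have uc : u @ \oo --> 0.
  apply/cvgrPdist_lt => d d0; have [N _ HN] := near_infty_natSinv_lt (PosNum d0).
  exists N => // n /= /HN /= nd; rewrite sub0r normrN gtr0_norm//.
  by have [_ un _] := uP n; exact: lt_trans un nd.
have /ccvgP /(_ e1 e0)[N /(_ N (leqnn N))] := H u u0 uc.
by have [_ _] := uP N; rewrite leNgt => /negP.
Qed.

Section M_integrals.
Context {R : realType} {M : completeMetricType R}.
Local Notation RR := (measurableTypeR R).
Implicit Types (f g h : Bb M) (Phi Psi : R -> Bb M) (k : R -> R).

Lemma is_Mintegral_mint (J : set RR) Phi Psi k : measurable J ->
  dominated_family Psi k -> (forall s, J s -> Phi s = Psi s) ->
  (forall s, ~ J s -> Psi s = 0) -> is_Mintegral J Phi (mint Psi).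
Proof.
move=> mJ dP JE J0 mu; have bm := bp_functional_pairing mu.
have E s : (\1_J s : R)%:C%C * pairing (Phi s) mu = pairing (Psi s) mu.
  rewrite indicE; have [Js|nJs] := pselect (J s).
    by rewrite mem_set// mul1r JE.
  by rewrite memNset// mul0r J0// (bp_functional0 bm).
have [i1 E1] := bp_functional_mint bm dP; split.
  by apply/(cintegrable_mkcond _ _ mJ); apply: eq_cintegrable i1 => // s _; rewrite E.
by rewrite E1 [RHS]cintegral_mkcond; apply: eq_cintegral => s _; rewrite E.
Qed.

Lemma Mintegrable_dominated (J : set RR) Phi Psi k : measurable J ->
  dominated_family Psi k -> (forall s, J s -> Phi s = Psi s) ->
  (forall s, ~ J s -> Psi s = 0) -> Mintegrable J Phi.
Proof.
move=> mJ [mP ik Pk] JE J0 A mA AJ.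
exists (mint (fun s => (\1_A s : R)%:C%C *: Psi s)).
apply: (is_Mintegral_mint (k := k)) => //.
- split => //.
    apply: cmeasurableM => //.
    exact: (cmeasurable_comp (cmeasurable_indic mA) measurable_fst).
  move=> s x; rewrite BbZ CabsM Cabs_real indicE; apply: le_trans (Pk s x).
  by case: (_ \in _); rewrite ?normr1 ?mul1r// normr0 mul0r Cabs_ge0.
- by move=> s /JE ->.
- by move=> s /J0 ->; rewrite scaler0.
Qed.

End M_integrals.

Section laplace_of_evolution.
Context {R : realType} {M : completeMetricType R}.
Implicit Types (f g h : Bb M) (U : R -> Bb M -> Bb M).

Lemma laplace_transform_evolution (l0 : R) U K : evolution_family l0 U K -> 0 <= K ->
  laplace_transform U l0 (fun lam => laplace lam U).
Proof.
move=> eU K0 lam ll; have iU := laplace_evolution_family ll eU K0; split.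
  exact: bp_operator_sigma (integral_operator_bp iU) (integral_operator_bounded iU).
move=> f mu F; have [b b0 fb] := Bb_bounded f; have bm := bp_functional_pairing mu.
have [i1 E1] := bp_functional_mint bm (integrable_family_dominated iU fb).
have E t : pairing (cdecay lam t *: U t f) mu =
    (\1_(`[0, +oo[ : set (measurableTypeR R)) t : R)%:C%C * F t.
  by rewrite (bp_functionalZ _ _ bm) /cdecay mulrA.
split.
  apply/cintegrable_mkcond; first exact: measurable_itv.
  by apply: eq_cintegrable i1 => // t _; exact: E.
rewrite [RHS]cintegral_mkcond -[laplace lam U f]/(mint _) E1.
by apply: eq_cintegral => t _; exact: E.
Qed.

End laplace_of_evolution.

(** Laplace transform of the equation [P = T0 + convol P]. *)
Lemma laplace_perturbed {R : realType} {M : completeMetricType R} (l0 A : R)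
    (Bt : R -> Bb M -> Bb M) (psi : R -> R) (T0 : R -> Bb M -> Bb M)
    (HB : miyadera_family l0 Bt psi) (A0 : 0 <= A)
    (T0_evolution : evolution_family l0 T0 A) (lam : R[i]) (h : Bb M) :
  l0 < Cre lam ->
  laplace lam (perturbed HB A0 T0_evolution) (h - laplace lam Bt h) =
  laplace lam T0 h.
Proof.
move=> ll; set P := perturbed HB A0 T0_evolution.
have eP : evolution_family l0 P (2 * A) := perturbed_evolution HB A0 T0_evolution.
have A20 : 0 <= 2 * A by rewrite mulr_ge0.
have A21 : 0 <= 2 * A / 2 by rewrite divr_ge0.
have iP := laplace_evolution_family ll eP A20.
have iT := laplace_evolution_family ll T0_evolution A0.
have iC := laplace_evolution_family ll (convol_evolution HB eP A20) A21.
have [b b0 hb] := Bb_bounded h.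
have bP : bp_operator (laplace lam P) := integral_operator_bp iP.
rewrite (bp_operatorB _ _ bP) -(laplace_convol HB ll eP A20).
apply/eqP; rewrite subr_eq; apply/eqP; apply: Bb_ext => x.
rewrite BbD (integral_operatorE _ _ iP) (integral_operatorE _ _ iT).
rewrite (integral_operatorE _ _ iC) -cintegralD; last 2 first.
- exact: cintegrable_dominated x (integrable_family_dominated iT hb).
- exact: cintegrable_dominated x (integrable_family_dominated iC hb).
apply: eq_cintegral => t _.
by rewrite -BbD -scalerDr /P -perturbed_eq.
Qed.

(** With [f = Rs lam h] and [(f, g)] in [L] one has
    [lam *: f - (g + B f) = h - B (Rs lam h)], so inverting [lam - (L + B)] amounts
    to inverting [id - B \o Rs lam] and applying [Rs lam]. *)
Lemma resolvent_perturb {R : realType} {M : completeMetricType R} (w : R)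
    (Rs : R[i] -> Bb M -> Bb M) (L : set (Bb M * Bb M)) (B Q : Bb M -> Bb M)
    (lam : R[i]) : has_resolvent L w Rs -> w < Cre lam ->
  (forall h : Bb M, Q (h - B (Rs lam h)) = Rs lam h) ->
  (forall g : Bb M, exists h, h - B (Rs lam h) = g) ->
  inverse_op (scalar_minus lam (perturb L B)) = graph Q.
Proof.
move=> L_res wl QE onto; apply/seteqP; split.
  move=> _ [_ [_ [[f g] Lfg <-] <-] <-] /=.
  have fE := (generator_resolvent L_res f g wl).1 Lfg.
  exists (lam *: f - (g + B f)) => //; congr pair.
  by rewrite [in RHS]fE -QE -fE opprD addrA.
move=> _ [g _ <-]; have [h hg] := onto g.
pose f := Rs lam h.
have Lf : L (f, lam *: f - h).
  by apply/(generator_resolvent L_res _ _ wl); rewrite opprB addrC subrK.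
exists (f, lam *: f - (lam *: f - h + B f)).
  exists (f, lam *: f - h + B f) => //.
  by exists (f, lam *: f - h).
rewrite /=; congr pair; first by rewrite opprD addrA subKr.
by rewrite -hg QE.
Qed.

Theorem theorem3p3 (R : realType) (M : completeMetricType R)
  (M_separable : separable_space M)
  (T : R -> Bb M -> Bb M) (C w : R) (Rs : R[i] -> Bb M -> Bb M)
  (L : set (Bb M * Bb M))
  (T_sfs : strong_feller_semigroup T)
  (T_type : of_type T C w)
  (T_laplace : laplace_transform T w Rs)
  (L_generator : has_resolvent L w Rs)
  (DB : set (Bb M)) (B : Bb M -> Bb M)
  (B_linear : linear_operator_on DB B)
  (L_DB : dom L `<=` DB)
  (BR_sigma : exists2 lam : R[i], w < Cre lam & sigma_operator (B \o Rs lam))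
  (BT : R -> Bb M -> Bb M)
  (BT_extension : forall t, 0 < t ->
     sigma_operator (BT t) /\ forall f, dom L f -> BT t f = B (T t f))
  (BT_measurable : forall f (mu : cmeasure R (borel M)),
     measurable_fun (`]0, +oo[ : set R)
       ((fun s => pairing (BT s f) mu) : R -> borel (Cplx R)))
  (phi : R -> R)
  (phi_integrable : forall a, 0 <= a ->
     lebesgue_measure.-integrable `[0, a] (EFin \o phi))
  (BT_bound : forall s, 0 < s -> (opnorm (BT s) <= (phi s)%:E)%E) :
  exists P : R -> Bb M -> Bb M,
    [/\ strong_feller_semigroup P,
        is_full_generator (perturb L B) P
      & forall (t : R) (f : Bb M), 0 <= t ->
          let Phi s := P (t - s) (BT s f) in
          Mintegrable `]0, t] Phi /\
          exists2 u, is_Mintegral `]0, t] Phi u & P t f = T t f + u].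
Proof.
have [l0 wl0 HB] := extendB_miyadera T_sfs T_type T_laplace L_generator BR_sigma
  BT_extension phi_integrable BT_bound.
have wl : w < l0 := le_lt_trans (ler_norm w) wl0.
pose T0 := extend0 T.
have T0E t f : 0 <= t -> T0 t f = T t f by rewrite /T0 /extend0 => ->.
have T0_evolution : evolution_family l0 T0 `|C|.
  split.
  - move=> t; have [t0|t0] := leP 0 t.
      rewrite (_ : T0 t = T t); first exact: (semigroup_bp T_sfs t0).
      by apply/funext => f; exact: T0E.
    rewrite (_ : T0 t = fun=> 0).
      move=> x; split; first by move=> c f g; rewrite Bb0 mulr0 addr0.
      by move=> f_ f _; exact: ccvg_cst.
    by apply/funext => f; rewrite /T0 /extend0 leNgt t0.
  - by move=> f; exact: semigroup_measurable T_sfs T_type f.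
  - move=> t f b fb x; rewrite /T0 /extend0 /half_exp; case: ifP => t0; last first.
      by rewrite Bb0 Cabs0 mulr0 mul0r.
    apply: le_trans (semigroup_bounded T_sfs T_type t0 fb x) _.
    rewrite ler_wpM2r ?(le_trans (Cabs_ge0 _) (fb x))//.
    apply: le_trans (ler_wpM2r (expR_ge0 _) (ler_norm C)) _.
    by rewrite ler_wpM2l// ler_expR opprK ler_wpM2r// ltW.
have C0 := normr_ge0 C.
have C20 : 0 <= 2 * `|C| by rewrite mulr_ge0.
have T00 f : T0 0 f = f by rewrite T0E// (sfs0 T_sfs).
have T0D t s f : 0 <= t -> 0 <= s -> T0 (t + s) f = T0 t (T0 s f).
  by move=> t0 s0; rewrite !T0E ?addr_ge0// (semigroupD T_sfs).
have BD r s f : 0 < r -> 0 <= s -> extendB BT (r + s) f = extendB BT r (T0 s f).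
  move=> r0 s0; rewrite /extendB r0 (ltr_wpDr s0 r0) T0E//.
  exact: (BT_semigroup T_sfs T_type T_laplace L_generator BR_sigma BT_extension).
have T0_feller t : 0 < t -> strong_feller (T0 t).
  move=> t0 f; rewrite T0E; last exact: ltW.
  exact: (sfs_strong_feller T_sfs t0 (f := f)).
have T0_cvg (f : Bb M) (u : nat -> R) : continuous (f : M -> Cplx R) ->
    (forall n, 0 < u n) -> u @ \oo --> 0 -> bpcvg (fun n => T0 (u n) f) f.
  move=> cf u0 uc; have := semigroup_bpcvg0 T_sfs T_type cf u0 uc.
  rewrite (_ : (fun n => T (u n) f) = fun n => T0 (u n) f)//.
  by apply/funext => n; rewrite T0E// ltW.
pose P := perturbed HB C0 T0_evolution.
have eP : evolution_family l0 P (2 * `|C|) := perturbed_evolution HB C0 T0_evolution.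
have [bP mP PK] := eP.
exists P; split.
- split.
  + by move=> t _; exact: bp_operator_sigma (bP t) (PK t).
  + by apply/funext => f; exact: perturbed0.
  + by move=> t s t0 s0; apply/funext => f; exact: perturbedD.
  + by move=> t t0; exact: perturbed_feller.
  + move=> f cf; apply/cvg_sigma_top => mu; apply: at_right_ccvg => u u0 uc.
    have Pf : bpcvg (fun n => P (u n) f) f by exact: perturbed_cvg.
    exact: ((bp_functional_pairing mu).2 _ _ Pf).
- exists (2 * `|C|), l0, (fun lam => laplace lam P); split.
  + move=> t t0; apply: opnorm_le; first by rewrite mulr_ge0 ?expR_ge0.
    by have := PK t; rewrite /half_exp t0 opprK.
  + exact: laplace_transform_evolution eP C20.
  + move=> lam ll; have wlam : w < Cre lam := lt_trans wl ll.
    have BR f : B (Rs lam f) = laplace lam (extendB BT) f.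
      exact: (BR_integral T_sfs T_type T_laplace L_generator BR_sigma BT_extension
        phi_integrable BT_bound f (lt_trans wl0 ll)).
    apply: (resolvent_perturb L_generator wlam) => [h|g]; last first.
      have [h hg] := laplace_miyadera_surjective HB ll g.
      by exists h; rewrite BR.
    rewrite BR laplace_perturbed//.
    by rewrite (resolvent_mint T_sfs T_type T_laplace h wlam).
- move=> t f t0 Phi; have [b b0 fb] := Bb_bounded f.
  have dP := integrable_family_dominated (convol_family HB t eP C20) fb.
  have mJ : measurable (`]0, t] : set (measurableTypeR R)) by exact: measurable_itv.
  have PhiJ s : (`]0, t]%classic : set R) s -> Phi s = P (t - s) (extendB BT s f).
    by rewrite /= in_itv/= /Phi /extendB => /andP[->].
  have PhiJ0 s : ~ (`]0, t]%classic : set R) s -> P (t - s) (extendB BT s f) = 0.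
    rewrite /= in_itv/= => /negP; rewrite negb_and -leNgt -ltNge => /orP[s0|ts].
      by rewrite (miyadera_operator_le0 HB)// (bp_operator0 (bP _)).
    by rewrite (evolution_family_lt0 _ eP)// subr_lt0.
  split; first exact: Mintegrable_dominated mJ dP PhiJ PhiJ0.
  exists (mint (fun s => P (t - s) (extendB BT s f))).
    exact: is_Mintegral_mint mJ dP PhiJ PhiJ0.
  by rewrite -(T0E t f t0) {1}/P perturbed_eq.
Qed.
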